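(* Let $Q=\{q(k)\}_{k\ge1}$ be a strictly increasing sequence of positive integers with $q(k+1)/q(k)\to\infty$. Then $\mathrm{PLA}+\mathcal{L}_{-Q}\neq L^0(\mathbb{T})$, i.e. there is $f\in L^0(\mathbb{T})$ that cannot be written as $f=g+h$ with $g\in\mathrm{PLA}$ and $h\in\mathcal{L}_{-Q}$.
   Context: $\mathbb{T}=\mathbb{R}/2\pi\mathbb{Z}$; $L^0(\mathbb{T})$ is the space of measurable, a.e. finite functions on $\mathbb{T}$. $\mathrm{PLA}$ denotes the set of measurable functions $g$ on $\mathbb{T}$ for which there exist complex numbers $c(n)$, $n\ge0$, such that $\sum_{0\le n<N}c(n)e^{int}\to g(t)$ as $N\to\infty$ for almost every $t$. For $S\subset\mathbb{Z}$, $\mathcal{L}_S=\{f\in L^1(\mathbb{T}):\widehat f(n)=0\ \forall n\notin S\}$, and $-Q=\{-q(k):k\ge1\}$. *)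

(* Defs.v *)
(* Functions on T = R/2piZ are represented as
   functions R -> R[i] considered on the fundamental domain [0, 2pi),
   with Lebesgue measure on R. *)
From mathcomp Require Import all_boot all_order all_algebra.
From mathcomp Require Import all_classical all_reals all_analysis.
From mathcomp Require Import complex.
Set Implicit Arguments.
Unset Strict Implicit.
Unset Printing Implicit Defensive.
Import Order.TTheory GRing.Theory Num.Theory.
Import numFieldNormedType.Exports.
Local Open Scope classical_set_scope.
Local Open Scope ring_scope.

Definition Tdom (R : realType) : set R := `[0, 2 * pi[%classic.
Arguments Tdom R : clear implicits.

Definition cexpi (R : realType) (x : R) : R[i] := Complex (cos x) (sin x).

(* complex-valued measurable functions on T (elements of L^0(T);
   complex values are automatically finite) *)
Definition cmeasurable (R : realType) (f : R -> R[i]) : Prop :=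
  measurable_fun (Tdom R) (fun x => complex.Re (f x)) /\
  measurable_fun (Tdom R) (fun x => complex.Im (f x)).

Definition cintegrable (R : realType) (f : R -> R[i]) : Prop :=
  (@lebesgue_measure R).-integrable (Tdom R) (fun x => (complex.Re (f x))%:E) /\
  (@lebesgue_measure R).-integrable (Tdom R) (fun x => (complex.Im (f x))%:E).

Definition cintegral (R : realType) (f : R -> R[i]) : R[i] :=
  Complex (Rintegral (@lebesgue_measure R) (Tdom R) (fun x => complex.Re (f x)))
          (Rintegral (@lebesgue_measure R) (Tdom R) (fun x => complex.Im (f x))).

Definition fourier_coef (R : realType) (f : R -> R[i]) (n : int) : R[i] :=
  Complex (2 * pi)^-1 0 * cintegral (fun t => f t * cexpi (- (n%:~R * t))).

Definition LS (R : realType) (S : set int) (f : R -> R[i]) : Prop :=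
  cintegrable f /\ forall n : int, ~ S n -> fourier_coef f n = 0.

Definition PLA (R : realType) (g : R -> R[i]) : Prop :=
  cmeasurable g /\
  exists c : nat -> R[i],
    {ae (@lebesgue_measure R), forall t, Tdom R t ->
       (fun N : nat => Normc.normc (\sum_(0 <= n < N) c n * cexpi (n%:R * t) - g t))
         @ \oo --> (0 : R)}.

Definition negQ (q : nat -> nat) : set int := [set n | exists k, n = - (q k)%:Z].

(* Main.v *)
(** The function is the sum f of the series of eps_n e^(-i p_n t), where
  eps_n = r^(2*4^n) for a constant r < 1 (called [decay]), and the p_n are
  chosen together with angles th_n > 0 such that, for all j,
    |e^(i q_j th_n) - 1| <= eps_n^2   while   |e^(i p_n th_n) - 1| >= 1.
  Write Du(t) = u(t + th_n) - u(t).  If f = g + h, then: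
  - Dh is small in L^1.  Lacunarity makes the Fourier coefficients of h square
    summable (test h against the products of 1 + i Re(b_j e^(i q_j t))), those
    of Dh are at most eps_n^2 times as large, and Fejer means of h converge in
    L^1; so the norm of Dh is O(eps_n^2).
  - e^(i p_n t) (Dg - D(sum of eps_j e^(-i p_j t), j < n)), minus its constant
    contribution from the n-th term of f, is the sum of a power series whose
    constant coefficient has modulus at least eps_n.  Its partial sums are
    bounded on a set K of almost full measure, and their limit on K involves
    only the tail of f and Dh, so that it is O(eps_n^2) in L^1.
  - If the partial sums of a power series are bounded by M on a set K whose
    complement in T has measure at most kap, then its constant coefficient d_0
    satisfies, for every L,
      2 pi |d_0| (1-kap)^L <= 3 ||sum||_(L^1(K)) + 63 pi M r^L.
    This is Cauchy's formula on a curve inside the disc which comes close to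
    the circle near K and recedes from it elsewhere, for the product with the
    L-th power of a polynomial that is less than r on the receding arcs and at
    least 1 - kap at 0.
  Taking L = 4*4^n and (1-kap)^4 >= r gives r^(3*4^n) = O(r^(4*4^n)), which is
  absurd for large n. *)
Require Import Defs.
From mathcomp Require Import all_boot all_order all_algebra.
From mathcomp Require Import all_classical all_reals all_analysis.
From mathcomp Require Import measurable_realfun complex ring lra zify.
Set Implicit Arguments.
Unset Strict Implicit.
Unset Printing Implicit Defensive.
Import Order.TTheory GRing.Theory Num.Theory.
Import numFieldNormedType.Exports.
Local Open Scope classical_set_scope.
Local Open Scope ring_scope.

Local Notation normc := Normc.normc.
Local Notation Re := complex.Re.
Local Notation Im := complex.Im.
Local Notation "x %:C" := (real_complex _ x).

(** * Complex numbers and the exponential *)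

Section ComplexExponential.
Context {R : realType}.
Implicit Types (x y : R) (z w : R[i]) (n : nat).

(** Convergence almost everywhere gives no integrability of g, so the c(n) cannot be recovered by
    integration. What it gives is a bound M for the partial sums on a set that misses a little of T.
    This M, the set and the l^2 bound for the coefficients of h are known only after f has been
    fixed. Hence f is built in stages: every stage n yields the same inequality with the same
    constants, up to a factor tending to 0. The obstacle is the price of the L-th power: it gains
    r^L against M, but loses (1-kap)^L in the lower bound. With kap small in terms of r the loss is
    at most r^(L/4), and the choice of L turns eps_n into eps_n^(3/2), still larger than all error
    terms of order eps_n^2. The doubly exponential decay keeps the tail, of order eps_(n+1) =
    eps_n^4, below that as well. The frequencies of f are negative so that multiplication by e^(i
    p_n t) sends the n-th one to 0, the earlier ones to p_n - p_j > 0, and leaves those of g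
    nonnegative. For the square summability an eventual ratio 3 of the q_k is enough; the unbounded
    ratio provides angles for arbitrarily small eps_n. *)

Lemma ReD z w : Re (z + w) = Re z + Re w. Proof. by case: z; case: w. Qed.

Lemma ImD z w : Im (z + w) = Im z + Im w. Proof. by case: z; case: w. Qed.

Lemma ReN z : Re (- z) = - Re z. Proof. by case: z. Qed.

Lemma ImN z : Im (- z) = - Im z. Proof. by case: z. Qed.

Lemma ReM z w : Re (z * w) = Re z * Re w - Im z * Im w.
Proof. by case: z; case: w. Qed.

Lemma ImM z w : Im (z * w) = Re z * Im w + Im z * Re w.
Proof. by case: z; case: w. Qed.

Lemma normc_ge0 z : 0 <= normc z.
Proof. by case: z => a b; exact: sqrtr_ge0. Qed.

Lemma normcX z n : normc (z ^+ n) = normc z ^+ n.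
Proof.
elim: n => [|n IH]; first by rewrite !expr0 Normc.normc1.
by rewrite !exprS Normc.normcM IH.
Qed.

Lemma normc_real x : normc x%:C = `|x|.
Proof. by rewrite /= expr0n/= addr0 sqrtr_sqr. Qed.

Lemma normc_sum (I : Type) (r : seq I) (P : pred I) (F : I -> R[i]) :
  normc (\sum_(i <- r | P i) F i) <= \sum_(i <- r | P i) normc (F i).
Proof.
elim/big_rec2 : _ => [|i y z _ le_zy]; first by rewrite Normc.normc0.
by apply: (le_trans (le_normcD _ _)); rewrite lerD2l.
Qed.

Lemma normc_prod (I : Type) (r : seq I) (P : pred I) (F : I -> R[i]) :
  normc (\prod_(i <- r | P i) F i) = \prod_(i <- r | P i) normc (F i).
Proof. exact: (big_morph _ (@Normc.normcM R) (@Normc.normc1 R)). Qed.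

Lemma normcB_le z w : normc (z - w) <= normc z + normc w.
Proof. by rewrite -[normc w]normcN; exact: le_normcD. Qed.

Lemma normc_distC z w : normc (z - w) = normc (w - z).
Proof. by rewrite -normcN opprB. Qed.

Lemma normc_triangle w z v : normc (z - v) <= normc (z - w) + normc (w - v).
Proof. by rewrite (_ : z - v = (z - w) + (w - v)) ?le_normcD//; ring. Qed.

Lemma lerB_normc z w : normc z - normc w <= normc (z - w).
Proof. by rewrite lerBlDr; have := le_normcD (z - w) w; rewrite subrK. Qed.

Lemma normc_Re_le z : `|Re z| <= normc z.
Proof. by case: z => a b /=; rewrite -sqrtr_sqr ler_wsqrtr// lerDl sqr_ge0. Qed.

Lemma normc_Im_le z : `|Im z| <= normc z.
Proof. by case: z => a b /=; rewrite -sqrtr_sqr ler_wsqrtr// lerDr sqr_ge0. Qed.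

Lemma normc_le_ReIm z : normc z <= `|Re z| + `|Im z|.
Proof.
case: z => a b /=; rewrite -[leRHS]ger0_norm ?addr_ge0// -sqrtr_sqr.
rewrite ler_wsqrtr// sqrrD !real_normK ?num_real// lerD2r lerDl.
by rewrite mulrn_wge0 ?mulr_ge0.
Qed.

Lemma sqr_normc z : normc z ^+ 2 = Re z ^+ 2 + Im z ^+ 2.
Proof. by case: z => a b; rewrite sqr_sqrtr// addr_ge0 ?sqr_ge0. Qed.

Lemma normc_conj z : normc (conjc z) = normc z.
Proof. by case: z => a b /=; rewrite sqrrN. Qed.

Lemma mulr_conjc z : z * conjc z = (normc z ^+ 2)%:C.
Proof.
rewrite sqr_normc; case: z => a b /=; apply/eqP; rewrite eq_complex /=.
by apply/andP; split; apply/eqP; ring.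
Qed.

Lemma cexpiD x y : cexpi (x + y) = cexpi x * cexpi y :> R[i].
Proof.
by apply/eqP; rewrite eq_complex /= cosD sinD eqxx/= addrC eqxx.
Qed.

Lemma cexpi0 : cexpi 0 = 1 :> R[i].
Proof. by rewrite /cexpi cos0 sin0. Qed.

Lemma conj_cexpi x : conjc (cexpi x) = cexpi (- x) :> R[i].
Proof. by rewrite /cexpi cosN sinN. Qed.

Lemma normc_cexpiNB1 x : normc (cexpi (- x) - 1) = normc (cexpi x - 1).
Proof. by rewrite -conj_cexpi -[1 in LHS](@rmorph1 _ _ (@conjc R)) -rmorphB normc_conj. Qed.

Lemma normc_cexpi x : normc (cexpi x) = 1.
Proof. by rewrite /= cos2Dsin2 sqrtr1. Qed.

Lemma cexpiN x : cexpi (- x) = (cexpi x)^-1 :> R[i].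
Proof.
apply: (mulfI (_ : cexpi x != 0)).
  by apply/eqP => /(congr1 (@Normc.normc R)); rewrite normc_cexpi Normc.normc0 => /eqP; rewrite oner_eq0.
rewrite -cexpiD subrr cexpi0 mulfV//.
by apply/eqP => /(congr1 (@Normc.normc R)); rewrite normc_cexpi Normc.normc0 => /eqP; rewrite oner_eq0.
Qed.

Lemma cexpi_neq0 x : cexpi x != 0 :> R[i].
Proof.
by apply/eqP => /(congr1 (@Normc.normc R)); rewrite normc_cexpi Normc.normc0 => /eqP; rewrite oner_eq0.
Qed.

Lemma cexpiMn x n : cexpi (n%:R * x) = cexpi x ^+ n :> R[i].
Proof.
elim: n => [|n IH]; first by rewrite mul0r cexpi0.
by rewrite exprS -IH -cexpiD -natr1 mulrDl mul1r addrC.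
Qed.

Lemma cexpi2pi : cexpi (2 * pi) = 1 :> R[i].
Proof. by rewrite /cexpi mulr_natl cos2pi sin2pi. Qed.

Lemma cexpiD2pi x n : cexpi (x + n%:R * (2 * pi)) = cexpi x :> R[i].
Proof. by rewrite cexpiD cexpiMn cexpi2pi expr1n mulr1. Qed.

Lemma norm_sin_le x : `|sin x| <= `|x|.
Proof.
have mvt (t : R) (t0 : 0 <= t) : exists c, sin t = cos c * t.
  have [|c _] := @MVT_segment R sin cos 0 t t0.
    by apply: continuous_subspaceT => u; exact: continuous_sin.
  by rewrite sin0 !subr0; exists c.
have H (t : R) : 0 <= t -> sin t <= t.
  by move=> t0; have [c ->] := mvt _ t0; rewrite ler_piMl//; exact: cos_le1.
have H2 (t : R) : 0 <= t -> - t <= sin t.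
  move=> t0; have [c ->] := mvt _ t0.
  by rewrite -mulN1r ler_wpM2r// cos_geN1.
have [x0|x0] := leP 0 x.
  by rewrite (ger0_norm x0) ler_norml H2// H.
have x0' : 0 <= - x by rewrite oppr_ge0 ltW.
by rewrite -normrN -sinN (ltr0_norm x0) ler_norml H2// H.
Qed.

Lemma normc_cexpiB1 x : normc (cexpi x - 1) <= `|x|.
Proof.
have -> : cexpi x - 1 = (cexpi (x / 2) - cexpi (- (x / 2))) * cexpi (x / 2).
  by rewrite mulrBl -!cexpiD addNr cexpi0 -splitr.
rewrite Normc.normcM normc_cexpi mulr1 /cexpi cosN sinN.
have -> : Complex (cos (x / 2)) (sin (x / 2)) - Complex (cos (x / 2)) (- sin (x / 2))
   = Complex 0 (2 * sin (x / 2)).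
  by apply/eqP; rewrite eq_complex /= subrr opprK eqxx /= mulr_natl mulr2n.
rewrite /= expr0n /= add0r sqrtr_sqr normrM ger0_norm//.
rewrite -ler_pdivlMl// mulrC; apply: (le_trans (norm_sin_le _)).
by rewrite normrM normfV (@ger0_norm _ 2).
Qed.

Lemma normc_cexpiB x y : normc (cexpi x - cexpi y) <= `|x - y|.
Proof.
have -> : cexpi x - cexpi y = (cexpi (x - y) - 1) * cexpi y :> R[i].
  by rewrite mulrBl mul1r -cexpiD subrK.
by rewrite Normc.normcM normc_cexpi mulr1 normc_cexpiB1.
Qed.

End ComplexExponential.

(** * Polynomials in the unit disc *)

Section Polynomials.
Context {R : realType}.
Implicit Types (x y t : R) (z w : R[i]) (n : nat) (p : {poly R[i]}).

Lemma abel_summation (u : nat -> R[i]) z N :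
  \sum_(n < N) u n * z ^+ n = (\sum_(n < N) u n) * z ^+ N
     + (1 - z) * \sum_(n < N) (\sum_(k < n.+1) u k) * z ^+ n.
Proof.
elim: N => [|N IH]; first by rewrite !big_ord0 mul0r mulr0 addr0.
rewrite big_ord_recr /= IH [\sum_(n < N.+1) _ * _]big_ord_recr /= exprS.
by rewrite [\sum_(k < N.+1) u k]big_ord_recr /=; ring.
Qed.

Lemma sum_expr_le (r : R) N : 0 <= r < 1 -> \sum_(n < N) r ^+ n <= (1 - r)^-1.
Proof.
move=> /andP[r0 r1]; have r1' : 0 < 1 - r by rewrite subr_gt0.
rewrite -[leRHS]mul1r ler_pdivlMr// mulrC -opprB mulNr -subrX1 opprB.
by rewrite lerBlDr lerDl exprn_ge0.
Qed.

Lemma abel_bound (u : nat -> R[i]) z N (M : R) :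
  (forall n, normc (\sum_(k < n) u k) <= M) -> normc z < 1 ->
  normc (\sum_(n < N) u n * z ^+ n) <= M * (1 + normc (1 - z) / (1 - normc z)).
Proof.
move=> uM z1; have M0 : 0 <= M by apply: le_trans (uM 0%N); exact: normc_ge0.
have z0 := normc_ge0 z.
rewrite abel_summation mulrDr mulr1; apply: (le_trans (le_normcD _ _)).
rewrite !Normc.normcM normcX; apply: lerD.
  by rewrite -[leRHS]mulr1 ler_pM ?normc_ge0 ?exprn_ge0 ?exprn_ile1// ltW.
rewrite mulrCA ler_wpM2l ?normc_ge0//.
apply: (le_trans (normc_sum _ _ _)); apply: (@le_trans _ _ (\sum_(n < N) M * normc z ^+ n)).
  by apply: ler_sum => n _; rewrite Normc.normcM normcX ler_wpM2r ?exprn_ge0.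
by rewrite -mulr_sumr ler_wpM2l// sum_expr_le// z0.
Qed.

(** After the rotation y = z / e^(it), Abel summation leaves |1 - y| times the sum of the |y|^n,
    that is, the Stolz ratio |z - e^(it)| / (1 - |z|). The bound does not depend on [N]. *)
Lemma nontangential_bound (d : nat -> R[i]) z t N (M : R) :
  (forall n, normc (\sum_(k < n) d k * cexpi t ^+ k) <= M) -> normc z < 1 ->
  normc (\poly_(n < N) d n).[z] <= M * (1 + normc (z - cexpi t) / (1 - normc z)).
Proof.
move=> dM z1; have [y yt] : exists y : R[i], y * cexpi t = z.
  by exists (z / cexpi t); rewrite mulfVK// cexpi_neq0.
have ny : normc y = normc z by rewrite -yt Normc.normcM normc_cexpi mulr1.
have -> : normc (z - cexpi t) = normc (1 - y).
  by rewrite -yt -{2}(mul1r (cexpi t)) -mulrBl Normc.normcM normc_cexpi mulr1 normc_distC.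
have -> : (\poly_(n < N) d n).[z] = \sum_(n < N) (d n * cexpi t ^+ n) * y ^+ n.
  by rewrite horner_poly; apply: eq_bigr => n _; rewrite -yt exprMn; ring.
by rewrite -ny; apply: (@abel_bound (fun n => d n * cexpi t ^+ n)); rewrite ?ny.
Qed.

(** Serves to compare an edge near a good root with a single sample point. The constant may depend
    on [p], because the mesh is refined after [p] is fixed. *)
Lemma poly_lipschitz p : exists2 L : R, 0 <= L & forall z w,
  normc z <= 1 -> normc w <= 1 -> normc (p.[z] - p.[w]) <= L * normc (z - w).
Proof.
elim/poly_ind : p => [|p c [L L0 pL]].
  by exists 0 => // z w _ _; rewrite !horner0 subrr Normc.normc0 mul0r.
have [L' L'0 pL'] : exists2 L' : R, 0 <= L' & forall z, normc z <= 1 -> normc p.[z] <= L'.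
  exists (L * 1 + normc p.[0]); first by rewrite mulr1 addr_ge0 ?normc_ge0.
  move=> z z1; have := pL z 0 z1; rewrite Normc.normc0 subr0 => /(_ ler01) H.
  rewrite -[p.[z]](subrK p.[0]); apply: (le_trans (le_normcD _ _)).
  by rewrite lerD2r (le_trans H)// ler_wpM2l.
exists (L + L'); first exact: addr_ge0.
move=> z w z1 w1; rewrite !hornerE.
have -> : p.[z] * z + c - (p.[w] * w + c) = (p.[z] - p.[w]) * z + p.[w] * (z - w) by ring.
apply: (le_trans (le_normcD _ _)); rewrite !Normc.normcM mulrDl lerD//.
  apply: le_trans (pL _ _ z1 w1); by rewrite ler_piMr ?normc_ge0.
by rewrite ler_wpM2r ?normc_ge0 ?pL'.
Qed.

End Polynomials.

(** * A cutoff polynomial attached to the boundary point 1 *)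

Section Cutoff.
Context {R : realType}.
Implicit Types (s x y t : R) (z w : R[i]) (n : nat) (p : {poly R[i]}).

(** With r = s Re z / |z|^2 the squared modulus is 1 - r + s^2 / (4 |z|^2). Since s <= Re z, the
    last term is at most r / 4, and 1 - 3r/4 <= (1 - 3r/8)^2. *)
Lemma one_minus_half_inv_le s z : 0 < s -> s <= Re z ->
  normc (1 - (s / 2)%:C / z) <= 1 - 3%:R / 8%:R * (s * Re z / normc z ^+ 2).
Proof.
move=> s0 sz; have z0 : 0 < normc z.
  by apply: lt_le_trans s0 (le_trans sz _); apply: le_trans (normc_Re_le z); exact: ler_norm.
have zn0 : z != 0.
  by apply/eqP => /(congr1 (@Normc.normc R)) /eqP; rewrite Normc.normc0 gt_eqF.
have zz0 : 0 < normc z ^+ 2 by rewrite exprn_gt0.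
set r := s * Re z / _.
have r1 : r <= 1.
  rewrite ler_pdivrMr// mul1r; apply: (@le_trans _ _ (Re z ^+ 2)).
    by rewrite expr2 ler_wpM2r// (le_trans _ sz)// ltW.
  by rewrite sqr_normc lerDl sqr_ge0.
rewrite -(@ler_pXn2r _ 2)// ?nnegrE ?normc_ge0//; last by lra.
have -> : normc (1 - (s / 2)%:C / z) ^+ 2 = 1 - r + s ^+ 2 / 4 / normc z ^+ 2.
  have -> : 1 - (s / 2)%:C / z = (z - (s / 2)%:C) / z by rewrite mulrBl divff.
  rewrite Normc.normcM Normc.normcV exprMn exprVn [normc (z - _) ^+ 2]sqr_normc /r.
  rewrite (_ : Re _ = Re z - s / 2); last by case: (z).
  rewrite (_ : Im _ = Im z); last by case: (z) => a b /=; rewrite oppr0 addr0.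
  have -> : (Re z - s / 2) ^+ 2 + Im z ^+ 2 = normc z ^+ 2 - s * Re z + s ^+ 2 / 4.
    by rewrite sqr_normc; field.
  by rewrite !mulrDl divff ?gt_eqF// mulNr.
have : s ^+ 2 / normc z ^+ 2 <= r.
  by rewrite /r ler_wpM2r ?invr_ge0 ?(ltW zz0)// [leLHS]expr2 ler_wpM2l ?(ltW s0)//.
have : 0 <= r ^+ 2 by rewrite sqr_ge0.
rewrite (_ : s ^+ 2 / 4 / normc z ^+ 2 = s ^+ 2 / normc z ^+ 2 / 4); last by field; rewrite gt_eqF.
move: (s ^+ 2 / _) => x r2 xr; rewrite -subr_ge0.
have -> : (1 - 3 / 8 * r) ^+ 2 - (1 - r + x / 4) = (r - x) / 4 + 9%:R / 64%:R * r ^+ 2 by field.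
by apply: addr_ge0; [rewrite divr_ge0 ?subr_ge0 | rewrite mulr_ge0// divr_ge0].
Qed.

Lemma exists_expr_lt (q e : R) : 0 <= q < 1 -> 0 < e -> exists n, q ^+ n < e.
Proof.
move=> /andP[q0 q1] e0.
have : (fun n => q ^+ n) @ \oo --> 0 by apply: cvg_expr; rewrite ger0_norm.
move/cvgrPdist_lt => /(_ e e0)[n _ /(_ n (leqnn n))] /=.
by rewrite sub0r normrN ger0_norm ?exprn_ge0// => ?; exists n.
Qed.

(* A truncated expansion of 1 - (s / 2) / (1 + s - z) at z = 0. *)
Lemma cutoff_poly s : 0 < s <= 1 -> exists p : {poly R[i]},
  [/\ forall z, normc z <= 1 -> normc p.[z] <=
        1 - s * (1 + s - Re z) / (4 * normc ((1 + s)%:C - z) ^+ 2) &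
      1 - s / 2 <= normc p.[0]].
Proof.
move=> /andP[s0 s1]; have s10 : 0 < 1 + s by lra.
have hs0 : 0 <= s / 2 by lra.
pose q := (1 + s)^-1.
have q0 : 0 < q by rewrite invr_gt0.
have q1 : q < 1 by rewrite invf_lt1// ltrDl.
(* The truncation may cost r / 8, the difference between 3/8 in [one_minus_half_inv_le] and the
   claimed 1/4. As |v| <= 3 below, r >= s^2 / 9, while the error is at most half of s^2 / 36. *)
have [D qD] : exists D, q ^+ D < s ^+ 2 / 36%:R.
  by apply: exists_expr_lt; rewrite ?ltW// divr_gt0 ?exprn_gt0// ltr0n.
exists (1 - \poly_(n < D.+1) (s / 2 * q ^+ n.+1)%:C); split; last first.
  rewrite hornerD hornerN hornerC horner_poly big_ord_recl /= expr0 mulr1 big1; last first.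
    by move=> i _; rewrite expr0n /= mulr0.
  rewrite addr0 expr1 -(rmorph1 (real_complex R)) -rmorphB normc_real.
  apply: le_trans (ler_norm _); by rewrite lerB// ler_piMr ?(ltW q1)// hs0.
move=> z z1; set v := (1 + s)%:C - z.
have Rz1 : Re z <= 1 by apply: le_trans z1; apply: le_trans (normc_Re_le z); exact: ler_norm.
have Rv : Re v = 1 + s - Re z by rewrite /v; case: (z).
have sv : s <= Re v by rewrite Rv; lra.
have v0 : 0 < normc v.
  by apply: lt_le_trans s0 (le_trans sv _); apply: le_trans (normc_Re_le v); exact: ler_norm.
have vn0 : v != 0.
  by apply/eqP => /(congr1 (@Normc.normc R)) /eqP; rewrite Normc.normc0 gt_eqF.
have v3 : normc v <= 3%:R.
  apply: (le_trans (normcB_le _ _)); rewrite normc_real (ger0_norm (ltW s10)).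
  have -> : 3%:R = 2 + 1 :> R by ring.
  by apply: lerD z1; lra.
have sumE : (\poly_(n < D.+1) (s / 2 * q ^+ n.+1)%:C).[z]
    = (s / 2)%:C / v * (1 - (q%:C * z) ^+ D.+1).
  have qv : v = (1 - q%:C * z) / q%:C.
    have qn0 : q%:C != 0 by rewrite (inj_eq (@complexI R)) gt_eqF.
    by rewrite mulrBl mul1r mulrAC divff// mul1r -(fmorphV (real_complex R)) invrK.
  have q1n0 : 1 - q%:C * z != 0 by apply: contraNneq vn0 => H; rewrite qv H mul0r.
  rewrite horner_poly -[1 - _ ^+ _]opprB subrX1 -mulNr opprB qv invf_div.
  rewrite [X in _ = X](_ : _ = (s / 2)%:C * q%:C * (\sum_(i < D.+1) (q%:C * z) ^+ i)).
    rewrite mulr_sumr; apply: eq_bigr => i _.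
    by rewrite exprMn exprS !rmorphM rmorphXn /=; ring.
  by field.
rewrite hornerD hornerN hornerC sumE.
set E := (q%:C * z) ^+ D.+1.
have -> : 1 - (s / 2)%:C / v * (1 - E) = (1 - (s / 2)%:C / v) + (s / 2)%:C / v * E by ring.
apply: (le_trans (le_normcD _ _)).
apply: (le_trans (lerD (one_minus_half_inv_le s0 sv) (lexx _))).
rewrite Normc.normcM Normc.normcM Normc.normcV normc_real (ger0_norm hs0).
have E36 : normc E <= s ^+ 2 / 36%:R.
  rewrite /E normcX Normc.normcM normc_real (ger0_norm (ltW q0)) exprMn.
  apply: (@le_trans _ _ (q ^+ D.+1 * 1)).
    by rewrite ler_wpM2l ?exprn_ge0 ?(ltW q0)// exprn_ile1 ?normc_ge0.
  rewrite mulr1 exprS; apply: le_trans (ltW qD).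
  by rewrite ler_piMl ?exprn_ge0 ?(ltW q0)// ltW.
have vv0 : 0 < normc v ^+ 2 by rewrite exprn_gt0.
rewrite -Rv; set r := s * Re v / normc v ^+ 2.
have -> : s * Re v / (4 * normc v ^+ 2) = r / 4 by rewrite /r; field; rewrite gt_eqF.
have rs : s ^+ 2 / 9%:R <= r.
  rewrite /r ler_pdivlMr// mulrAC ler_pdivrMr//.
  rewrite expr2 -!mulrA ler_wpM2l ?(ltW s0)//; apply: ler_pM => //; [exact: ltW|exact: ltW|].
  by rewrite (_ : 9%:R = 3%:R ^+ 2) ?lerXn2r ?nnegrE ?normc_ge0// -natrX.
have sv1 : s / 2 / normc v <= 1 / 2.
  rewrite ler_pdivrMr//; have : Re v <= normc v by apply: le_trans (normc_Re_le v); exact: ler_norm.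
  lra.
have : s / 2 / normc v * normc E <= 1 / 2 * (s ^+ 2 / 36%:R).
  by rewrite ler_pM ?normc_ge0// divr_ge0 ?divr_ge0 ?normc_ge0 ?ltW.
lra.
Qed.

End Cutoff.

(** * Contour integration in the logarithmic plane *)

Section ComplexDerivative.
Context {R : realType}.
Implicit Types (s x y t a : R) (z w : R[i]) (F G : R -> R[i]) (n : nat) (p : {poly R[i]}).

Definition is_cderive F s w :=
  is_derive s 1 (fun x => Re (F x)) (Re w) /\ is_derive s 1 (fun x => Im (F x)) (Im w).

Lemma is_cderive_cst z s : is_cderive (fun=> z) s 0.
Proof. by split; exact: is_derive_cst. Qed.

Lemma is_cderiveD F G s z w :
  is_cderive F s z -> is_cderive G s w -> is_cderive (fun x => F x + G x) s (z + w).
Proof.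
move=> [F1 F2] [G1 G2]; split.
- rewrite (_ : (fun x => _) = (fun x => Re (F x)) + (fun x => Re (G x))); last first.
    by apply/funext => x; rewrite ReD.
  by rewrite ReD; exact: is_deriveD.
- rewrite (_ : (fun x => _) = (fun x => Im (F x)) + (fun x => Im (G x))); last first.
    by apply/funext => x; rewrite ImD.
  by rewrite ImD; exact: is_deriveD.
Qed.

Lemma is_cderiveM F G s z w :
  is_cderive F s z -> is_cderive G s w ->
  is_cderive (fun x => F x * G x) s (F s * w + z * G s).
Proof.
move=> [F1 F2] [G1 G2]; split.
- rewrite (_ : (fun x => _) = (fun x => Re (F x)) * (fun x => Re (G x))
    - (fun x => Im (F x)) * (fun x => Im (G x))); last first.
    by apply/funext => x; rewrite ReM.
  apply: (is_derive_eq (is_deriveB (is_deriveM F1 G1) (is_deriveM F2 G2))).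
  by rewrite ReD !ReM /GRing.scale /=; ring.
- rewrite (_ : (fun x => _) = (fun x => Re (F x)) * (fun x => Im (G x))
    + (fun x => Im (F x)) * (fun x => Re (G x))); last first.
    by apply/funext => x; rewrite ImM.
  apply: (is_derive_eq (is_deriveD (is_deriveM F1 G2) (is_deriveM F2 G1))).
  by rewrite ImD !ImM /GRing.scale /=; ring.
Qed.

Lemma is_cderive_sum N (F : nat -> R -> R[i]) s (w : nat -> R[i]) :
  (forall n, is_cderive (F n) s (w n)) ->
  is_cderive (fun x => \sum_(n < N) F n x) s (\sum_(n < N) w n).
Proof.
move=> Fw; elim: N => [|N IH].
  by under eq_fun do rewrite big_ord0; rewrite big_ord0; exact: is_cderive_cst.
under eq_fun do rewrite big_ord_recr/=.
by rewrite big_ord_recr/=; exact: is_cderiveD.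
Qed.

Lemma is_cderiveX F s z n : is_cderive F s z ->
  is_cderive (fun x => F x ^+ n.+1) s (n.+1%:R * F s ^+ n * z).
Proof.
move=> Fz; elim: n => [|n IH].
  by rewrite expr0 !mul1r; under eq_fun do rewrite expr1.
under eq_fun do rewrite exprS.
have := is_cderiveM Fz IH; congr is_cderive.
by rewrite -natr1 [F s ^+ n.+1]exprS; ring.
Qed.

Lemma is_cderive_eq F s z w : is_cderive F s z -> z = w -> is_cderive F s w.
Proof. by move=> ? <-. Qed.

Lemma cmean_value F (F' : R -> R[i]) (B : R) :
  (forall s, is_cderive F s (F' s)) -> (forall s, 0 <= s <= 1 -> normc (F' s) <= B) ->
  normc (F 1 - F 0) <= B.
Proof.
move=> dF F'B; set w := F 1 - F 0.
have B0 : 0 <= B by apply: le_trans (F'B 0 _); rewrite ?normc_ge0 ?lexx ?ler01.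
have [w0|w0] := eqVneq (normc w) 0; first by rewrite w0.
(* The mean value theorem fails for complex values. Pairing with the increment [w] reduces it to one
   real function, whose increment is |w|^2. *)
have dG s : is_cderive (fun x => conjc w * F x) s (conjc w * F' s).
  by apply: is_cderive_eq (is_cderiveM (is_cderive_cst _ _) (dF s)) _; rewrite mul0r addr0.
have [||c c01] := @MVT_segment R (fun x => Re (conjc w * F x)) (fun x => Re (conjc w * F' x)) 0 1 ler01.
- by move=> x _; case: (dG x).
- apply: continuous_subspaceT => x; apply: differentiable_continuous.
  by apply/derivable1_diffP; case: (dG x) => -[].
rewrite subr0 mulr1 -ReN -ReD -mulrBr -/w mulrC mulr_conjc /= => ww.
have : normc w ^+ 2 <= normc w * B.
  rewrite ww; apply: le_trans (ler_norm _) _; apply: le_trans (normc_Re_le _) _.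
  by rewrite Normc.normcM normc_conj ler_wpM2l ?normc_ge0// F'B// -in_itv.
by rewrite expr2 ler_pM2l// lt_neqAle eq_sym w0 normc_ge0.
Qed.

End ComplexDerivative.

Section LogPlane.
Context {R : realType}.
Implicit Types (s x y t a phi : R) (z w : R[i]) (n : nat) (p : {poly R[i]}).

(** The point e^zeta for zeta = -a + i phi. In these coordinates dz / z becomes d zeta and the curve
    a polygon, so increments of a primitive replace contour integrals. *)
Definition cexp a phi : R[i] := (expR (- a))%:C * cexpi phi.

Lemma normc_cexp a phi : normc (cexp a phi) = expR (- a).
Proof. by rewrite Normc.normcM normc_cexpi mulr1 normc_real ger0_norm ?expR_ge0. Qed.

(* A primitive of zeta |-> p(e^zeta), at the point zeta = - a + i phi. *)
Definition log_primitive p a phi : R[i] :=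
  p`_0 * Complex (- a) phi + \sum_(n < (size p).-1) p`_n.+1 / n.+1%:R * cexp a phi ^+ n.+1.

(** This is Cauchy's formula for the constant coefficient: every term of the primitive except the
    linear one has period 2 pi in phi. *)
Lemma log_primitive2pi p a :
  log_primitive p a (2 * pi) - log_primitive p a 0 = p`_0 * Complex 0 (2 * pi).
Proof.
rewrite /log_primitive /cexp cexpi2pi cexpi0 opprD addrACA subrr addr0 -mulrBr.
by congr (_ * _); apply/eqP; rewrite eq_complex/= subrr subr0 !eqxx.
Qed.

Lemma is_cderive_cexp (a0 a1 phi0 phi1 s : R) :
  is_cderive (fun s => cexp (a0 + s * a1) (phi0 + s * phi1)) s
    (Complex (- a1) phi1 * cexp (a0 + s * a1) (phi0 + s * phi1)).
Proof.
have daff (u v : R) : is_derive s 1 (fun s => u + s * v) v.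
  apply: is_derive_eq; rewrite /GRing.scale /=; ring.
have dE : is_cderive (fun s => (expR (- (a0 + s * a1)))%:C) s
    ((- a1)%:C * (expR (- (a0 + s * a1)))%:C).
  split => /=; last first.
    by rewrite mul0r mulr0 addr0; exact: is_derive_cst.
  have daff' : is_derive s 1 (fun s => - (a0 + s * a1)) (- a1).
    exact: is_deriveN.
  have := @is_derive1_comp R expR (fun s => - (a0 + s * a1)) s _ _ (is_derive_expR _) daff'.
  by rewrite mul0r subr0 mulrC.
have dC : is_cderive (fun s => cexpi (phi0 + s * phi1)) s
    (Complex 0 phi1 * cexpi (phi0 + s * phi1)).
  split => /=; rewrite ?mul0r ?sub0r ?add0r.
    have := @is_derive1_comp R cos (fun s => phi0 + s * phi1) s _ _ (is_derive_cos _) (daff phi0 phi1).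
    by rewrite mulrC mulrN.
  have := @is_derive1_comp R sin (fun s => phi0 + s * phi1) s _ _ (is_derive_sin _) (daff phi0 phi1).
  by rewrite mulrC.
apply: is_cderive_eq (is_cderiveM dE dC) _; rewrite /cexp.
have -> : Complex (- a1) phi1 = (- a1)%:C + Complex 0 phi1.
  by apply/eqP; rewrite eq_complex/= addr0 add0r !eqxx.
by ring.
Qed.

Lemma is_cderive_log_primitive p (a0 a1 phi0 phi1 s : R) :
  is_cderive (fun s => log_primitive p (a0 + s * a1) (phi0 + s * phi1)) s
    (Complex (- a1) phi1 * p.[cexp (a0 + s * a1) (phi0 + s * phi1)]).
Proof.
have d0 : is_cderive (fun s => Complex (- (a0 + s * a1)) (phi0 + s * phi1)) s (Complex (- a1) phi1).
  have daff (u v : R) : is_derive s 1 (fun s => u + s * v) v.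
    apply: is_derive_eq; rewrite /GRing.scale /=; ring.
  by split => /=; first exact: is_deriveN.
have d1 := is_cderiveM (is_cderive_cst p`_0 s) d0.
have d2 := @is_cderive_sum R (size p).-1 (fun n s => p`_n.+1 / n.+1%:R *
   cexp (a0 + s * a1) (phi0 + s * phi1) ^+ n.+1) s _
   (fun n => is_cderiveM (is_cderive_cst _ s) (is_cderiveX n (is_cderive_cexp a0 a1 phi0 phi1 s))).
apply: is_cderive_eq (is_cderiveD d1 d2) _.
set z := cexp _ _; set w := Complex _ _.
rewrite mul0r addr0 (_ : p.[z] = p`_0 + \sum_(n < (size p).-1) p`_n.+1 * z ^+ n.+1).
  rewrite mulrDr [w * p`_0]mulrC; congr (_ + _); rewrite mulr_sumr; apply: eq_bigr => n _.
  rewrite mul0r addr0 exprS; field.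
  by rewrite addrC natr1 pnatr_eq0.
rewrite horner_coef; have [->|p0] := eqVneq p 0.
  by rewrite size_poly0 !big_ord0 coef0 addr0.
rewrite -[size p in LHS]prednK ?size_poly_gt0//.
by rewrite big_ord_recl expr0 mulr1.
Qed.

Lemma log_primitive_edge p (a0 a1 phi0 phi1 B : R) :
  (forall s, 0 <= s <= 1 ->
     normc p.[cexp (a0 + s * (a1 - a0)) (phi0 + s * (phi1 - phi0))] <= B) ->
  normc (log_primitive p a1 phi1 - log_primitive p a0 phi0) <=
    (`|a1 - a0| + `|phi1 - phi0|) * B.
Proof.
move=> pB.
pose F s := log_primitive p (a0 + s * (a1 - a0)) (phi0 + s * (phi1 - phi0)).
have -> : log_primitive p a1 phi1 = F 1 by rewrite /F !mul1r ![_ + (_ - _)]addrC !subrK.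
have -> : log_primitive p a0 phi0 = F 0 by rewrite /F !mul0r !addr0.
apply: (cmean_value (fun s => is_cderive_log_primitive p a0 (a1 - a0) phi0 (phi1 - phi0) s)).
move=> s s01; rewrite Normc.normcM ler_pM ?normc_ge0 ?pB//.
by apply: (le_trans (normc_le_ReIm _)); rewrite /= normrN.
Qed.

End LogPlane.

(** * Elementary inequalities and the constant r *)

Section Auxiliary.
Context {R : realType}.

(** Allows a product over all roots of unity to start at the j-th one. *)
Lemma prod_rotate (u : nat -> R) m j : (forall k, u (k + m)%N = u k) ->
  \prod_(k < m) u (k + j)%N = \prod_(k < m) u k.
Proof.
case: m => [|m] um; first by rewrite !big_ord0.
elim: j => [|j IH]; first by apply: eq_bigr => k _; rewrite addn0.
rewrite -IH big_ord_recr big_ord_recl /= mulrC; congr (_ * _).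
  by rewrite add0n -(um j) !addnS addnC.
by apply: eq_bigr => k _; rewrite /bump /= add1n addSn addnS.
Qed.

Lemma exprB_le (y : R) n : 0 <= y <= 1 -> (1 - y) ^+ n <= (1 + n%:R * y)^-1.
Proof.
move=> /andP[y0 y1]; have ny : 0 < 1 + n%:R * y by rewrite ltr_wpDr// mulr_ge0.
rewrite -[leRHS]mul1r ler_pdivlMr//.
elim: n {ny} => [|n IH]; first by rewrite expr0 mul0r addr0 mul1r.
apply: le_trans IH; rewrite exprSr -mulrA ler_wpM2l ?exprn_ge0 ?subr_ge0//.
have : 0 <= n.+1%:R * y ^+ 2 by rewrite mulr_ge0// sqr_ge0.
by rewrite -natr1 => H; nra.
Qed.

Lemma expRN_le (a : R) : 0 <= a <= 1 -> expR (- a) <= 1 - a / 2.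
Proof.
move=> /andP[a0 a1]; rewrite expRN.
apply: (@le_trans _ _ (1 + a)^-1).
  by rewrite lef_pV2 ?posrE ?expR_gt0 ?expR_ge1Dx// ltr_wpDr.
rewrite -[leLHS]mul1r ler_pdivrMr ?ltr_wpDr//.
have : 0 <= a * (1 - a) by rewrite mulr_ge0 ?subr_ge0.
by move=> H; nra.
Qed.

Lemma exists_argmin m (good : pred nat) (F : nat -> R) :
  (exists2 c, (c < m)%N & good c) ->
  exists c, [/\ (c < m)%N, good c & forall k, (k < m)%N -> good k -> F c <= F k].
Proof.
move=> [c0 c0m gc0].
case: (@Order.TotalTheory.arg_minP _ R 'I_m (Ordinal c0m) (fun i => good i) (fun i => F i) gc0) => i gi Hi.
by exists i; split => // k km gk; exact: (Hi (Ordinal km)).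
Qed.

Lemma exists_decay : exists g : R, [/\ 0 < g, g < 1 & g^-1 <= 1 + 864%:R^-1].
Proof.
exists (1 + 864%:R^-1)^-1.
have p : 0 < 864%:R^-1 :> R by rewrite invr_gt0 ltr0n.
by rewrite invr_gt0 invf_lt1 ?invrK ?lexx ?ltrDl ?ltr_wpDr ?(ltW p).
Qed.

(* The bound for the cutoff above a bad cell; 864 = 3 * 288 comes from the
   estimates [cut_near] and [cutoff_prod_small]. *)
Definition decay : R := projT1 (cid exists_decay).

Lemma decay_gt0 : 0 < decay. Proof. by case: (projT2 (cid exists_decay)). Qed.

Lemma decay_lt1 : decay < 1. Proof. by case: (projT2 (cid exists_decay)). Qed.

Lemma decayV_le : decay^-1 <= 1 + 864%:R^-1.
Proof. by case: (projT2 (cid exists_decay)). Qed.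

End Auxiliary.
Arguments decay R : clear implicits.

(** * Estimate of the constant coefficient *)

Section Polygon.
Context {R : realType}.
Variables (m : nat) (good : pred nat) (l : R).
Let om (k : nat) : R[i] := cexpi (k%:R * l).

Hypothesis ml : m%:R * l = 2 * pi.
Hypothesis l1 : l <= 1.
Hypothesis m0 : (0 < m)%N.
Hypothesis exists_good : exists2 c, (c < m)%N & good c.

Let l0 : 0 < l.
Proof.
by rewrite -(@pmulr_rgt0 _ m%:R) ?ltr0n// ml mulr_gt0// pi_gt0.
Qed.

Let om_per k : om (k + m)%N = om k.
Proof. by rewrite /om natrD mulrDl ml cexpiD cexpi2pi mulr1. Qed.

Let om_mod k : om (k %% m)%N = om k.
Proof.
rewrite [in RHS](divn_eq k m) addnC; elim: (k %/ m)%N => [|n IH]; first by rewrite addn0.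
by rewrite mulSnr addnA om_per.
Qed.

Let om_dist k i : normc (om (k + i)%N - om k) <= i%:R * l.
Proof.
apply: (le_trans (normc_cexpiB _ _)); rewrite natrD mulrDl addrAC subrr add0r.
by rewrite ger0_norm// mulr_ge0// ltW.
Qed.

Let near j := projT1 (cid (exists_argmin (fun c => normc (om j - om c)) exists_good)).

Let nearP j : [/\ (near j < m)%N, good (near j) &
  forall k, (k < m)%N -> good k -> normc (om j - om (near j)) <= normc (om j - om k)].
Proof. exact: projT2 (cid (exists_argmin (fun c => normc (om j - om c)) exists_good)). Qed.

(* Near the j-th root of unity the curve passes at depth [(gap j + 2 * l) / 4]
   below the circle. *)
Definition gap j := normc (om j - om (near j)).

Lemma gap_ge0 j : 0 <= gap j. Proof. exact: normc_ge0. Qed.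

Lemma gap_le2 j : gap j <= 2.
Proof.
apply: (le_trans (normcB_le _ _)); rewrite !normc_cexpi; lra.
Qed.

Lemma gap_le j k : (k < m)%N -> good k -> gap j <= normc (om j - om k).
Proof. by case: (nearP j) => _ _; exact. Qed.

Lemma gap_good j : (j < m)%N -> good j -> gap j = 0.
Proof.
move=> jm gj; apply/eqP; rewrite eq_le gap_ge0 andbT.
by apply: (le_trans (gap_le j jm gj)); rewrite subrr Normc.normc0.
Qed.

(** Closes the curve: its depth is the same at both ends of the turn. *)
Lemma gap_per : gap m = gap 0.
Proof.
have om0 : om m = om 0 by rewrite -[m in LHS]add0n om_per.
have [m1 g1 H1] := nearP m; have [m2 g2 H2] := nearP 0.
apply/eqP; rewrite eq_le /gap om0; apply/andP; split; last exact: H2.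
by have := H1 _ m2 g2; rewrite om0.
Qed.

Lemma gapS j : `|gap j.+1 - gap j| <= l.
Proof.
have omS : normc (om j.+1 - om j) <= l by have := om_dist j 1; rewrite addn1 mul1r.
have [m1 g1 _] := nearP j; have [m2 g2 _] := nearP j.+1.
rewrite ler_distl; apply/andP; split.
  rewrite lerBlDr; apply: (le_trans (gap_le j m2 g2)).
  rewrite [leRHS]addrC; apply: (le_trans (normc_triangle (om j.+1) _ _)); rewrite lerD2r.
  by rewrite normc_distC.
apply: (le_trans (gap_le j.+1 m1 g1)).
by rewrite [leRHS]addrC; apply: (le_trans (normc_triangle (om j) _ _)); rewrite lerD2r.
Qed.

(** The quarter keeps the depth at most 1, the range of [expRN_le]. Since the depth varies by at
    most l / 4 along an edge, the offset 2 l keeps it at least l / 4 everywhere. *)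
Definition depth j := (gap j + 2 * l) / 4.

Lemma depthS j : `|depth j.+1 - depth j| <= l / 4.
Proof.
have -> : depth j.+1 - depth j = (gap j.+1 - gap j) / 4 by rewrite /depth; field.
by rewrite normrM (ger0_norm (_ : 0 <= 4^-1)) ?invr_ge0// ler_wpM2r ?invr_ge0// gapS.
Qed.

Definition edge_point j s : R[i] :=
  cexp (depth j + s * (depth j.+1 - depth j)) (j%:R * l + s * (j.+1%:R * l - j%:R * l)).

Section EdgePoint.
Variables (j : nat) (s : R).
Hypothesis s01 : 0 <= s <= 1.
Let x := edge_point j s.

Let a := depth j + s * (depth j.+1 - depth j).

Let a_bounds : [/\ (gap j + l) / 4 <= a, a <= (gap j + 3 * l) / 4, 0 <= a & a <= 1].
Proof.
move: s01 => /andP[s0 s1].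
have := depthS j; rewrite ler_norml => /andP[H1 H2].
have [H3 H4] : - (l / 4) <= s * (depth j.+1 - depth j) /\ s * (depth j.+1 - depth j) <= l / 4.
  have := l0 => l0'; split.
    have : s * (- (l / 4)) <= s * (depth j.+1 - depth j) by rewrite ler_wpM2l.
    by move: (s * (depth _ - _)) => y Hy; nra.
  have : s * (depth j.+1 - depth j) <= s * (l / 4) by rewrite ler_wpM2l.
  by move: (s * (depth _ - _)) => y Hy; nra.
have Ea : a = depth j + s * (depth j.+1 - depth j) by [].
have Ed : depth j = (gap j + 2 * l) / 4 by [].
have g0 := gap_ge0 j; have l0' := l0; have l1' := l1.
have [E1 E2] : depth j <= 3 / 4 + l/4 /\ depth j.+1 <= 1.
  by have := gap_le2 j; have := gap_le2 j.+1; rewrite /depth; split; lra.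
have a1 : a <= 1.
  have -> : a = (1 - s) * depth j + s * depth j.+1 by rewrite Ea; ring.
  have dj1 : depth j <= 1 by lra.
  have : (1 - s) * depth j <= (1 - s) * 1 by rewrite ler_wpM2l// subr_ge0.
  have : s * depth j.+1 <= s * 1 by rewrite ler_wpM2l.
  by move: (s * depth _) ((1 - s) * depth _) => u v; lra.
have H y b : - (l / 4) <= y -> y <= l / 4 -> b = depth j + y -> b <= 1 ->
    [/\ (gap j + l) / 4 <= b, b <= (gap j + 3 * l) / 4, 0 <= b & b <= 1].
  by rewrite Ed => ? ? ? ?; split; lra.
exact: H H3 H4 Ea a1.
Qed.

Lemma edge_point_norm : 1 - normc x >= (gap j + l) / 8.
Proof.
have [H1 _ a0 a1] := a_bounds.
rewrite /x /edge_point normc_cexp -/a.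
have := @expRN_le R a; rewrite a0 a1 => /(_ isT); lra.
Qed.

Lemma edge_point_le1 : normc x <= 1.
Proof. by have := edge_point_norm; have := gap_ge0 j; have := l0; lra. Qed.

Lemma edge_point_lt1 : normc x < 1.
Proof. by have := edge_point_norm; have := gap_ge0 j; have := l0; lra. Qed.

Lemma edge_point_dist : normc (x - om j) <= (gap j + 7 * l) / 4.
Proof.
have [_ H2 a0 a1] := a_bounds; move: s01 => /andP[s0 s1].
rewrite /x /edge_point -/a; set phi := _ + _ * _.
apply: (le_trans (normc_triangle (cexpi phi) _ _)).
have : normc (cexp a phi - cexpi phi) <= a.
  rewrite /cexp -[X in normc (_ - X)]mul1r -mulrBl Normc.normcM normc_cexpi mulr1.
  rewrite -(rmorph1 (real_complex R)) -rmorphB normc_real ler0_norm.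
    by have := expR_ge1Dx (- a); lra.
  by rewrite subr_le0 expR_le1 oppr_le0.
have : normc (cexpi phi - om j) <= l.
  apply: (le_trans (normc_cexpiB _ _)).
  have -> : phi - j%:R * l = s * l by rewrite /phi -natr1; ring.
  by rewrite (ger0_norm (mulr_ge0 s0 (ltW l0))); exact: ler_piMl (ltW l0) s1.
by have := l0; lra.
Qed.

End EdgePoint.

Section Estimate.
Variables (d : nat -> R[i]) (N L : nat) (M : R) (t V : nat -> R).
Let D : {poly R[i]} := \poly_(n < N) d n.

Hypothesis t_cell : forall c, (c < m)%N -> good c -> `|t c - c%:R * l| <= l.
Hypothesis t_bound : forall c, (c < m)%N -> good c ->
  forall n, normc (\sum_(k < n) d k * cexpi (t c) ^+ k) <= M.
Hypothesis V_bound : forall c, (c < m)%N -> good c ->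
  forall x, normc x <= 1 -> normc (x - om c) <= 2 * l -> normc D.[x] <= V c.

(** The edge lies in a Stolz region of the sample point in the nearest good cell, whatever the gap:
    the distance to that point is at most 5/4 gap + 11/4 l, the distance to the circle at least (gap
    + l) / 8, and the ratio at most 24. *)
Lemma edge_poly_bound j s : 0 <= s <= 1 -> normc D.[edge_point j s] <= 25%:R * M.
Proof.
move=> s01; have [nm ng _] := nearP j.
have x1 := edge_point_norm j s01; have xd := edge_point_dist j s01.
have M0 : 0 <= M by apply: le_trans (t_bound nm ng 0); exact: normc_ge0.
apply: le_trans (nontangential_bound N (t_bound nm ng) (edge_point_lt1 j s01)) _.
rewrite mulrC ler_wpM2r//.
have g0 := gap_ge0 j; have l0' := l0.
have y0 : 0 < 1 - normc (edge_point j s) by rewrite subr_gt0 edge_point_lt1.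
suff : normc (edge_point j s - cexpi (t (near j))) / (1 - normc (edge_point j s)) <= 24%:R by lra.
rewrite ler_pdivrMr//.
have : normc (edge_point j s - cexpi (t (near j))) <=
    normc (edge_point j s - om j) + (normc (om j - om (near j)) + normc (om (near j) - cexpi (t (near j)))).
  apply: le_trans (normc_triangle (om j) _ _) _; rewrite lerD2l.
  exact: normc_triangle.
have : normc (om (near j) - cexpi (t (near j))) <= l.
  by apply: le_trans (normc_cexpiB _ _) _; rewrite distrC t_cell.
have : normc (om j - om (near j)) = gap j by [].
move: (normc (om j - _)) (normc (om (near j) - _)) => u v; lra.
Qed.

(* Rotations of [psi] to the bad roots of unity: those close to a point at gap
   delta number about delta / l, and each contributes 1 - c l / (delta + l). *)
Let psi := projT1 (cid (cutoff_poly (introT andP (conj l0 l1)))).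

Let psiP : [/\ forall z, normc z <= 1 -> normc psi.[z] <=
        1 - l * (1 + l - Re z) / (4 * normc ((1 + l)%:C - z) ^+ 2) &
      1 - l / 2 <= normc psi.[0]].
Proof. exact: projT2 (cid (cutoff_poly (introT andP (conj l0 l1)))). Qed.

Let cut k : {poly R[i]} := psi \Po ((om k)^-1 *: 'X).

Let cutE k z : (cut k).[z] = psi.[z / om k].
Proof. by rewrite /cut horner_comp !hornerE mulrC. Qed.

Let norm_rot k z : normc (z / om k) = normc z.
Proof. by rewrite Normc.normcM Normc.normcV normc_cexpi invr1 mulr1. Qed.

Let cut_le1 k z : normc z <= 1 -> normc (cut k).[z] <= 1.
Proof.
move=> z1; rewrite cutE; apply: le_trans (psiP.1 _ _) _; rewrite ?norm_rot//.
rewrite gerBl; apply: divr_ge0; last by rewrite mulr_ge0// sqr_ge0.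
apply: mulr_ge0; first exact: ltW.
have : Re (z / om k) <= 1.
  by apply: le_trans (ler_norm _) (le_trans (normc_Re_le _) _); rewrite norm_rot.
by have := l0; lra.
Qed.

Let cut_near j k s : 0 <= s <= 1 -> normc (om k - om j) <= gap j ->
  normc (cut k).[edge_point j s] <= 1 - l / (288%:R * (gap j + l)).
Proof.
move=> s01 kj; set x := edge_point j s.
have x1 := edge_point_norm j s01; have xd := edge_point_dist j s01; rewrite -/x in x1 xd.
have g0 := gap_ge0 j; have l0' := l0.
have A0 : 0 < gap j + l by lra.
rewrite cutE; apply: le_trans (psiP.1 _ _) _; rewrite ?norm_rot ?edge_point_le1//.
set y := x / om k; set v := (1 + l)%:C - y.
have Ry : Re y <= normc x.
  by rewrite -(norm_rot k); apply: le_trans (ler_norm _) (normc_Re_le _).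
have v3 : normc v <= 3%:R * (gap j + l).
  have -> : v = l%:C + (om k - x) / om k.
    by rewrite /v /y mulrBl divff ?cexpi_neq0// rmorphD rmorph1; ring.
  apply: le_trans (le_normcD _ _) _; rewrite normc_real (ger0_norm (ltW l0)) norm_rot.
  have : normc (om k - x) <= normc (om k - om j) + normc (x - om j).
    by rewrite (normc_distC x); exact: normc_triangle.
  lra.
have v0 : 0 < normc v.
  apply: lt_le_trans (normc_Re_le v); rewrite normr_gt0.
  have -> : Re v = 1 + l - Re y by rewrite /v ReD ReN.
  by rewrite gt_eqF//; lra.
rewrite lerB//.
(* Here 288 = 8 * 4 * 3^2: the numerator contains 1 - |x| >= (gap j + l) / 8, and the denominator 4
   |v|^2 with |v| <= 3 (gap j + l). *)
have step1 : l / (288%:R * (gap j + l)) = l * ((gap j + l) / 8) / (4 * (3%:R * (gap j + l)) ^+ 2).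
  by field; rewrite gt_eqF.
rewrite step1; apply: ler_pM.
- by rewrite mulr_ge0 ?(ltW l0)// divr_ge0// ltW.
- by rewrite invr_ge0 mulr_ge0// sqr_ge0.
- by apply: ler_wpM2l; [exact: ltW | lra].
- have p1 : 0 < 4 * normc v ^+ 2 by rewrite mulr_gt0// exprn_gt0.
  have p2 : 0 < 4 * (3%:R * (gap j + l)) ^+ 2 by rewrite mulr_gt0// exprn_gt0// mulr_gt0.
  rewrite lef_pV2 ?posrE//; apply: ler_wpM2l => //.
  by apply: lerXn2r => //; rewrite nnegrE ?normc_ge0// mulr_ge0 ?(ltW A0).
Qed.

Let Phi : {poly R[i]} := \prod_(c < m | ~~ good c) cut c ^+ L.

Lemma cutoff_prod_le1 z : normc z <= 1 -> normc Phi.[z] <= 1.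
Proof.
move=> z1; rewrite /Phi horner_prod normc_prod; apply: prodr_ile1 => c _.
by rewrite normc_ge0 horner_exp normcX exprn_ile1 ?normc_ge0 ?cut_le1.
Qed.

(** All roots closer to the j-th one than its gap are bad. Those on one side of it already number at
    least (gap j + l) / (3 l), and each of their cutoffs is at most 1 - l / (288 (gap j + l)). The
    resulting bound depends neither on the mesh nor on the gap. *)
Lemma cutoff_prod_small j s : (j < m)%N -> ~~ good j -> 0 <= s <= 1 ->
  normc Phi.[edge_point j s] <= (decay R) ^+ L.
Proof.
move=> jm bj s01; set x := edge_point j s.
have x1 : normc x <= 1 by exact: edge_point_le1.
have g0 := gap_ge0 j; have l0' := l0.
have A0 : 0 < gap j + l by lra.
have -> : normc Phi.[x] = (\prod_(c < m | ~~ good c) normc (cut c).[x]) ^+ L.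
  rewrite /Phi horner_prod normc_prod -prodrXl; apply: eq_bigr => c _.
  by rewrite horner_exp normcX.
suff prod_le : \prod_(c < m | ~~ good c) normc (cut c).[x] <= decay R.
  apply: lerXn2r => //; rewrite nnegrE; last exact/ltW/decay_gt0.
  by apply: prodr_ge0 => c _; exact: normc_ge0.
(* The periodic extension, with value 1 at good roots, lets the product run cyclically from j. *)
pose u k := if ~~ good (k %% m)%N then normc (cut k).[x] else 1.
have uper k : u (k + m)%N = u k by rewrite /u modnDr /cut om_per.
have u01 k : 0 <= u k <= 1.
  by rewrite /u; case: ifP => _; rewrite ?ler01 ?lexx// normc_ge0 cut_le1.
have -> : \prod_(c < m | ~~ good c) normc (cut c).[x] = \prod_(k < m) u k.
  by rewrite big_mkcond; apply: eq_bigr => c _; rewrite /u modn_small.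
rewrite -(prod_rotate j uper).
(* The maximum counts the root j itself, which is needed when its gap is less than l. *)
pose r := maxn 1 (Num.truncn (gap j / l)).
have rj i : (i < r)%N -> i != 0%N -> i%:R * l < gap j.
  rewrite /r leq_max => /orP[|]; first by rewrite ltnS leqn0 => ->.
  move=> ir _; rewrite -ltr_pdivlMr//.
  apply: lt_le_trans (_ : (Num.truncn (gap j / l))%:R <= _); first by rewrite ltr_nat.
  by rewrite truncn_le// divr_ge0// ltW.
have rm : (r <= m)%N.
  rewrite /r geq_max m0 /= -(ler_nat R).
  apply: (@le_trans _ _ (gap j / l)); first by rewrite truncn_le// divr_ge0// ltW.
  rewrite ler_pdivrMr// ml; apply: (le_trans (gap_le2 j)).
  by have := @pi_ge2 R; lra.
have rbad i : (i < r)%N -> ~~ good ((i + j) %% m)%N.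
  move=> ir; have [->|i0] := eqVneq i 0%N; first by rewrite add0n modn_small.
  apply/negP => gi; have := gap_le j (ltn_pmod (i + j) m0) gi.
  rewrite om_mod leNgt => /negP; apply; apply: le_lt_trans (rj i ir i0).
  by rewrite normc_distC addnC om_dist.
have ru i : (i < r)%N -> u (i + j)%N <= 1 - l / (288%:R * (gap j + l)).
  move=> ir; rewrite /u rbad//; apply: cut_near => //.
  have [->|i0] := eqVneq i 0%N; first by rewrite add0n subrr Normc.normc0.
  by apply: (@le_trans _ _ (i%:R * l)); [rewrite addnC om_dist | exact/ltW/rj].
set y := l / (288%:R * (gap j + l)).
have y0 : 0 <= y := divr_ge0 (ltW l0) (mulr_ge0 (ler0n _ _) (ltW A0)).
have p288 : 0 < 288%:R :> R by rewrite ltr0n.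
have y1 : y <= 1.
  rewrite /y ler_pdivrMr; last exact: mulr_gt0 p288 A0.
  by rewrite mul1r; lra.
apply: (@le_trans _ _ ((1 - y) ^+ r)).
  rewrite -(big_mkord xpredT (fun k => u (k + j)%N)) (big_cat_nat (n := r))//=.
  rewrite -[leRHS]mulr1; apply: ler_pM.
  - by apply: prodr_ge0 => i _; have /andP[] := u01 (i + j)%N.
  - by apply: prodr_ge0 => i _; have /andP[] := u01 (i + j)%N.
  - rewrite big_mkord -[X in _ <= _ ^+ X]card_ord -prodr_const; apply: ler_prod => i _.
    by have /andP[-> _] := u01 (i + j)%N; rewrite /= ru.
  - by apply: prodr_ile1 => i _; exact: u01.
apply: (le_trans (exprB_le r _)); first by rewrite y0 y1.
rewrite -[leRHS]invrK lef_pV2 ?posrE ?invr_gt0 ?decay_gt0//; last first.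
  by rewrite ltr_wpDr// mulr_ge0.
apply: (le_trans decayV_le); rewrite lerD2l.
(* Adding the two inequalities gives gap j + l <= 3 r l; this 3 times 288 is the 864 in [decay]. *)
have rl : gap j <= 2 * (r%:R * l) /\ l <= r%:R * l.
  have r1 : 1 <= r%:R :> R by rewrite ler1n /r leq_maxl.
  have rl1 : l <= r%:R * l by rewrite ler_peMl// ltW.
  split => //.
  have : gap j / l < r%:R + 1.
    rewrite natr1; apply: lt_le_trans (truncnS_gt _) _.
    by rewrite ler_nat ltnS /r leq_maxr.
  by rewrite ltr_pdivrMr// mulrDl mul1r; lra.
rewrite /y mulrA.
rewrite ler_pdivlMr ?mulr_gt0 ?ltr0n//.
have -> : 864%:R^-1 * (288%:R * (gap j + l)) = (gap j + l) / 3 by field.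
by move: rl; move: (r%:R * l) => w; lra.
Qed.

Lemma cutoff_prod0 :
  (1 - l / 2) ^+ (#|[pred c : 'I_m | ~~ good c]| * L) <= normc Phi.[0].
Proof.
rewrite /Phi horner_prod normc_prod exprM -prodr_const -prodrXl.
apply: ler_prod => c _; rewrite exprn_ge0 ?subr_ge0 /=; last by have := l1; lra.
rewrite horner_exp normcX lerXn2r ?nnegrE ?normc_ge0//; first by have := l1; lra.
by rewrite cutE mul0r psiP.2.
Qed.

(** The increments of the logarithmic primitive of D * Phi are summed around the polygon. An edge
    has length at most 5 l / 4, with [V] as bound on good edges and 25 M r^L on bad ones; the bad
    edges give at most 2 pi * 5/4 * 25 = 62.5 pi times M r^L. *)
Lemma polygon_estimate : (0 < N)%N ->
  2 * pi * normc (d 0%N) * (1 - l / 2) ^+ (#|[pred c : 'I_m | ~~ good c]| * L) <=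
  \sum_(c < m | good c) 5 / 4 * l * V c + 63%:R * pi * M * (decay R) ^+ L.
Proof.
move=> N0; pose H := D * Phi.
have M0 : 0 <= M.
  by have [c cm gc] := exists_good; apply: le_trans (t_bound cm gc 0); exact: normc_ge0.
pose A j := log_primitive H (depth j) (j%:R * l).
have telA : A m - A 0%N = \sum_(j < m) (A j.+1 - A j).
  by rewrite -(big_mkord xpredT (fun j => A j.+1 - A j)) telescope_sumr.
have Hm : A m - A 0%N = H`_0 * Complex 0 (2 * pi).
  rewrite /A ml mul0r -(log_primitive2pi H (depth 0)).
  by rewrite /depth gap_per.
have H0 : H`_0 = d 0%N * Phi.[0].
  by rewrite -horner_coef0 hornerM; congr (_ * _); rewrite horner_coef0 coef_poly N0.
have edge j (B : R) : (forall s, 0 <= s <= 1 -> normc H.[edge_point j s] <= B) ->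
    normc (A j.+1 - A j) <= 5 / 4 * l * B.
  move=> HB; have B0 : 0 <= B by apply: le_trans (HB 0 _); rewrite ?normc_ge0 ?lexx ?ler01.
  apply: (le_trans (log_primitive_edge HB)); rewrite ler_wpM2r//.
  have -> : j.+1%:R * l - j%:R * l = l by rewrite -natr1; ring.
  have := depthS j; rewrite (ger0_norm (ltW l0)).
  lra.
have goodE (c : 'I_m) : good c -> normc (A c.+1 - A c) <= 5 / 4 * l * V c.
  move=> gc; apply: edge => s s01; rewrite /H hornerM Normc.normcM.
  rewrite -[leRHS]mulr1; apply: ler_pM; rewrite ?normc_ge0 ?cutoff_prod_le1 ?edge_point_le1//.
  (* At a good root the gap is 0, so the edge stays within 7 l / 4 of the root. *)
  apply: V_bound => //; first exact: edge_point_le1.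
  by apply: le_trans (edge_point_dist c s01) _; rewrite gap_good//; have := l0; lra.
have badE (c : 'I_m) : ~~ good c -> normc (A c.+1 - A c) <=
    5 / 4 * l * (25%:R * M * (decay R) ^+ L).
  move=> gc; apply: edge => s s01; rewrite /H hornerM Normc.normcM.
  by apply: ler_pM; rewrite ?normc_ge0 ?edge_poly_bound ?cutoff_prod_small.
have total : 2 * pi * normc (d 0%N) * normc Phi.[0] <= \sum_(j < m) normc (A j.+1 - A j).
  rewrite -mulrA -Normc.normcM -H0 mulrC.
  have -> : normc H`_0 * (2 * pi) = normc (A m - A 0%N).
    rewrite Hm Normc.normcM; congr (_ * _).
    by rewrite /= expr0n/= add0r sqrtr_sqr ger0_norm// mulr_ge0// pi_ge0.
  by rewrite telA; exact: normc_sum.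
apply: (@le_trans _ _ (2 * pi * normc (d 0%N) * normc Phi.[0])).
  by rewrite ler_wpM2l ?cutoff_prod0// ?mulr_ge0 ?pi_ge0 ?normc_ge0.
apply: (le_trans total); rewrite (bigID (fun c : 'I_m => good c)) /=; apply: lerD.
  by apply: ler_sum => c; exact: goodE.
apply: (@le_trans _ _ (\sum_(c < m) 5 / 4 * l * (25%:R * M * (decay R) ^+ L))).
  rewrite [leRHS](bigID (fun c : 'I_m => ~~ good c)) /= -[leLHS]addr0 lerD//.
    by apply: ler_sum => c; exact: badE.
  by apply: sumr_ge0 => c _; rewrite !mulr_ge0 ?exprn_ge0 ?(ltW l0) ?(ltW decay_gt0).
rewrite sumr_const card_ord -[leLHS]mulr_natl.
have -> : m%:R * (5 / 4 * l * (25%:R * M * (decay R) ^+ L)) =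
   (m%:R * l) * (125%:R / 4 * (M * (decay R) ^+ L)) by field.
rewrite ml.
have : 0 <= pi * (M * (decay R) ^+ L).
  by rewrite !mulr_ge0 ?pi_ge0 ?exprn_ge0 ?(ltW decay_gt0).
move=> w0; apply: (@le_trans _ _ (125%:R / 2 * (pi * (M * (decay R) ^+ L)))).
  by rewrite le_eqVlt; apply/orP; left; apply/eqP; field.
have -> : 63%:R * pi * M * (decay R) ^+ L = 63%:R * (pi * (M * (decay R) ^+ L)).
  by rewrite !mulrA.
by apply: ler_wpM2r => //; lra.
Qed.

End Estimate.

End Polygon.

(** * Measurability of complex-valued functions *)

Section ComplexMeasurable.
Context {R : realType}.
Implicit Types (D : set R) (f g : R -> R[i]).

Definition cmeasurable_on D f :=
  measurable_fun D (fun x => Re (f x)) /\ measurable_fun D (fun x => Im (f x)).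

Lemma cmeasurable_cst D z : cmeasurable_on D (fun=> z).
Proof. by split; exact: measurable_cst. Qed.

Lemma cmeasurableD D f g : cmeasurable_on D f -> cmeasurable_on D g ->
  cmeasurable_on D (fun x => f x + g x).
Proof.
move=> [f1 f2] [g1 g2]; split.
  by under eq_fun do rewrite ReD; exact: measurable_funD.
by under eq_fun do rewrite ImD; exact: measurable_funD.
Qed.

Lemma cmeasurableN D f : cmeasurable_on D f -> cmeasurable_on D (fun x => - f x).
Proof.
move=> [f1 f2]; split.
  by under eq_fun do rewrite ReN; exact: measurableT_comp.
by under eq_fun do rewrite ImN; exact: measurableT_comp.
Qed.

Lemma cmeasurableB D f g : cmeasurable_on D f -> cmeasurable_on D g ->
  cmeasurable_on D (fun x => f x - g x).
Proof. by move=> mf mg; apply: cmeasurableD => //; exact: cmeasurableN. Qed.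

Lemma cmeasurableM D f g : cmeasurable_on D f -> cmeasurable_on D g ->
  cmeasurable_on D (fun x => f x * g x).
Proof.
move=> [f1 f2] [g1 g2]; split.
  under eq_fun do rewrite ReM.
  by apply: measurable_funB; exact: measurable_funM.
under eq_fun do rewrite ImM.
by apply: measurable_funD; exact: measurable_funM.
Qed.

Lemma cmeasurable_sum D (I : Type) (r : seq I) (P : pred I) (F : I -> R -> R[i]) :
  (forall i, cmeasurable_on D (F i)) ->
  cmeasurable_on D (fun x => \sum_(i <- r | P i) F i x).
Proof.
move=> mF; elim: r => [|i r IH].
  by under eq_fun do rewrite big_nil; exact: cmeasurable_cst.
case Pi : (P i).
  by under eq_fun do rewrite big_cons Pi; exact: cmeasurableD.
by under eq_fun do rewrite big_cons Pi.
Qed.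

Lemma cmeasurableX D f n : cmeasurable_on D f -> cmeasurable_on D (fun x => f x ^+ n).
Proof.
move=> mf; elim: n => [|n IH].
  by under eq_fun do rewrite expr0; exact: cmeasurable_cst.
by under eq_fun do rewrite exprS; exact: cmeasurableM.
Qed.

Lemma cmeasurable_cexpi D (u : R -> R) : measurable_fun D u ->
  cmeasurable_on D (fun x => cexpi (u x)).
Proof.
move=> mu; split => /=.
  apply: (measurableT_comp _ mu); apply: continuous_measurable_fun.
  exact: continuous_cos.
apply: (measurableT_comp _ mu); apply: continuous_measurable_fun.
exact: continuous_sin.
Qed.

Lemma cmeasurable_cexpi_id D : cmeasurable_on D (fun x => cexpi x).
Proof. by apply: (@cmeasurable_cexpi D id); exact: measurable_id. Qed.

Lemma cmeasurable_horner D (p : {poly R[i]}) : cmeasurable_on D (fun x => p.[cexpi x]).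
Proof.
under eq_fun do rewrite horner_coef.
apply: cmeasurable_sum => i; apply: cmeasurableM; first exact: cmeasurable_cst.
exact: cmeasurableX (cmeasurable_cexpi_id _).
Qed.

Lemma measurable_normc D f : cmeasurable_on D f -> measurable_fun D (fun x => normc (f x)).
Proof.
move=> [f1 f2].
rewrite (_ : (fun x => _) = (@Num.sqrt R) \o (fun x => Re (f x) ^+ 2 + Im (f x) ^+ 2)).
  apply: measurableT_comp; last by apply: measurable_funD; exact: measurable_funX.
  by apply: continuous_measurable_fun; exact: sqrt_continuous.
by apply/funext => x /=; case: (f x).
Qed.

Lemma measurable_EFin_normc D f : cmeasurable_on D f ->
  measurable_fun D (fun x => (normc (f x))%:E).
Proof. by move=> mf; apply/measurable_EFinP; exact: measurable_normc. Qed.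

Lemma cmeasurable_subset D E f : measurable D -> E `<=` D ->
  cmeasurable_on D f -> cmeasurable_on E f.
Proof. by move=> mD ED [f1 f2]; split; apply: measurable_funS mD ED _. Qed.

End ComplexMeasurable.

(** * From sample points to the L^1 norm on K *)

Section MainEstimate.
Context {R : realType}.

Lemma bernoulli_le (y : R) n : 0 <= y <= 1 -> 1 - n%:R * y <= (1 - y) ^+ n.
Proof.
move=> /andP[y0 y1]; elim: n => [|n IH]; first by rewrite expr0 mul0r subr0.
rewrite exprSr; apply: le_trans (ler_wpM2r _ IH); last by rewrite subr_ge0.
have : 0 <= n%:R * y ^+ 2 by rewrite mulr_ge0// sqr_ge0.
by rewrite -natr1; nra.
Qed.

Local Notation mu := (@lebesgue_measure R).

Lemma measurable_Tdom : measurable (Tdom R).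
Proof. exact: measurable_itv. Qed.

Lemma lebesgue_measure_Tdom : mu (Tdom R) = (2 * pi)%:E.
Proof.
rewrite /Tdom lebesgue_measure_itv /= lte_fin mulr_gt0 ?pi_gt0//.
by rewrite sube0.
Qed.

Lemma exists_le_mean (E : set R) (f : R -> R) (v c e : R) : measurable E ->
  measurable_fun E f -> (forall x, 0 <= f x) -> (c%:E <= mu E)%E -> 0 < c -> 0 < e ->
  (\int[mu]_(x in E) (f x)%:E <= v%:E)%E -> exists2 x, E x & f x <= v / c + e.
Proof.
move=> mE mf f0 cE c0 e0 fv; apply: contrapT => nex.
have fgt x : E x -> v / c + e <= f x.
  by move=> Ex; rewrite leNgt; apply/negP => fx; apply: nex; exists x => //; exact: ltW.
have v0 : 0 <= v.
  by rewrite -lee_fin; apply: le_trans fv; apply: integral_ge0 => x _; rewrite lee_fin.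
have : ((v / c + e)%:E * mu E <= v%:E)%E.
  rewrite -integral_cst//; apply: le_trans fv; apply: ge0_le_integral => //.
  - by move=> x _; rewrite lee_fin addr_ge0 ?divr_ge0// ltW.
  - exact/measurable_EFinP.
apply/negP; rewrite -ltNge; apply: (@lt_le_trans _ _ ((v / c + e) * c)%:E).
  by rewrite lte_fin mulrDl divfK ?gt_eqF// ltrDl mulr_gt0.
by rewrite EFinM lee_wpmul2l// lee_fin addr_ge0 ?divr_ge0// ltW.
Qed.

Section Cells.
Variables (m : nat) (l : R).
Hypothesis ml : m%:R * l = 2 * pi.
Hypothesis l0 : 0 < l.

Definition cell (c : nat) : set R := `[c%:R * l, c.+1%:R * l[%classic.

Lemma measurable_cell c : measurable (cell c).
Proof. exact: measurable_itv. Qed.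

Lemma trivIset_cell (D : set nat) : trivIset D cell.
Proof.
apply/trivIsetP => i j _ _; wlog ij : i j / (i < j)%N.
  move=> H; rewrite neq_ltn => /orP[ij|ji]; first by apply: H => //; rewrite ltn_eqF.
  by rewrite setIC; apply: H => //; rewrite ltn_eqF.
move=> _; apply/seteqP; split => // x []; rewrite /cell /= !in_itv /= => /andP[_ xi] /andP[jx _].
have : i.+1%:R * l <= j%:R * l by rewrite ler_wpM2r ?(ltW l0)// ler_nat.
by rewrite leNgt => /negP; apply; exact: le_lt_trans jx xi.
Qed.

Lemma trivIset_cell_ord (D : set 'I_m) : trivIset D (fun c : 'I_m => cell c).
Proof.
apply/trivIsetP => i j _ _ ij.
by have /trivIsetP := @trivIset_cell setT; apply.
Qed.

Lemma lebesgue_measure_cell c : mu (cell c) = l%:E.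
Proof.
rewrite /cell lebesgue_measure_itv /= lte_fin ltr_pM2r// ltr_nat ltnSn.
by rewrite -EFinD -natr1 mulrDl mul1r addrAC subrr add0r.
Qed.

Lemma cell_Tdom c : (c < m)%N -> cell c `<=` Tdom R.
Proof.
move=> cm x; rewrite /cell /Tdom /= !in_itv /= => /andP[cx xc]; apply/andP; split.
  by apply: le_trans cx; rewrite mulr_ge0// ltW.
by apply: (lt_le_trans xc); rewrite -ml ler_wpM2r ?(ltW l0)// ler_nat.
Qed.

End Cells.

(* A cell at least half covered by [K] is good and provides a sample point; the
   total length of the bad cells is at most twice [kap]. *)
Lemma main_estimate (d : nat -> R[i]) (K : set R) (M kap : R) (L N : nat) :
  measurable K -> K `<=` Tdom R -> (mu (Tdom R `\` K) <= kap%:E)%E -> kap < 1 ->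
  (forall t, K t -> forall n, normc (\sum_(k < n) d k * cexpi t ^+ k) <= M) ->
  (0 < N)%N ->
  ((2 * pi * normc (d 0%N) * (1 - kap) ^+ L)%:E <=
   3%:E * \int[mu]_(t in K) (normc (\sum_(k < N) d k * cexpi t ^+ k))%:E +
   (63%:R * pi * M * (decay R) ^+ L)%:E)%E.
Proof.
move=> mK KT Kkap kap1 dM N0.
pose D : {poly R[i]} := \poly_(n < N) d n.
have DE t : \sum_(k < N) d k * cexpi t ^+ k = D.[cexpi t] by rewrite horner_poly.
under eq_integral do rewrite DE.
have mD E : measurable_fun E (fun t => normc D.[cexpi t]).
  by apply: measurable_normc; exact: cmeasurable_horner.
have mDE E : measurable_fun E (fun t => (normc D.[cexpi t])%:E).
  by apply: measurable_EFin_normc; exact: cmeasurable_horner.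
have [Lp Lp0 LpP] := poly_lipschitz D.
have int0 (E : set R) : (0 <= \int[mu]_(t in E) (normc D.[cexpi t])%:E)%E.
  by apply: integral_ge0 => t _; rewrite lee_fin normc_ge0.
have : (0 <= \int[mu]_(t in K) (normc D.[cexpi t])%:E)%E := int0 K.
case E : (\int[mu]_(t in K) _)%E => [v| |] //; last first.
  by move=> _; rewrite mulry sgr_nat mul1e addye ?leey.
rewrite lee_fin => v0; rewrite -EFinM -EFinD lee_fin.
have kap0 : 0 <= kap by rewrite -lee_fin; apply: le_trans Kkap.
apply/ler_addgt0Pr => e e0.
(* The quotient C / m is the total discretization error: m cells, each contributing 5/4 l (1 + 3 Lp)
   l with l = 2 pi / m. The summand 8 >= 2 pi in [m] below ensures l <= 1. *)
pose C : R := 5 / 2 * pi * (1 + 3%:R * Lp) * (2 * pi).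
have C0 : 0 <= C.
  by rewrite /C !mulr_ge0 ?pi_ge0 ?addr_ge0 ?mulr_ge0.
pose m := ((Num.truncn (C / e)).+1 + 8)%N.
have m0 : (0 < m)%N by rewrite addn_gt0.
have mR0 : 0 < m%:R :> R by rewrite ltr0n.
pose l : R := 2 * pi / m%:R.
have ml : m%:R * l = 2 * pi by rewrite /l mulrC divfK// gt_eqF.
have l0 : 0 < l by rewrite divr_gt0// mulr_gt0// pi_gt0.
have l1 : l <= 1.
  rewrite ler_pdivrMr// mul1r; apply: (@le_trans _ _ 8%:R).
    by have := @pihalf_02 R => /andP[_]; lra.
  by rewrite ler_nat leq_addl.
(* An edge of length 5 l / 4, times a mean over a set of measure at least l / 2, gives 5/2 of the
   integral over the cell. This is the origin of the factor 3. *)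
have c53 : 5 / 2 <= 3%:R :> R by lra.
have Ce : C / m%:R <= e.
  rewrite ler_pdivrMr// mulrC -ler_pdivrMr//; apply: (le_trans (ltW (truncnS_gt _))).
  by rewrite ler_nat leq_addr.
have lE : l = 2 * pi / m%:R by [].
clearbody l; clearbody m.
have l201 : 0 <= l / 2 <= 1 by apply/andP; split; lra.
pose good c := ((l / 2)%:E <= mu (K `&` cell l c))%E.
pose I c : \bar R := (\int[mu]_(t in K `&` cell l c) (normc D.[cexpi t])%:E)%E.
have mKc c : measurable (K `&` cell l c) by apply: measurableI => //; exact: measurable_cell.
have sumI : (\sum_(c < m) I c <= v%:E)%E.
  rewrite -E -(@ge0_integral_bigsetU _ _ _ mu _ (fun c : 'I_m => K `&` cell l c))//.
  - apply: ge0_subset_integral => //.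
    + by apply: bigsetU_measurable => i _; exact: mKc.
    + exact: mDE.
    + by move=> t _; rewrite lee_fin normc_ge0.
    + by rewrite -bigcup_seq => t [c _ []].
  - by move=> c; exact: mKc.
  - exact: index_enum_uniq.
  - by apply: trivIset_setIl; exact: trivIset_cell_ord.
  - exact: mDE.
  - by move=> t _; rewrite lee_fin normc_ge0.
have Ifin (c : 'I_m) : I c = (fine (I c))%:E.
  rewrite fineK// ge0_fin_numE; last exact: int0.
  apply: le_lt_trans (ltry v); apply: le_trans sumI.
  by rewrite (bigD1 c)//= leeDl// sume_ge0// => i _; exact: int0.
have sumv : \sum_(c < m) fine (I c) <= v.
  by rewrite -lee_fin -sumEFin; under eq_bigr do rewrite -Ifin.
have tP c : exists t, (c < m)%N -> good c ->
    [/\ K t, cell l c t & normc D.[cexpi t] <= fine (I c) / (l / 2) + l].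
  have [cm|] := boolP (c < m)%N; last by exists 0.
  have [gc|] := boolP (good c); last by exists 0.
  have l20 : 0 < l / 2 by rewrite divr_gt0.
  have Ic : (I c <= (fine (I c))%:E)%E by rewrite -(Ifin (Ordinal cm)).
  have [t [Kt ct] Dt] := @exists_le_mean (K `&` cell l c) (fun t => normc D.[cexpi t])
    (fine (I c)) (l / 2) l (mKc c) (mD _) (fun t => normc_ge0 _) gc l20 l0 Ic.
  by exists t.
have [t tcP] := choice tP.
pose nb := #|[pred c : 'I_m | ~~ good c]|.
(* Each bad cell has at least l / 2 of its length outside K, and the cells are disjoint. *)
have nbl : l / 2 * nb%:R <= kap.
  have badc (c : 'I_m) : ~~ good c -> ((l / 2)%:E <= mu (cell l c `\` K))%E.
    rewrite /good -ltNge => gc.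
    have EQ : (l%:E = mu (cell l c `\` K) + mu (K `&` cell l c))%E.
      rewrite -(lebesgue_measure_cell l0 c) (setIC K); apply: measureDI => //.
      exact: measurable_cell.
    rewrite leNgt; apply/negP => lc.
    have : (mu (cell l c `\` K) + mu (K `&` cell l c) < (l / 2)%:E + (l / 2)%:E)%E.
      by apply: lteD.
    by rewrite -EQ -EFinD -splitr lte_fin ltxx.
  rewrite -lee_fin; apply: le_trans Kkap.
  apply: (@le_trans _ _ (\sum_(c < m | ~~ good c) mu (cell l c `\` K))%E).
    apply: (@le_trans _ _ (\sum_(c < m | ~~ good c) (l / 2)%:E)%E).
      by rewrite sumEFin lee_fin sumr_const mulr_natr.
    by apply: lee_sum => c; exact: badc.
  rewrite -(@measure_bigsetU_ord_cond _ _ _ mu m (fun c => ~~ good c) (fun c => cell l c `\` K)).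
  - apply: le_measure; rewrite ?inE.
    + by apply: bigsetU_measurable => i _; apply: measurableD => //; exact: measurable_cell.
    + by apply: measurableD => //; exact: measurable_Tdom.
    + rewrite -bigcup_seq_cond => x [c /= _ [cx Kx]]; split => //.
      by apply: (cell_Tdom ml l0 (ltn_ord c)).
  - by move=> i _; apply: measurableD => //; exact: measurable_cell.
  - apply/trivIsetP => i j _ _ ij.
    have /trivIsetP/(_ i j Logic.I Logic.I ij) ij0 := @trivIset_cell_ord m l l0 setT.
    by apply/seteqP; split => // x [[xi _] [xj _]]; rewrite -ij0.
(* If all cells were bad, [nbl] would read pi <= kap < 1. *)
have exg : exists2 c, (c < m)%N & good c.
  apply: contrapT => ng.
  have : nb = m.
    rewrite /nb -[RHS]card_ord; apply: eq_card => c; rewrite !inE.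
    by apply/negP => gc; apply: ng; exists (c : nat).
  move=> nbm; move: nbl; rewrite nbm mulrAC (mulrC l) ml.
  by have := @pi_ge2 R; lra.
(* A point within 2 l of the root is within 3 l of the sample point of that cell. *)
pose V c := normc D.[cexpi (t c)] + Lp * (3%:R * l).
have tcell c : (c < m)%N -> good c -> `|t c - c%:R * l| <= l.
  move=> cm gc; have [_ + _] := tcP c cm gc.
  rewrite /cell /= in_itv /= -natr1 mulrDl mul1r => /andP[H1 H2].
  by rewrite ger0_norm ?subr_ge0// lerBlDl ltW.
have tbound c : (c < m)%N -> good c ->
    forall n, normc (\sum_(k < n) d k * cexpi (t c) ^+ k) <= M.
  by move=> cm gc; have [Kt _ _] := tcP c cm gc; exact: dM.
have Vbound c : (c < m)%N -> good c -> forall x, normc x <= 1 ->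
    normc (x - cexpi (c%:R * l)) <= 2 * l -> normc D.[x] <= V c.
  move=> cm gc x x1 xc.
  have := LpP x (cexpi (t c)) x1; rewrite normc_cexpi lexx => /(_ isT) Dx.
  have xt : normc (x - cexpi (t c)) <= 3%:R * l.
    apply: le_trans (normc_triangle (cexpi (c%:R * l)) _ _) _.
    have : normc (cexpi (c%:R * l) - cexpi (t c)) <= l.
      by apply: le_trans (normc_cexpiB _ _) _; rewrite distrC tcell.
    by move: xc; lra.
  rewrite /V -lerBlDl; apply: le_trans (lerB_normc _ _) _; apply: le_trans Dx _.
  by rewrite ler_wpM2l.
have key := polygon_estimate (N := N) ml l1 m0 exg L tcell tbound Vbound N0.
(* The value of the cutoffs at 0 costs (1 - l/2)^nb per power, at least 1 - nb l / 2 by Bernoulli,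
   hence at least 1 - kap by [nbl]. *)
apply: (@le_trans _ _ (2 * pi * normc (d 0%N) * (1 - l / 2) ^+ (nb * L))).
  rewrite ler_wpM2l ?mulr_ge0 ?pi_ge0 ?normc_ge0// exprM lerXn2r ?nnegrE ?subr_ge0 ?(ltW kap1)//.
    by apply: exprn_ge0; rewrite subr_ge0; case/andP: l201.
  by apply: le_trans (bernoulli_le nb l201); rewrite lerB// mulrC.
apply: (le_trans key); rewrite -addrA [X in _ <= _ + X]addrC addrA lerD2r.
apply: (@le_trans _ _ (\sum_(c < m) (5 / 2 * fine (I c) + 5 / 4 * l * ((1 + 3%:R * Lp) * l)))).
  rewrite [leRHS](bigID (fun c : 'I_m => good c)) /= -[leLHS]addr0 lerD//.
    apply: ler_sum => c gc; have [_ _ Dt] := tcP c (ltn_ord c) gc.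
    have -> : 5 / 2 * fine (I c) + 5 / 4 * l * ((1 + 3%:R * Lp) * l) =
        5 / 4 * l * (fine (I c) / (l / 2) + l + Lp * (3%:R * l)) by field; rewrite gt_eqF.
    by rewrite ler_wpM2l ?mulr_ge0 ?(ltW l0)// lerD2r.
  apply: sumr_ge0 => c _; rewrite addr_ge0 ?mulr_ge0 ?(ltW l0) ?addr_ge0 ?mulr_ge0//.
  exact/fine_ge0/int0.
rewrite big_split /= -mulr_sumr sumr_const card_ord -[X in _ + X <= _]mulr_natl.
apply: lerD.
  by apply: (@le_trans _ _ (5 / 2 * v)); [rewrite ler_wpM2l | rewrite ler_wpM2r].
apply: le_trans Ce; rewrite /C lE le_eqVlt; apply/orP; left; apply/eqP.
by field; rewrite gt_eqF.
Qed.

End MainEstimate.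

(** * Complex integrals *)

Section ComplexIntegral.
Context {R : realType}.
Local Notation mu := (@lebesgue_measure R).
Local Notation T := (Tdom R).
Implicit Types (D E : set R) (f g : R -> R[i]).

Definition norm1 D f : \bar R := (\int[mu]_(t in D) (normc (f t))%:E)%E.

Lemma Tdom_lty : (mu T < +oo)%E.
Proof. by rewrite lebesgue_measure_Tdom ltry. Qed.

Lemma norm1_ge0 D f : (0 <= norm1 D f)%E.
Proof. by apply: integral_ge0 => t _; rewrite lee_fin normc_ge0. Qed.

Lemma le_norm1 D f g : measurable D -> cmeasurable_on D f -> cmeasurable_on D g ->
  (forall t, D t -> normc (f t) <= normc (g t)) -> (norm1 D f <= norm1 D g)%E.
Proof.
move=> mD mf mg fg; apply: ge0_le_integral => //.
- by move=> t _; rewrite lee_fin normc_ge0.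
- exact: measurable_EFin_normc.
- exact: measurable_EFin_normc.
Qed.

Lemma eq_norm1 D f g : (forall t, D t -> normc (f t) = normc (g t)) ->
  norm1 D f = norm1 D g.
Proof. by move=> fg; apply: eq_integral => t /[!inE] Dt; rewrite fg. Qed.

Lemma norm1D D f g : measurable D -> cmeasurable_on D f -> cmeasurable_on D g ->
  (norm1 D (fun t => f t + g t)%R <= norm1 D f + norm1 D g)%E.
Proof.
move=> mD mf mg; rewrite /norm1 -ge0_integralD//.
- apply: ge0_le_integral => //.
  + by move=> t _; rewrite lee_fin normc_ge0.
  + by apply: measurable_EFin_normc; exact: cmeasurableD.
  + by apply: emeasurable_funD; exact: measurable_EFin_normc.
  + by move=> t _; rewrite -EFinD lee_fin le_normcD.
- by move=> t _; rewrite lee_fin normc_ge0.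
- exact: measurable_EFin_normc.
- by move=> t _; rewrite lee_fin normc_ge0.
- exact: measurable_EFin_normc.
Qed.

Lemma norm1N D f : norm1 D (fun t => - f t)%R = norm1 D f.
Proof. by apply: eq_norm1 => t _; rewrite normcN. Qed.

Lemma norm1B D f g : measurable D -> cmeasurable_on D f -> cmeasurable_on D g ->
  (norm1 D (fun t => f t - g t)%R <= norm1 D f + norm1 D g)%E.
Proof.
move=> mD mf mg; rewrite -(norm1N D g); apply: norm1D => //; exact: cmeasurableN.
Qed.

Lemma norm1Z D z f : measurable D -> cmeasurable_on D f ->
  norm1 D (fun t => z * f t)%R = ((normc z)%:E * norm1 D f)%E.
Proof.
move=> mD mf; rewrite /norm1 -ge0_integralZl//.
- by apply: eq_integral => t _; rewrite Normc.normcM EFinM.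
- exact: measurable_EFin_normc.
- by move=> t _; rewrite lee_fin normc_ge0.
- by rewrite lee_fin normc_ge0.
Qed.

Lemma norm1M_le D f g (C : R) : measurable D -> cmeasurable_on D f -> cmeasurable_on D g ->
  0 <= C -> (forall t, D t -> normc (g t) <= C) ->
  (norm1 D (fun t => f t * g t)%R <= C%:E * norm1 D f)%E.
Proof.
move=> mD mf mg C0 gC; rewrite -(ger0_norm C0) -normc_real -norm1Z//.
apply: le_norm1 => //; first exact: cmeasurableM.
  by apply: cmeasurableM => //; exact: cmeasurable_cst.
move=> t Dt; rewrite !Normc.normcM normc_real (ger0_norm C0) mulrC.
by rewrite ler_wpM2r ?normc_ge0 ?gC.
Qed.

Lemma norm1_sum D (I : Type) (r : seq I) (F : I -> R -> R[i]) : measurable D ->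
  (forall i, cmeasurable_on D (F i)) ->
  (norm1 D (fun t => \sum_(i <- r) F i t)%R <= \sum_(i <- r) norm1 D (F i))%E.
Proof.
move=> mD mF; elim: r => [|i r IH].
  rewrite big_nil /norm1 integral0_eq// => t _.
  by rewrite big_nil Normc.normc0.
rewrite big_cons; apply: (@le_trans _ _ (norm1 D (F i) + norm1 D (fun t => \sum_(j <- r) F j t)%R)%E).
  rewrite (_ : (fun t => \sum_(j <- i :: r) F j t) = (fun t => F i t + \sum_(j <- r) F j t)).
    by apply: norm1D => //; exact: cmeasurable_sum.
  by apply/funext => t; rewrite big_cons.
by rewrite leeD2l.
Qed.

Lemma norm1_subset D E f : measurable D -> measurable E -> D `<=` E ->
  cmeasurable_on E f -> (norm1 D f <= norm1 E f)%E.
Proof.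
move=> mD mE DE mf; apply: ge0_subset_integral => //.
- exact: measurable_EFin_normc.
- by move=> t _; rewrite lee_fin normc_ge0.
Qed.

Lemma cintegrableP f : cintegrable f <-> cmeasurable_on T f /\ (norm1 T f < +oo)%E.
Proof.
have mT := @measurable_Tdom R.
split=> [[If1 If2]|[[mf1 mf2] If]].
  have mf1 : measurable_fun T (fun x => Re (f x)) by apply/measurable_EFinP; case/integrableP: If1.
  have mf2 : measurable_fun T (fun x => Im (f x)) by apply/measurable_EFinP; case/integrableP: If2.
  split => //.
  apply: (@le_lt_trans _ _ (\int[mu]_(t in T) (`|(Re (f t))%:E| + `|(Im (f t))%:E|))%E).
    apply: ge0_le_integral => //.
    - by move=> t _; rewrite lee_fin normc_ge0.
    - exact: measurable_EFin_normc.
    - by apply: emeasurable_funD; apply: measurableT_comp => //; exact/measurable_EFinP.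
    - by move=> t _; rewrite -EFinD lee_fin normc_le_ReIm.
  rewrite ge0_integralD//; last 2 first.
  - by apply: measurableT_comp => //; exact/measurable_EFinP.
  - by apply: measurableT_comp => //; exact/measurable_EFinP.
  by rewrite lte_add_pinfty//; [case/integrableP: If1|case/integrableP: If2].
have aux (u : R -> R) : measurable_fun T u -> (forall t, `|u t| <= normc (f t)) ->
    mu.-integrable T (EFin \o u).
  move=> mu uf; apply/integrableP; split; first exact/measurable_EFinP.
  apply: le_lt_trans If; apply: ge0_le_integral => //.
  - by apply: measurableT_comp => //; exact/measurable_EFinP.
  - exact: measurable_EFin_normc.
  - by move=> t _; rewrite lee_fin.
by split; apply: aux => // t; [exact: normc_Re_le | exact: normc_Im_le].
Qed.

Lemma cintegrable_measurable f : cintegrable f -> cmeasurable_on T f.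
Proof. by move/cintegrableP => []. Qed.

Lemma cintegrableD f g : cintegrable f -> cintegrable g -> cintegrable (fun t => f t + g t).
Proof.
move=> /cintegrableP[mf If] /cintegrableP[mg Ig]; apply/cintegrableP; split.
  exact: cmeasurableD.
apply: (le_lt_trans (norm1D (@measurable_Tdom R) mf mg)).
exact: lte_add_pinfty.
Qed.

Lemma cintegrableM f g (C : R) : cintegrable f -> cmeasurable_on T g ->
  (forall t, T t -> normc (g t) <= C) -> cintegrable (fun t => f t * g t).
Proof.
move=> /cintegrableP[mf If] mg gC; apply/cintegrableP; split; first exact: cmeasurableM.
have C0 : 0 <= C.
  have T0 : T 0 by rewrite /Tdom /= in_itv /= lexx mulr_gt0// pi_gt0.
  exact: le_trans (normc_ge0 _) (gC 0 T0).
apply: (le_lt_trans (norm1M_le (@measurable_Tdom R) mf mg C0 gC)).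
by rewrite lte_mul_pinfty// lee_fin.
Qed.

Lemma cintegrableZ z f : cintegrable f -> cintegrable (fun t => z * f t).
Proof.
move=> If; rewrite (_ : (fun t => _) = (fun t => f t * z)).
  by apply: (@cintegrableM _ _ (normc z)) => //; exact: cmeasurable_cst.
by apply/funext => t; rewrite mulrC.
Qed.

Lemma cintegrable_bounded f (C : R) : cmeasurable_on T f ->
  (forall t, T t -> normc (f t) <= C) -> cintegrable f.
Proof.
move=> mf fC; rewrite (_ : f = (fun t => 1 * f t)); last by apply/funext => t; rewrite mul1r.
apply: (@cintegrableM _ _ C) => //; apply/cintegrableP; split; first exact: cmeasurable_cst.
rewrite /norm1 Normc.normc1 integral_cst; last exact: measurable_Tdom.
rewrite mul1e; exact: Tdom_lty.
Qed.

Lemma cintegralD f g : cintegrable f -> cintegrable g ->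
  cintegral (fun t => f t + g t) = cintegral f + cintegral g.
Proof.
move=> [f1 f2] [g1 g2]; rewrite /cintegral.
under eq_Rintegral do rewrite ReD.
under [in X in Complex _ X]eq_Rintegral do rewrite ImD.
by rewrite !RintegralD//; exact: measurable_Tdom.
Qed.

Lemma cintegralZ z f : cintegrable f ->
  cintegral (fun t => z * f t) = z * cintegral f.
Proof.
move=> [f1 f2]; rewrite /cintegral; have mT := @measurable_Tdom R.
under eq_Rintegral do rewrite ReM.
under [in X in Complex _ X]eq_Rintegral do rewrite ImM.
have Zl a u : mu.-integrable T (EFin \o u) -> mu.-integrable T (EFin \o (fun t => a * u t)).
  move=> Iu; have : mu.-integrable T (fun t => a%:E * (u t)%:E)%E by exact: integrableZl.
  by apply: eq_integrable => // t _; rewrite /= EFinM.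
rewrite RintegralB ?RintegralD ?RintegralZl//; try exact: Zl.
by case: z.
Qed.

Lemma cintegral_sum (I : Type) (r : seq I) (F : I -> R -> R[i]) :
  (forall i, cintegrable (F i)) ->
  cintegral (fun t => \sum_(i <- r) F i t) = \sum_(i <- r) cintegral (F i) /\
  cintegrable (fun t => \sum_(i <- r) F i t).
Proof.
move=> IF; elim: r => [|i r [IH1 IH2]].
  split.
    rewrite big_nil (_ : (fun t => _) = fun t => 0 * (0 : R[i])).
      rewrite cintegralZ ?mul0r//.
      by apply: (@cintegrable_bounded _ 0) => [|t _]; [exact: cmeasurable_cst|rewrite Normc.normc0].
    by apply/funext => t; rewrite big_nil mul0r.
  apply: (@cintegrable_bounded _ 0) => [|t _]; last by rewrite big_nil Normc.normc0.
  by under eq_fun do rewrite big_nil; exact: cmeasurable_cst.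
have E : (fun t => \sum_(j <- i :: r) F j t) = (fun t => F i t + \sum_(j <- r) F j t).
  by apply/funext => t; rewrite big_cons.
by rewrite E big_cons cintegralD// IH1; split => //; exact: cintegrableD.
Qed.

(** The factor 2 comes from estimating the real and imaginary parts separately. *)
Lemma normc_cintegral_le f : cintegrable f ->
  ((normc (cintegral f))%:E <= 2%:E * norm1 T f)%E.
Proof.
move=> If; have [mf If'] := (cintegrableP f).1 If; have [f1 f2] := If.
have mT := @measurable_Tdom R.
have aux (u : R -> R) : mu.-integrable T (EFin \o u) -> (forall t, `|u t| <= normc (f t)) ->
    ((`|Rintegral mu T u|)%:E <= norm1 T f)%E.
  move=> Iu uf; rewrite EFin_normr_Rintegral//.
  apply: (le_trans (le_abse_integral mu mT _)); first by case/integrableP: Iu.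
  apply: ge0_le_integral => //.
  - by apply: measurableT_comp => //; case/integrableP: Iu.
  - exact: measurable_EFin_normc.
  - by move=> t _; rewrite lee_fin.
apply: (@le_trans _ _ ((`|Re (cintegral f)|)%:E + (`|Im (cintegral f)|)%:E)%E).
  by rewrite -EFinD lee_fin normc_le_ReIm.
have -> : 2%:E = (1%:E + 1%:E)%E :> \bar R by rewrite -EFinD.
rewrite ge0_muleDl// mul1e; apply: leeD.
  by apply: aux => // t; exact: normc_Re_le.
by apply: aux => // t; exact: normc_Im_le.
Qed.

End ComplexIntegral.

(** * Orthogonality of the exponentials *)

Section Orthogonality.
Context {R : realType}.
Local Notation mu := (@lebesgue_measure R).
Local Notation T := (Tdom R).
Implicit Types (f g u : R -> R[i]) (n : int).

Lemma Rintegral_Tdom_derive (f F : R -> R) : (forall x : R, is_derive x 1 F (f x)) ->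
  continuous f -> Rintegral mu T f = F (2 * pi) - F 0.
Proof.
move=> dF cf.
have cF x : {for x, continuous F}.
  apply: differentiable_continuous; apply/derivable1_diffP.
  by case: (dF x).
have p0 : 0 < 2 * pi :> R by rewrite mulr_gt0// pi_gt0.
have -> : Rintegral mu T f = fine (\int[mu]_(x in `[0%R, (2 * pi)%R]) (f x)%:E)%E.
  rewrite /Rintegral /Tdom integral_itv_bndo_bndc//.
  apply/measurable_EFinP; apply: measurable_funTS; exact: continuous_measurable_fun.
rewrite (@continuous_FTC2 R f F 0 (2 * pi))//.
- exact: continuous_subspaceT.
- split=> [x _||].
  + by case: (dF x).
  + exact: cvg_at_right_filter (cF 0).
  + exact: cvg_at_left_filter (cF (2 * pi)).
- by move=> x _; rewrite derive1E; case: (dF x).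
Qed.

Lemma cexpi_int2pi n : cexpi (n%:~R * (2 * pi)) = 1 :> R[i].
Proof.
case: n => k; first by rewrite -[_ * _]add0r cexpiD2pi cexpi0.
by rewrite NegzE rmorphN mulNr cexpiN -[_ * _]add0r cexpiD2pi cexpi0 invr1.
Qed.

Lemma cintegral_cexpi n :
  cintegral (fun t => cexpi (n%:~R * t)) = (if n == 0 then 2 * pi else 0 : R)%:C.
Proof.
have lin (a x : R) : is_derive x 1 (fun t : R => a * t) a.
  by apply: (is_derive_eq (is_deriveZ a (is_derive_id x 1))); rewrite /GRing.scale /= mulr1.
have contl (a : R) : continuous (fun t : R => a * t).
  by move=> x; apply: continuousM; [exact: cst_continuous|exact: cvg_id].
case: eqP => [->|/eqP n0]; rewrite /cintegral /=.
  have d1 (x : R) : is_derive x 1 (fun t : R => t) (cos (0 * x)).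
    by rewrite mul0r cos0; exact: is_derive_id.
  have d2 (x : R) : is_derive x 1 (fun=> 0 : R) (sin (0 * x)).
    by rewrite mul0r sin0; exact: is_derive_cst.
  have c1 : continuous (fun t : R => cos (0 * t)).
    by move=> x; apply: continuous_comp; [exact: contl|exact: continuous_cos].
  have c2 : continuous (fun t : R => sin (0 * t)).
    by move=> x; apply: continuous_comp; [exact: contl|exact: continuous_sin].
  by rewrite (Rintegral_Tdom_derive d1 c1) (Rintegral_Tdom_derive d2 c2) subr0 subrr.
have nR : n%:~R != 0 :> R by rewrite intr_eq0.
have e2 : Complex (cos (n%:~R * (2 * pi))) (sin (n%:~R * (2 * pi))) = Complex 1 0 :> R[i].
  exact: cexpi_int2pi.
have [c2 s2] : cos (n%:~R * (2 * pi)) = 1 :> R /\ sin (n%:~R * (2 * pi)) = 0 :> R.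
  by case: e2.
have d1 (x : R) : is_derive x 1 (fun t => n%:~R^-1 * sin (n%:~R * t)) (cos (n%:~R * x)).
  apply: (is_derive_eq (@is_deriveZ R R R _ (n%:~R^-1) x _ _
      (@is_derive1_comp R sin (fun t => n%:~R * t) x _ _ (is_derive_sin _) (lin n%:~R x)))).
  by rewrite /GRing.scale /= mulrCA mulVf ?mulr1.
have d2 (x : R) : is_derive x 1 (fun t => - n%:~R^-1 * cos (n%:~R * t)) (sin (n%:~R * x)).
  apply: (is_derive_eq (@is_deriveZ R R R _ (- n%:~R^-1) x _ _
      (@is_derive1_comp R cos (fun t => n%:~R * t) x _ _ (is_derive_cos _) (lin n%:~R x)))).
  by rewrite /GRing.scale /= !mulNr mulrN opprK mulrCA mulVf ?mulr1.
have c1 : continuous (fun t : R => cos (n%:~R * t)).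
  by move=> x; apply: continuous_comp; [exact: contl|exact: continuous_cos].
have c3 : continuous (fun t : R => sin (n%:~R * t)).
  by move=> x; apply: continuous_comp; [exact: contl|exact: continuous_sin].
rewrite (Rintegral_Tdom_derive d1 c1) (Rintegral_Tdom_derive d2 c3).
by rewrite s2 c2 !mulr0 sin0 cos0 mulr0 !subrr.
Qed.

Definition fint f n := cintegral (fun t => f t * cexpi (- (n%:~R * t))).

Lemma fint_fourier f n : fint f n = (2 * pi)%:C * fourier_coef f n.
Proof.
rewrite /fourier_coef -/(fint f n) mulrA.
have -> : Complex (2 * pi)^-1 0 = ((2 * pi)^-1)%:C :> R[i] by [].
by rewrite -rmorphM divff ?rmorph1 ?mul1r// gt_eqF// mulr_gt0// pi_gt0.
Qed.

Lemma measurable_linear (a : R) (D : set R) : measurable_fun D (fun t : R => a * t).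
Proof. by apply: measurable_funM => //; exact: measurable_id. Qed.

Lemma cmeasurable_cexpi_lin (a : R) (D : set R) : cmeasurable_on D (fun t => cexpi (a * t)).
Proof. by apply: (@cmeasurable_cexpi _ _ (fun t => a * t)); exact: measurable_linear. Qed.

Lemma cintegrable_cexpi f (a : R) : cintegrable f -> cintegrable (fun t => f t * cexpi (a * t)).
Proof.
move=> If; apply: (@cintegrableM _ _ _ 1) => //; first exact: cmeasurable_cexpi_lin.
by move=> t _; rewrite normc_cexpi.
Qed.

Lemma fint_shift f (k : int) n :
  fint (fun t => f t * cexpi (k%:~R * t)) n = fint f (n - k).
Proof.
rewrite /fint; congr cintegral; apply/funext => t; rewrite -mulrA -cexpiD.
by congr (_ * cexpi _); rewrite rmorphB /=; ring.
Qed.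

Lemma fint0 f : fint f 0 = cintegral f.
Proof. by rewrite /fint; congr cintegral; apply/funext => t; rewrite mul0r oppr0 cexpi0 mulr1. Qed.

End Orthogonality.

(** * Square summability of lacunary coefficients *)

Section RieszProduct.
Context {R : realType}.
Local Notation mu := (@lebesgue_measure R).
Local Notation T := (Tdom R).
Implicit Types (f g u h : R -> R[i]) (n : int) (beta : nat -> R[i]) (p : nat -> nat).

(* A Riesz product with imaginary coefficients: the modulus of a factor is
   sqrt(1 + x^2) <= exp(x^2 / 2), so that it is bounded when [beta] is square
   summable. *)
Fixpoint riesz beta p J (t : R) : R[i] :=
  if J is J'.+1 then
    riesz beta p J' t * (1 + Complex 0 1 * (Re (beta J' * cexpi ((p J')%:R * t)))%:C)
  else 1.

Lemma cmeasurable_riesz beta p J (D : set R) : cmeasurable_on D (riesz beta p J).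
Proof.
elim: J => [|J IH] /=; first exact: cmeasurable_cst.
apply: cmeasurableM => //; apply: cmeasurableD; first exact: cmeasurable_cst.
apply: cmeasurableM; first exact: cmeasurable_cst.
split => /=; last exact: measurable_cst.
by apply: (cmeasurableM (cmeasurable_cst _ _) (cmeasurable_cexpi_lin _ _)).1.
Qed.

Lemma riesz_bound beta p J t :
  normc (riesz beta p J t) ^+ 2 <= expR (\sum_(j < J) normc (beta j) ^+ 2).
Proof.
elim: J => [|J IH].
  by rewrite big_ord0 expR0 [riesz _ _ _ _]/= Normc.normc1 expr1n.
rewrite [riesz _ _ _ _]/= big_ord_recr expRD Normc.normcM exprMn; apply: ler_pM; rewrite ?sqr_ge0//.
apply: le_trans (expR_ge1Dx _).
set x := Re _; have -> : normc (1 + Complex 0 1 * x%:C) ^+ 2 = 1 + x ^+ 2.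
  by rewrite sqr_normc ReD ImD ReM ImM /=; ring.
rewrite /x lerD2l -real_normK ?num_real// lerXn2r ?nnegrE ?normc_ge0 ?normr_ge0//.
by apply: le_trans (normc_Re_le _) _; rewrite Normc.normcM normc_cexpi mulr1.
Qed.

Lemma riesz_bounded beta p J t :
  normc (riesz beta p J t) <= expR (\sum_(j < J) normc (beta j) ^+ 2).
Proof.
rewrite -(@ler_pXn2r _ 2)// ?nnegrE ?normc_ge0 ?expR_ge0//.
apply: (le_trans (riesz_bound _ _ _ _)); rewrite expr2 ler_peMl ?expR_ge0//.
by rewrite -expR0 ler_expR sumr_ge0// => j _; exact: sqr_ge0.
Qed.

Lemma cintegrable_riesz u beta p J : cintegrable u ->
  cintegrable (fun t => u t * riesz beta p J t).
Proof.
move=> Iu; apply: (cintegrableM Iu (cmeasurable_riesz beta p J _)) => t _.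
exact: riesz_bounded.
Qed.

Lemma cintegral_rieszS u beta p J : cintegrable u ->
  cintegral (fun t => u t * riesz beta p J.+1 t) =
  cintegral (fun t => u t * riesz beta p J t) +
  (Complex 0 (1 / 2) * beta J *
     cintegral (fun t => u t * cexpi ((p J)%:R * t) * riesz beta p J t) +
   Complex 0 (1 / 2) * conjc (beta J) *
     cintegral (fun t => u t * cexpi ((- (p J)%:Z)%:~R * t) * riesz beta p J t)).
Proof.
move=> Iu.
have I0 := cintegrable_riesz beta p J Iu.
have I1 := cintegrable_riesz beta p J (cintegrable_cexpi (p J)%:R Iu).
have I2 := cintegrable_riesz beta p J (cintegrable_cexpi (- (p J)%:Z)%:~R Iu).
have I1' := cintegrableZ (Complex 0 (1 / 2) * beta J) I1.
have I2' := cintegrableZ (Complex 0 (1 / 2) * conjc (beta J)) I2.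
rewrite -(cintegralZ _ I1) -(cintegralZ _ I2) -(cintegralD I1' I2').
rewrite -(cintegralD I0 (cintegrableD I1' I2')).
congr cintegral; apply/funext => t /=.
have -> : (Re (beta J * cexpi ((p J)%:R * t)))%:C =
    (1 / 2)%:C * (beta J * cexpi ((p J)%:R * t) + conjc (beta J) * cexpi ((- (p J)%:Z)%:~R * t)).
  have -> : conjc (beta J) * cexpi ((- (p J)%:Z)%:~R * t) = conjc (beta J * cexpi ((p J)%:R * t)).
    by rewrite rmorphM /= -[Complex _ (- _)]/(conjc (cexpi ((p J)%:R * t))) conj_cexpi rmorphN mulNr.
  case: (beta J * _) => a b; apply/eqP; rewrite eq_complex /=.
  by apply/andP; split; apply/eqP; field.
have -> : Complex 0 (1 / 2) = Complex 0 1 * (1 / 2)%:C :> R[i].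
  by apply/eqP; rewrite eq_complex /=; apply/andP; split; apply/eqP; ring.
by ring.
Qed.

Definition psum p J := (\sum_(j < J) p j)%N.

(** The induction runs over all [u] at once. The last factor shifts the spectrum of [u] by p_J or
    -p_J; as p_J exceeds p_0 + ... + p_(J-1), the shifted function has no coefficient left in the
    window of the shorter product, not even at 0. *)
Lemma riesz_mean beta p J u : (forall j, (psum p j < p j)%N) -> cintegrable u ->
  (forall n, n != 0 -> (`|n| <= psum p J)%N -> fint u n = 0) ->
  cintegral (fun t => u t * riesz beta p J t) = cintegral u.
Proof.
move=> pS; elim: J u => [|J IH] u Iu un0.
  by congr cintegral; apply/funext => t; rewrite /= mulr1.
have psumS : psum p J.+1 = (psum p J + p J)%N by rewrite /psum big_ord_recr.
rewrite cintegral_rieszS// IH//; last first.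
  by move=> n n0 nJ; apply: un0 => //; rewrite psumS; apply: leq_trans nJ (leq_addr _ _).
have aux (k : int) : `|k|%N = p J ->
    cintegral (fun t => u t * cexpi (k%:~R * t) * riesz beta p J t) = 0.
  move=> kp; have z n : (`|n| <= psum p J)%N -> fint u (n - k) = 0.
    have pJ := pS J; move=> nJ; apply: un0; last by rewrite psumS; lia.
    by rewrite subr_eq0; apply/eqP => nk; move: nJ pJ; rewrite nk kp; lia.
  rewrite IH; first by rewrite -fint0 fint_shift z.
    exact: cintegrable_cexpi.
  by move=> n _ nJ; rewrite fint_shift z.
have -> : (p J)%:R = (p J)%:Z%:~R :> R by [].
by rewrite !aux ?mulr0 ?addr0//; lia.
Qed.

End RieszProduct.

Section Lacunary.
Context {R : realType}.
Local Notation mu := (@lebesgue_measure R).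
Local Notation T := (Tdom R).
Variables (q : nat -> nat) (h : R -> R[i]).
Hypothesis q_pos : forall k, (0 < q k)%N.
Hypothesis q_incr : forall k, (q k < q k.+1)%N.
Hypothesis hQ : LS (negQ q) h.

Let Ih : cintegrable h := hQ.1.

Lemma lacunary_mono i j : (i <= j)%N -> (q i <= q j)%N.
Proof. by apply: (@homo_leq _ _ leq) => // [|k]; [exact: leq_trans | exact/ltnW]. Qed.

Lemma leq_lacunary i : (i <= q i)%N.
Proof. by elim: i => // i IH; apply: leq_ltn_trans IH (q_incr i). Qed.

Lemma fint_outside n : (forall i, n != - (q i)%:Z) -> fint h n = 0.
Proof.
move=> nq; rewrite fint_fourier hQ.2 ?mulr0// => -[i ni].
by have := nq i; rewrite ni eqxx.
Qed.

Section Tail.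
Variable k0 : nat.
Hypothesis ratio3 : forall k, (k0 <= k)%N -> (3 * q k <= q k.+1)%N.
Let p j := q (k0 + j).

Let psum_half J : (2 * psum p J <= p J)%N.
Proof.
elim: J => [|J IH]; first by rewrite /psum big_ord0 muln0.
rewrite /psum big_ord_recr /= -/(psum p J).
by have := ratio3 (leq_addr J k0); rewrite -addnS -/(p J) -/(p J.+1); lia.
Qed.

Let psum_lt J : (psum p J < p J)%N.
Proof. by have := psum_half J; have := q_pos (k0 + J); rewrite -/(p J); lia. Qed.

(** The ratio 3 gives 2 [psum p J] <= p_J, so a move from -p_J by at most [psum p J] meets no other
    frequency of [h]. *)
Let fint_near J n : n != 0 -> (`|n| <= psum p J)%N -> fint h (n - (p J)%:Z) = 0.
Proof.
move=> n0 nJ; apply: fint_outside => i; apply/eqP => ni.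
have half := psum_half J; have pp := q_pos (k0 + J); rewrite -/(p J) in pp.
case: (ltngtP i (k0 + J)%N) => ij.
- case: J ni nJ half ij pp => [|J] ni nJ half ij pp; first by move: nJ n0; rewrite /psum big_ord0; lia.
  have : (q i <= p J)%N by apply: lacunary_mono; rewrite addnS ltnS in ij.
  by have := ratio3 (leq_addr J k0); rewrite -addnS -/(p J) -/(p J.+1); lia.
- have : (p J.+1 <= q i)%N by apply: lacunary_mono; rewrite addnS.
  by have := ratio3 (leq_addr J k0); rewrite -addnS -/(p J) -/(p J.+1); lia.
- by move: ni n0; rewrite ij -/(p J); lia.
Qed.

Let fint_pos n : 0 <= n -> fint h n = 0.
Proof. by move=> n0; apply: fint_outside => i; have := q_pos i; lia. Qed.

(** Each new factor reads off one coefficient: its e^(i p_J t) half picks the coefficient of [h] at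
    -p_J, while the conjugate half looks at +p_J, where [h] has none. *)
Let riesz_integral beta J : cintegral (fun t => h t * riesz beta p J t) =
  \sum_(j < J) Complex 0 (1 / 2) * beta j * fint h (- (p j)%:Z).
Proof.
elim: J => [|J IH].
  rewrite big_ord0 -(fint_pos (lexx 0)) fint0; congr cintegral; apply/funext => t.
  by rewrite /= mulr1.
rewrite cintegral_rieszS// IH big_ord_recr /=; congr (_ + _).
have -> : (p J)%:R = (p J)%:Z%:~R :> R by [].
rewrite !(riesz_mean _ psum_lt); first last.
- by move=> n n0 nJ; rewrite fint_shift fint_near.
- exact: cintegrable_cexpi.
- move=> n n0 nJ; rewrite fint_shift opprK fint_pos//.
  by have := psum_lt J; lia.
- exact: cintegrable_cexpi.
rewrite -!fint0 !fint_shift opprK sub0r add0r [fint h (p J)]fint_pos// mulr0 addr0.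
by [].
Qed.

Lemma tail_square_summable : exists A : R, forall J,
  \sum_(j < J) normc (fint h (- (p j)%:Z)) ^+ 2 <= A.
Proof.
have [mh h1] := (cintegrableP h).1 Ih.
have nh : norm1 T h = (fine (norm1 T h))%:E.
  by rewrite fineK// ge0_fin_numE// norm1_ge0.
set n1 := fine _ in nh.
have n10 : 0 <= n1 by apply: fine_ge0; exact: norm1_ge0.
exists ((4 * expR 1 * n1) ^+ 2) => J; set B := \sum_(j < J) _.
have B0 : 0 <= B by apply: sumr_ge0 => j _; exact: sqr_ge0.
have [->|Bn0] := eqVneq B 0; first exact: sqr_ge0.
have sB0 : 0 < Num.sqrt B by rewrite sqrtr_gt0 lt_neqAle eq_sym Bn0.
have sBB : Num.sqrt B ^+ 2 = B by rewrite sqr_sqrtr.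
pose x := (Num.sqrt B)^-1; have x0 : 0 < x by rewrite invr_gt0.
(* Duality in l^2: the conjugate coefficients, normalized. The Riesz product is then bounded by e,
   while its integral against [h] is (i/2) sqrt B; with [normc_cintegral_le] this gives sqrt B <= 4
   e ||h||. *)
pose beta j := x%:C * conjc (fint h (- (p j)%:Z)).
have sumbeta : \sum_(j < J) normc (beta j) ^+ 2 = 1.
  under eq_bigr do rewrite /beta Normc.normcM normc_conj normc_real exprMn (ger0_norm (ltW x0)).
  by rewrite -mulr_sumr -/B -sBB /x -exprMn mulVf ?expr1n// gt_eqF.
have LE : cintegral (fun t => h t * riesz beta p J t) = Complex 0 (1 / 2 * Num.sqrt B).
  rewrite riesz_integral.
  have -> : \sum_(j < J) Complex 0 (1 / 2) * beta j * fint h (- (p j)%:Z) =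
      Complex 0 (1 / 2) * (x * B)%:C.
    rewrite mulr_sumr rmorph_sum mulr_sumr; apply: eq_bigr => j _.
    set a := fint _ _; rewrite [RHS](_ : _ = Complex 0 (1 / 2) * (x%:C * (normc a ^+ 2)%:C)).
      by rewrite -mulr_conjc /beta -/a; ring.
    by rewrite -rmorphM.
  have -> : x * B = Num.sqrt B by rewrite -[X in _ * X]sBB /x expr2 mulrA mulVf ?mul1r// gt_eqF.
  by apply/eqP; rewrite eq_complex /=; apply/andP; split; apply/eqP; ring.
have := normc_cintegral_le (cintegrable_riesz beta p J Ih).
rewrite LE; have -> : normc (Complex 0 (1 / 2 * Num.sqrt B)) = 1 / 2 * Num.sqrt B.
  by rewrite /= expr0n /= add0r sqrtr_sqr ger0_norm// mulr_ge0// ltW.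
move=> le1.
have : ((1 / 2 * Num.sqrt B)%:E <= 2%:E * ((expR 1)%:E * n1%:E))%E.
  apply: (le_trans le1); rewrite lee_wpmul2l// -nh.
  apply: norm1M_le => //; [exact: measurable_Tdom|exact: cmeasurable_riesz|].
  by move=> t _; rewrite -sumbeta riesz_bounded.
rewrite -!EFinM lee_fin => le2.
rewrite -[leLHS]sBB lerXn2r ?nnegrE ?(ltW sB0)// ?mulr_ge0 ?expR_ge0//.
by rewrite -mulrA; move: (expR 1 * n1) le2 => w; lra.
Qed.

End Tail.

Lemma square_summable : (exists k0, forall k, (k0 <= k)%N -> (3 * q k <= q k.+1)%N) ->
  exists A : R, forall J, \sum_(j < J) normc (fint h (- (q j)%:Z)) ^+ 2 <= A.
Proof.
move=> [k0 r3]; have [A HA] := tail_square_summable r3.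
exists (\sum_(j < k0) normc (fint h (- (q j)%:Z)) ^+ 2 + A) => J.
have : (\sum_(j < k0 + J) normc (fint h (- (q j)%:Z)) ^+ 2 <=
   \sum_(j < k0) normc (fint h (- (q j)%:Z)) ^+ 2 + A).
  by rewrite big_split_ord /= lerD2l HA.
apply: le_trans; rewrite addnC big_split_ord /= lerDl.
by apply: sumr_ge0 => j _; exact: sqr_ge0.
Qed.

Lemma sum_delta_le (N a k : nat) (c : R) : 0 <= c ->
  \sum_(j < N) (if (j + a == k)%N then c else 0) <= c.
Proof.
move=> c0; suff -> : \sum_(j < N) (if (j + a == k)%N then c else 0) =
    if (a <= k < N + a)%N then c else 0 by case: ifP.
elim: N => [|N IH].
  by rewrite big_ord0 add0n; case: ifP => // /andP[]; lia.
rewrite big_ord_recr /= IH.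
case: (eqVneq (N + a)%N k) => [<-|Nk].
  by rewrite ltnn andbF add0r leq_addl addSn ltnSn.
rewrite addr0; congr (if _ then _ else _).
by apply/andP/andP => -[ak kN]; split => //; move: Nk => /eqP; lia.
Qed.

(** Controls row k of the double sum in [fejer]. Each -q_i occurs for at most one j, and q_i >= i
    restricts the indices to i <= k. *)
Lemma window_square_le (A : R) :
  (forall J, \sum_(j < J) normc (fint h (- (q j)%:Z)) ^+ 2 <= A) ->
  forall N k, \sum_(j < N) normc (fint h (j%:Z - k%:Z)) ^+ 2 <= A.
Proof.
move=> HA N k; apply: le_trans (HA k.+1).
apply: (@le_trans _ _ (\sum_(j < N) \sum_(i < k.+1)
   (if (j + q i == k)%N then normc (fint h (- (q i)%:Z)) ^+ 2 else 0))).
  apply: ler_sum => j _.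
  have ge0 (i : 'I_k.+1) : 0 <= (if (j + q i == k)%N then normc (fint h (- (q i)%:Z)) ^+ 2 else 0).
    by case: ifP => // _; exact: sqr_ge0.
  have [[i ik]|ni] := pselect (exists i, (j + q i = k)%N); last first.
    rewrite fint_outside ?Normc.normc0 ?expr0n ?sumr_ge0// => i.
    by apply/eqP => ji; apply: ni; exists i; lia.
  have ilt : (i < k.+1)%N by have := leq_lacunary i; lia.
  rewrite (bigD1 (Ordinal ilt))//= ik eqxx.
  have -> : j%:Z - k%:Z = - (q i)%:Z by lia.
  by rewrite lerDl sumr_ge0.
rewrite exchange_big; apply: ler_sum => i _; apply: sum_delta_le; exact: sqr_ge0.
Qed.

End Lacunary.

(** * Fejer means *)

Section FejerKernel.
Context {R : realType}.
Local Notation mu := (@lebesgue_measure R).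
Local Notation T := (Tdom R).
Implicit Types (f g u h : R -> R[i]) (n : int) (N : nat).

Definition fejer_kernel N (x : R) : R :=
  N%:R^-1 * normc (\sum_(j < N) cexpi (j%:R * x)) ^+ 2.

Lemma fejer_kernel_ge0 N x : 0 <= fejer_kernel N x.
Proof. by rewrite mulr_ge0 ?invr_ge0 ?sqr_ge0. Qed.

Lemma fejer_kernelE N x : (fejer_kernel N x)%:C =
  (N%:R^-1)%:C * \sum_(k < N) \sum_(j < N) cexpi ((j%:Z - k%:Z)%:~R * x).
Proof.
rewrite rmorphM /= -mulr_conjc rmorph_sum /= mulr_sumr; congr (_ * _).
apply: eq_bigr => k _; rewrite mulr_suml; apply: eq_bigr => j _.
rewrite -[Complex (cos (k%:R * x)) _]/(conjc (cexpi (k%:R * x))) conj_cexpi -cexpiD.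
by congr cexpi; rewrite rmorphB /=; ring.
Qed.

Lemma fejer_kernelN N x : fejer_kernel N (- x) = fejer_kernel N x.
Proof.
rewrite /fejer_kernel -[in RHS]normc_conj rmorph_sum /=; congr (_ * normc _ ^+ 2).
by apply: eq_bigr => j _; rewrite -[RHS]/(conjc (cexpi (j%:R * x))) conj_cexpi mulrN.
Qed.

Lemma fejer_kernel_le N x (c : R) : 0 < c -> c <= normc (cexpi x - 1) ^+ 2 ->
  fejer_kernel N x <= N%:R^-1 * (4 / c).
Proof.
move=> c0 cx; rewrite ler_wpM2l ?invr_ge0// ler_pdivlMr//.
apply: (@le_trans _ _ (normc (\sum_(j < N) cexpi (j%:R * x)) ^+ 2 * normc (cexpi x - 1) ^+ 2)).
  by rewrite ler_wpM2l ?sqr_ge0.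
rewrite -exprMn -Normc.normcM.
have -> : \sum_(j < N) cexpi (j%:R * x) = \sum_(j < N) cexpi x ^+ j :> R[i].
  by apply: eq_bigr => j _; rewrite cexpiMn.
rewrite mulrC -subrX1 (_ : 4 = 2 ^+ 2 :> R); last by rewrite expr2; lra.
rewrite lerXn2r ?nnegrE ?normc_ge0//; apply: (le_trans (normcB_le _ _)).
by rewrite normcX normc_cexpi expr1n Normc.normc1; lra.
Qed.

Lemma measurable_fejer_kernel N : measurable_fun setT (fejer_kernel N).
Proof.
apply: measurable_funM => //; apply: measurable_funX; apply: measurable_normc.
by apply: cmeasurable_sum => j; exact: cmeasurable_cexpi_lin.
Qed.

Lemma cmeasurable_real (D : set R) (f : R -> R) : measurable_fun D f ->
  cmeasurable_on D (fun x => (f x)%:C).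
Proof. by move=> mf; split => //=; exact: measurable_cst. Qed.

Lemma fejer_kernel_bounded N : exists C : R, forall x, fejer_kernel N x <= C.
Proof.
exists (N%:R^-1 * N%:R ^+ 2) => x; rewrite ler_wpM2l ?invr_ge0//.
rewrite lerXn2r ?nnegrE ?normc_ge0//; apply: (le_trans (normc_sum _ _ _)).
by rewrite (eq_bigr (fun=> 1)) ?sumr_const ?card_ord// => j _; rewrite normc_cexpi.
Qed.

Lemma measurable_fejer_kernelB N (D : set R) s :
  measurable_fun D (fun t => fejer_kernel N (t - s)).
Proof.
apply: measurable_funTS.
apply: (@measurableT_comp _ _ _ _ _ _ (fejer_kernel N)); first exact: measurable_fejer_kernel.
by apply: measurable_funB; [exact: measurable_id|exact: measurable_cst].
Qed.

Lemma cintegrable_kernel N s : cintegrable (fun t => (fejer_kernel N (t - s))%:C).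
Proof.
have [C kC] := fejer_kernel_bounded N.
apply: (@cintegrable_bounded _ _ C); first by apply: cmeasurable_real; exact: measurable_fejer_kernelB.
by move=> t _; rewrite normc_real ger0_norm ?fejer_kernel_ge0.
Qed.

Lemma cintegral_kernel N s : (0 < N)%N ->
  cintegral (fun t => (fejer_kernel N (t - s))%:C) = (2 * pi)%:C.
Proof.
move=> N0.
pose F (k j : 'I_N) t : R[i] := cexpi (- ((j%:Z - k%:Z)%:~R * s)) * cexpi ((j%:Z - k%:Z)%:~R * t).
have IF k j : cintegrable (F k j).
  apply: (@cintegrable_bounded _ _ 1).
    by apply: cmeasurableM; [exact: cmeasurable_cst|exact: cmeasurable_cexpi_lin].
  by move=> t _; rewrite Normc.normcM !normc_cexpi mulr1.
have IF' k := (@cintegral_sum R _ (index_enum 'I_N) (F k) (IF k)).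
have IF'' := @cintegral_sum R _ (index_enum 'I_N) _ (fun k => (IF' k).2).
have -> : (fun t => (fejer_kernel N (t - s))%:C) =
    (fun t => (N%:R^-1)%:C * \sum_(k < N) \sum_(j < N) F k j t).
  apply/funext => t; rewrite fejer_kernelE; congr (_ * _).
  apply: eq_bigr => k _; apply: eq_bigr => j _; rewrite /F -cexpiD; congr cexpi; ring.
rewrite cintegralZ; last exact: IF''.2.
rewrite IF''.1 (eq_bigr (fun=> (2 * pi)%:C)) => [|k _].
  rewrite sumr_const card_ord -rmorphMn -rmorphM /=; congr (_%:C).
  rewrite -[2 * pi *+ N]mulr_natl mulKf//.
  by rewrite pnatr_eq0 -lt0n.
rewrite (IF' k).1 (bigD1 k)//= big1 => [|j jk].
  rewrite addr0 /F cintegralZ ?cintegral_cexpi.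
    by rewrite subrr eqxx mul0r oppr0 cexpi0 mul1r.
  by apply: (@cintegrable_bounded _ _ 1) => [|t _]; [exact: cmeasurable_cexpi_lin|rewrite normc_cexpi].
rewrite /F cintegralZ ?cintegral_cexpi.
  rewrite subr_eq0 (_ : (j%:Z == k%:Z) = false) ?mulr0//.
  by apply/negbTE; apply: contraNneq jk => jk; apply/eqP/val_inj; case: jk.
by apply: (@cintegrable_bounded _ _ 1) => [|t _]; [exact: cmeasurable_cexpi_lin|rewrite normc_cexpi].
Qed.

Lemma integral_kernel N s : (0 < N)%N ->
  (\int[mu]_(t in T) (fejer_kernel N (t - s))%:E = (2 * pi)%:E)%E.
Proof.
move=> N0; have := cintegral_kernel s N0; rewrite /cintegral /= => -[E _].
rewrite -E /Rintegral fineK//.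
rewrite ge0_fin_numE; last by apply: integral_ge0 => t _; rewrite lee_fin fejer_kernel_ge0.
have [_] := (cintegrableP _).1 (cintegrable_kernel N s); apply: le_lt_trans.
rewrite le_eqVlt; apply/orP; left; apply/eqP; apply: eq_integral => t _.
by rewrite normc_real ger0_norm ?fejer_kernel_ge0.
Qed.

Lemma integral_kernelN N t : (0 < N)%N ->
  (\int[mu]_(s in T) (fejer_kernel N (t - s))%:E = (2 * pi)%:E)%E.
Proof.
move=> N0; rewrite -(integral_kernel t N0); apply: eq_integral => s _.
by rewrite -fejer_kernelN opprB.
Qed.

(** The double sum replaces the weights 1 - |n| / N: it is an average over k of trigonometric
    polynomials, to each of which [parseval] and [window_square_le] apply. *)
Definition fejer N h t : R[i] := ((2 * pi)^-1 * N%:R^-1)%:C *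
  \sum_(k < N) \sum_(j < N) fint h (j%:Z - k%:Z) * cexpi ((j%:Z - k%:Z)%:~R * t).

Lemma cintegrable_mul_kernel N h t : cintegrable h ->
  cintegrable (fun s => h s * (fejer_kernel N (t - s))%:C).
Proof.
move=> Ih; have [C kC] := fejer_kernel_bounded N.
apply: (@cintegrableM _ _ _ C) => //; last first.
  by move=> s _; rewrite normc_real ger0_norm ?fejer_kernel_ge0.
under eq_fun do rewrite -fejer_kernelN opprB.
by apply: cmeasurable_real; exact: measurable_fejer_kernelB.
Qed.

Lemma fejer_conv N h t : cintegrable h ->
  fejer N h t = ((2 * pi)^-1)%:C * cintegral (fun s => h s * (fejer_kernel N (t - s))%:C).
Proof.
move=> Ih; rewrite /fejer rmorphM /= -mulrA; congr (_ * _).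
pose F (k j : 'I_N) s : R[i] := cexpi ((j%:Z - k%:Z)%:~R * t) *
  (h s * cexpi (- ((j%:Z - k%:Z)%:~R * s))).
have IF k j : cintegrable (F k j).
  apply: cintegrableZ.
  by under eq_fun do rewrite -mulNr; exact: cintegrable_cexpi.
have IF' k := (@cintegral_sum R _ (index_enum 'I_N) (F k) (IF k)).
have IF'' := @cintegral_sum R _ (index_enum 'I_N) _ (fun k => (IF' k).2).
have -> : (fun s => h s * (fejer_kernel N (t - s))%:C) =
    (fun s => (N%:R^-1)%:C * \sum_(k < N) \sum_(j < N) F k j s).
  apply/funext => s; rewrite fejer_kernelE mulrCA; congr (_ * _); rewrite mulr_sumr.
  apply: eq_bigr => k _; rewrite mulr_sumr; apply: eq_bigr => j _.
  by rewrite /F mulrCA -cexpiD; congr (_ * cexpi _); ring.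
rewrite cintegralZ; last exact: IF''.2.
rewrite IF''.1; congr (_ * _); apply: eq_bigr => k _; rewrite (IF' k).1; apply: eq_bigr => j _.
rewrite /F cintegralZ; first by rewrite mulrC.
by under eq_fun do rewrite -mulNr; exact: cintegrable_cexpi.
Qed.

End FejerKernel.

Section FejerApproximation.
Context {R : realType}.
Local Notation mu := (@lebesgue_measure R).
Local Notation T := (Tdom R).
Implicit Types (f g u h : R -> R[i]) (n : int) (N : nat).

Lemma tonelli_kernel N (v : R -> R) : measurable_fun T v -> (forall t, 0 <= v t) ->
  measurable_fun T (fun t => \int[mu]_(s in T) (v s * fejer_kernel N (t - s))%:E)%E /\
  (\int[mu]_(t in T) \int[mu]_(s in T) (v s * fejer_kernel N (t - s))%:E =
   \int[mu]_(s in T) \int[mu]_(t in T) (v s * fejer_kernel N (t - s))%:E)%E.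
Proof.
move=> mv v0; have mT := @measurable_Tdom R.
(* Tonelli is applied on the whole plane, so both restrictions to T are moved into the integrand:
   for s through [w], for t through the indicator [i]. *)
pose w : R -> R := v \_ T.
pose i : R -> R := \1_T.
pose F (p : measurableTypeR R * measurableTypeR R) : \bar R := (i p.1 * (w p.2 * fejer_kernel N (p.1 - p.2)))%:E.
have mw : measurable_fun setT w by apply/(measurable_restrictT _ mT).
have mi : measurable_fun setT i by exact: measurable_indic.
have F0 (p : measurableTypeR R * measurableTypeR R) : (0 <= F p)%E.
  rewrite lee_fin; apply: mulr_ge0; first by rewrite /i indicE.
  apply: mulr_ge0; last exact: fejer_kernel_ge0.
  by rewrite /w /patch; case: ifP.
have mF : measurable_fun setT F.
  apply/measurable_EFinP; apply: measurable_funM.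
    exact: (measurableT_comp mi (@measurable_fst _ _ (measurableTypeR R) (measurableTypeR R))).
  apply: measurable_funM.
    exact: (measurableT_comp mw (@measurable_snd _ _ (measurableTypeR R) (measurableTypeR R))).
  apply: (@measurableT_comp _ _ _ _ _ _ (fejer_kernel N)); first exact: measurable_fejer_kernel.
  by apply: measurable_funB; [exact: measurable_fst|exact: measurable_snd].
have inner t : t \in T -> (\int[mu]_(s in T) (v s * fejer_kernel N (t - s))%:E =
    \int[mu]_s F (t, s))%E.
  move=> tT; rewrite integral_mkcond; apply: eq_integral => s _.
  rewrite /F /patch /i indicE /= tT mul1r /w /patch.
  by case: ifP => // _; rewrite mul0r.
split.
  apply: (eq_measurable_fun (fun t => \int[mu]_s F (t, s))%E) => [t tT|]; first by rewrite inner.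
  exact: (measurable_funTS (measurable_fun_fubini_tonelli_F (m2 := mu) F mF F0)).
have := fubini_tonelli (m1 := mu) (m2 := mu) F mF F0; rewrite /F /= => E.
rewrite [LHS]integral_mkcond [RHS]integral_mkcond.
transitivity (\int[mu]_x \int[mu]_y (i x * (w y * fejer_kernel N (x - y)))%:E)%E.
  clear E; apply: eq_integral => t _; rewrite /patch; case: ifPn => tT; first exact: inner.
  rewrite /i indicE (negbTE tT) integral0_eq// => s _.
  by rewrite mul0r.
rewrite {}E; apply: eq_integral => s _; rewrite [in RHS]/patch; case: ifPn => sT.
  rewrite [RHS]integral_mkcond; apply: eq_integral => t _; rewrite /w /patch sT /i indicE.
  by case: ifP => tT; rewrite ?mul1r ?mul0r.
by rewrite integral0_eq// => t _; rewrite /w /patch (negbTE sT) mul0r mulr0.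
Qed.

Lemma cmeasurable_fejer N h (D : set R) : cmeasurable_on D (fejer N h).
Proof.
apply: cmeasurableM; first exact: cmeasurable_cst.
apply: cmeasurable_sum => k; apply: cmeasurable_sum => j; apply: cmeasurableM.
  exact: cmeasurable_cst.
exact: cmeasurable_cexpi_lin.
Qed.

Lemma normc_conv_le N u t : cintegrable u ->
  ((normc (((2 * pi)^-1)%:C * cintegral (fun s => u s * (fejer_kernel N (t - s))%:C)))%:E <=
   (pi^-1)%:E * \int[mu]_(s in T) (normc (u s) * fejer_kernel N (t - s))%:E)%E.
Proof.
move=> Iu; have p0 := @pi_gt0 R.
have pn0 : pi != 0 :> R by rewrite gt_eqF.
rewrite Normc.normcM normc_real ger0_norm ?invr_ge0 ?mulr_ge0 ?(ltW p0)// EFinM.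
have -> : (pi^-1)%:E = (((2 * pi)^-1)%:E * 2%:E)%E :> \bar R.
  by rewrite -EFinM invfM mulrAC mulVf ?mul1r.
rewrite -muleA lee_wpmul2l ?lee_fin ?invr_ge0 ?mulr_ge0 ?(ltW p0)//.
have -> : (\int[mu]_(s in T) (normc (u s) * fejer_kernel N (t - s))%:E)%E =
    norm1 T (fun s => u s * (fejer_kernel N (t - s))%:C).
  apply: eq_integral => s _; congr EFin.
  by rewrite Normc.normcM normc_real ger0_norm ?fejer_kernel_ge0.
exact: normc_cintegral_le (cintegrable_mul_kernel N t Iu).
Qed.

Lemma norm1_fejer N h : (0 < N)%N -> cintegrable h ->
  (norm1 T (fejer N h) <= 2%:E * norm1 T h)%E.
Proof.
move=> N0 Ih; have [mh h1] := (cintegrableP h).1 Ih; have mT := @measurable_Tdom R.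
have p0 := @pi_gt0 R; have mnh := measurable_normc mh.
have m2 s : measurable_fun T (fun t => (normc (h s) * fejer_kernel N (t - s))%:E).
  apply/measurable_EFinP; apply: measurable_funM; first exact: measurable_cst.
  exact: measurable_fejer_kernelB.
have TK := tonelli_kernel N mnh (fun t => normc_ge0 _).
apply: (@le_trans _ _ (\int[mu]_(t in T) ((pi^-1)%:E *
    \int[mu]_(s in T) (normc (h s) * fejer_kernel N (t - s))%:E))%E).
  apply: ge0_le_integral => //.
  - by move=> t _; rewrite lee_fin normc_ge0.
  - by apply: measurable_EFin_normc; exact: cmeasurable_fejer.
  - exact: measurable_funeM TK.1.
  - by move=> t _; rewrite (fejer_conv N t Ih); exact: normc_conv_le Ih.
have ip0 : (0 <= (pi^-1)%:E :> \bar R)%E by rewrite lee_fin invr_ge0 ltW.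
have in0 t : T t -> (0 <= \int[mu]_(s in T) (normc (h s) * fejer_kernel N (t - s))%:E)%E.
  by move=> _; apply: integral_ge0 => s _; rewrite lee_fin mulr_ge0 ?normc_ge0 ?fejer_kernel_ge0.
rewrite (ge0_integralZl mu mT TK.1 in0 ip0) TK.2 {TK in0}.
have -> : (\int[mu]_(s in T) \int[mu]_(t in T) (normc (h s) * fejer_kernel N (t - s))%:E =
    (2 * pi)%:E * norm1 T h)%E.
  have m3 : measurable_fun T (fun t => (normc (h t))%:E) by exact/measurable_EFinP.
  have h0 t : T t -> (0 <= (normc (h t))%:E :> \bar R)%E by rewrite lee_fin normc_ge0.
  have tp0 : (0 <= (2 * pi)%:E :> \bar R)%E by rewrite lee_fin mulr_ge0// ltW.
  rewrite -(ge0_integralZl mu mT m3 h0 tp0); apply: eq_integral => s _.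
  have m4 : measurable_fun T (fun t => (fejer_kernel N (t - s))%:E).
    by apply/measurable_EFinP; exact: measurable_fejer_kernelB.
  have k0 t : T t -> (0 <= (fejer_kernel N (t - s))%:E :> \bar R)%E.
    by rewrite lee_fin fejer_kernel_ge0.
  have hs0 : (0 <= (normc (h s))%:E :> \bar R)%E by rewrite lee_fin normc_ge0.
  under eq_integral do rewrite EFinM.
  by rewrite (ge0_integralZl mu mT m4 k0 hs0) (integral_kernel s N0) muleC.
have -> : 2%:E = ((pi^-1)%:E * (2 * pi)%:E)%E :> \bar R.
  by rewrite -EFinM mulrCA mulVf ?mulr1 ?gt_eqF.
by rewrite muleA.
Qed.

End FejerApproximation.

(** * Pointwise convergence of Fejer means at points of continuity *)

Section FejerConvergence.
Context {R : realType}.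
Local Notation mu := (@lebesgue_measure R).
Local Notation T := (Tdom R).
Implicit Types (f g u h : R -> R[i]) (n : int) (N : nat).

Lemma sqr_normc_cexpiB1 (x : R) : normc (cexpi x - 1) ^+ 2 = 2 - 2 * cos x.
Proof.
rewrite sqr_normc ReD ReN ImD ImN /=; have := cos2Dsin2 x => cs.
rewrite subr0 sqrrB1 mulr_natl -[in RHS]addrA; lra.
Qed.

Lemma cos_le_far (d x : R) : 0 < d -> d <= `|x| -> `|x| <= 2 * pi - d -> cos x <= cos d.
Proof.
move=> d0 dx xd; have -> : cos x = cos `|x|.
  by have [x0|x0] := leP 0 x; [rewrite ger0_norm|rewrite ltr0_norm ?cosN].
move: dx xd; move: `|x| => y dy yd.
have mono (a b : R) : 0 < a -> a <= b -> b <= pi -> cos b <= cos a.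
  move=> a0 ab bp; move: ab; rewrite le_eqVlt => /orP[/eqP->//|ab]; apply: ltW.
  by rewrite ltr_cos// in_itv /=; apply/andP; split; lra.
have [yp|yp] := leP y pi; first exact: mono.
have -> : cos y = cos (2 * pi - y).
  rewrite -[RHS]cosN opprB -[in LHS](subrK (pi *+ 2) y) cosD2pi.
  by rewrite mulr_natl.
apply: mono => //; lra.
Qed.

Lemma fejer_sub N u t : (0 < N)%N -> cintegrable u ->
  fejer N u t - u t = ((2 * pi)^-1)%:C *
    cintegral (fun s => (u s - u t) * (fejer_kernel N (t - s))%:C).
Proof.
move=> N0 Iu; rewrite (fejer_conv N t Iu).
have Ik : cintegrable (fun s => (fejer_kernel N (t - s))%:C).
  by under eq_fun do rewrite -fejer_kernelN opprB; exact: cintegrable_kernel.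
have -> : (fun s => (u s - u t) * (fejer_kernel N (t - s))%:C) =
   (fun s => u s * (fejer_kernel N (t - s))%:C + (- u t) * (fejer_kernel N (t - s))%:C).
  by apply/funext => s; rewrite mulrDl.
rewrite (cintegralD (cintegrable_mul_kernel N t Iu) (cintegrableZ _ Ik)) (cintegralZ _ Ik).
have -> : (fun s => (fejer_kernel N (t - s))%:C) = (fun s => (fejer_kernel N (s - t))%:C).
  by apply/funext => s; rewrite -fejer_kernelN opprB.
rewrite (cintegral_kernel t N0) [RHS]mulrDr; apply: (congr1 (fun z => _ + z)).
rewrite mulrCA -rmorphM /= mulVf ?mulr1//.
by rewrite mulf_neq0// gt_eqF ?pi_gt0.
Qed.

(** Since [u] is not assumed periodic, t keeps a distance d from both ends of T. Then |t - s| > d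
    leaves t - s at distance at least d from 0 and from 2 pi, -2 pi, where the kernel is
    concentrated. *)
Lemma fejer_sub_le N u t (d e B : R) : (0 < N)%N -> cmeasurable_on T u ->
  (forall s, T s -> normc (u s) <= B) -> 0 < d -> d <= t -> t <= 2 * pi - d -> 0 <= e ->
  (forall s, `|s - t| <= d -> normc (u s - u t) <= e) ->
  normc (fejer N u t - u t) <= 2 * e + N%:R^-1 * (16 * B / (2 - 2 * cos d)).
Proof.
move=> N0 mU uB d0 dt td e0 ue; have p0 := @pi_gt0 R; have mT := @measurable_Tdom R.
have Tt : T t by rewrite /Tdom /= in_itv /=; apply/andP; split; lra.
have Iu : cintegrable u by exact: cintegrable_bounded uB.
have B0 : 0 <= B by exact: le_trans (normc_ge0 _) (uB _ Tt).
have c0 : 0 < 2 - 2 * cos d.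
  have : cos d < cos 0 by rewrite ltr_cos// in_itv /=; apply/andP; split; lra.
  by rewrite cos0; lra.
have Iv : cintegrable (fun s => u s - u t).
  by apply: cintegrableD => //; apply: (@cintegrable_bounded _ _ (normc (- u t))).
pose b : R := 2 * B * (N%:R^-1 * (4 / (2 - 2 * cos d))).
have b0 : 0 <= b by rewrite !mulr_ge0 ?invr_ge0// ltW.
have ptw s : T s -> normc (u s - u t) * fejer_kernel N (t - s) <=
    e * fejer_kernel N (t - s) + b.
  move=> Ts; have k0 := fejer_kernel_ge0 N (t - s).
  have [st|st] := leP `|s - t| d.
    by apply: ler_wpDr => //; rewrite ler_wpM2r ?ue.
  apply: ler_wpDl; first by rewrite mulr_ge0.
  apply: ler_pM => //; first exact: normc_ge0.
    apply: (le_trans (normcB_le _ _)); have := uB _ Ts; have := uB _ Tt; lra.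
  apply: fejer_kernel_le => //; rewrite sqr_normc_cexpiB1.
  have : cos (t - s) <= cos d; last by lra.
  apply: cos_le_far => //; first by rewrite distrC ltW.
  move: Ts; rewrite /Tdom /= in_itv /= => /andP[s0 s2].
  by rewrite ler_norml; apply/andP; split; lra.
rewrite -lee_fin (fejer_sub t N0 Iu); apply: (le_trans (normc_conv_le N t Iv)).
have mk : measurable_fun T (fun s => fejer_kernel N (t - s)).
  by under eq_fun do rewrite -fejer_kernelN opprB; exact: measurable_fejer_kernelB.
have mk' : measurable_fun T (fun s => (fejer_kernel N (t - s))%:E).
  exact/measurable_EFinP.
have k0 s : T s -> (0 <= (fejer_kernel N (t - s))%:E :> \bar R)%E.
  by move=> _; rewrite lee_fin fejer_kernel_ge0.
have le1 : (\int[mu]_(s in T) (normc (u s - u t) * fejer_kernel N (t - s))%:E <=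
    \int[mu]_(s in T) (e%:E * (fejer_kernel N (t - s))%:E + b%:E))%E.
  apply: ge0_le_integral => //.
  - by move=> s _; rewrite lee_fin mulr_ge0 ?normc_ge0 ?fejer_kernel_ge0.
  - apply/measurable_EFinP; apply: measurable_funM => //.
    exact: (measurable_normc (cintegrable_measurable Iv)).
  - by apply: emeasurable_funD; [exact: measurable_funeM|exact: measurable_cst].
have e0' : (0 <= e%:E :> \bar R)%E by rewrite lee_fin.
have ek0 s : T s -> (0 <= e%:E * (fejer_kernel N (t - s))%:E :> \bar R)%E.
  by move=> Ts; rewrite mule_ge0// k0.
have E : (\int[mu]_(s in T) (e%:E * (fejer_kernel N (t - s))%:E + b%:E) =
    (e * (2 * pi) + b * (2 * pi))%:E)%E.
  rewrite (ge0_integralD mu mT ek0 (measurable_funeM _ mk')); last 2 first.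
  - by move=> s _; rewrite lee_fin.
  - exact: measurable_cst.
  rewrite (ge0_integralZl mu mT mk' k0 e0') (integral_kernelN t N0) integral_cst//.
  have M2 : mu T = (2 * pi)%:E := @lebesgue_measure_Tdom R.
  by rewrite [X in (_ + b%:E * X)%E]M2 -!EFinM -EFinD.
have ip0 : (0 <= (pi^-1)%:E :> \bar R)%E by rewrite lee_fin invr_ge0 ltW.
apply: (le_trans (lee_wpmul2l ip0 le1)); rewrite E -EFinM lee_fin.
rewrite -mulrDl mulrCA (_ : pi^-1 * _ = 2); last by rewrite mulrCA mulVf ?mulr1 ?gt_eqF.
rewrite mulrC mulrDr lerD2l /b le_eqVlt; apply/orP; left; apply/eqP; field.
by rewrite pnatr_eq0 -lt0n N0 gt_eqF.
Qed.

Lemma normc_fejer_le N u t (B : R) : (0 < N)%N -> cmeasurable_on T u ->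
  (forall s, T s -> normc (u s) <= B) -> 0 <= B -> normc (fejer N u t) <= 2 * B.
Proof.
move=> N0 mU uB B0; have p0 := @pi_gt0 R; have mT := @measurable_Tdom R.
have Iu : cintegrable u by exact: cintegrable_bounded uB.
have mk : measurable_fun T (fun s => fejer_kernel N (t - s)).
  by under eq_fun do rewrite -fejer_kernelN opprB; exact: measurable_fejer_kernelB.
have mk' : measurable_fun T (fun s => (fejer_kernel N (t - s))%:E).
  exact/measurable_EFinP.
have k0 s : T s -> (0 <= (fejer_kernel N (t - s))%:E :> \bar R)%E.
  by move=> _; rewrite lee_fin fejer_kernel_ge0.
rewrite -lee_fin (fejer_conv N t Iu); apply: (le_trans (normc_conv_le N t Iu)).
have le1 : (\int[mu]_(s in T) (normc (u s) * fejer_kernel N (t - s))%:E <=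
    \int[mu]_(s in T) (B%:E * (fejer_kernel N (t - s))%:E))%E.
  apply: ge0_le_integral => //.
  - by move=> s _; rewrite lee_fin mulr_ge0 ?normc_ge0 ?fejer_kernel_ge0.
  - apply/measurable_EFinP; apply: measurable_funM => //; exact: measurable_normc mU.
  - exact: measurable_funeM.
  - by move=> s Ts; rewrite -EFinM lee_fin ler_wpM2r ?uB ?fejer_kernel_ge0.
have ip0 : (0 <= (pi^-1)%:E :> \bar R)%E by rewrite lee_fin invr_ge0 ltW.
have B0' : (0 <= B%:E :> \bar R)%E by rewrite lee_fin.
apply: (le_trans (lee_wpmul2l ip0 le1)).
rewrite (ge0_integralZl mu mT mk' k0 B0') (integral_kernelN t N0) -!EFinM lee_fin.
have pn0 : pi != 0 :> R by rewrite gt_eqF.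
by rewrite [leLHS]mulrCA [_^-1 * _]mulrCA mulVf// mulr1 [leLHS]mulrC.
Qed.

Lemma fejer_cvg u (B t : R) : cmeasurable_on T u ->
  (forall s, T s -> normc (u s) <= B) -> `]0, 2 * pi[%classic t ->
  {for t, continuous (fun s => Re (u s))} -> {for t, continuous (fun s => Im (u s))} ->
  (fun N => normc (fejer N.+1 u t - u t)) @ \oo --> (0 : R).
Proof.
move=> mU uB; rewrite /= in_itv /= => /andP[t0 t2] cr ci.
apply/cvgrPdist_le => e e0.
have e4 : 0 < e / 8 by lra.
move/cvgrPdist_le : cr => /(_ _ e4) /nbhs_ballP[d1 /= d10 h1].
move/cvgrPdist_le : ci => /(_ _ e4) /nbhs_ballP[d2 /= d20 h2].
pose d := Num.min (Num.min t (2 * pi - t)) (Num.min (d1 / 2) (d2 / 2)).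
have d0 : 0 < d by rewrite !lt_min; apply/andP; split; apply/andP; split; lra.
have [da db dc dd] : [/\ d <= t, d <= 2 * pi - t, d <= d1 / 2 & d <= d2 / 2].
  by split; rewrite /d !ge_min lexx ?orbT.
have ue s : `|s - t| <= d -> normc (u s - u t) <= e / 4.
  move=> st; have st1 : ball t d1 s by rewrite /ball /= distrC; lra.
  have st2 : ball t d2 s by rewrite /ball /= distrC; lra.
  apply: (le_trans (normc_le_ReIm _)); rewrite ReD ReN ImD ImN.
  by have := h1 _ st1; have := h2 _ st2; rewrite ![`|_ (u t) - _|]distrC /=; lra.
have c0 : 0 < 2 - 2 * cos d.
  have : cos d < cos 0 by rewrite ltr_cos// in_itv /=; apply/andP; split; lra.
  by rewrite cos0; lra.
have B0 : 0 <= B.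
  by apply: (le_trans (normc_ge0 (u t)) (uB _ _)); rewrite /Tdom /= in_itv /= t2 ltW.
pose b := 16 * B / (2 - 2 * cos d).
have b0 : 0 <= b by rewrite !mulr_ge0 ?invr_ge0// ltW.
exists (Num.truncn (b / (e / 2))).+1 => // N /= leN.
rewrite sub0r normrN ger0_norm ?normc_ge0//.
have td : t <= 2 * pi - d by lra.
have e40 : 0 <= e / 4 by lra.
apply: (le_trans (fejer_sub_le (ltn0Sn N) mU uB d0 da td e40 ue)).
rewrite -/b; suff : N.+1%:R^-1 * b <= e / 2.
  by clear; move: (_ * b) => x; lra.
rewrite mulrC ler_pdivrMr// mulrC -ler_pdivrMr; last by lra.
apply/ltW/(lt_le_trans (truncnS_gt _)); rewrite ler_nat ltnS.
exact: leq_trans leN.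
Qed.

End FejerConvergence.

(** * Convergence of Fejer means in L^1 *)

Section FejerDensity.
Context {R : realType}.
Local Notation mu := (@lebesgue_measure R).
Local Notation T := (Tdom R).
Implicit Types (f g u h : R -> R[i]) (n : int) (N : nat).

Lemma ae_imply (P Q : R -> Prop) : (forall t, P t -> Q t) ->
  {ae mu, forall t, P t} -> {ae mu, forall t, Q t}.
Proof. exact: (@filterS _ _ (ae_filter_ringOfSetsType mu)). Qed.

Lemma ae_imply2 (P Q S : R -> Prop) : (forall t, P t -> Q t -> S t) ->
  {ae mu, forall t, P t} -> {ae mu, forall t, Q t} -> {ae mu, forall t, S t}.
Proof. exact: (@filterS2 _ _ (ae_filter_ringOfSetsType mu)). Qed.

Lemma norm1_cvg0 (D : set R) (w : nat -> R -> R[i]) (C e : R) : measurable D -> D `<=` T ->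
  (forall N, cmeasurable_on D (w N)) ->
  {ae mu, forall t, D t -> (forall N, normc (w N t) <= C) /\
                           (fun N => normc (w N t)) @ \oo --> (0 : R)} ->
  0 < e -> exists N0 : nat, forall N, (N0 <= N)%N -> (norm1 D (w N) <= e%:E)%E.
Proof.
move=> mD DT mw wC e0.
have Dfin : (mu D < +oo)%E.
  apply: le_lt_trans (@Tdom_lty R); apply: le_measure; rewrite ?inE//; exact: measurable_Tdom.
have ICst : mu.-integrable D (cst C%:E).
  apply/integrableP; split; first exact: measurable_cst.
  by rewrite integral_cst// lte_mul_pinfty.
have cvg0 : {ae mu, forall t, D t -> (fun N => (normc (w N t))%:E) @ \oo --> (0%:E : \bar R)}.
  move: wC; apply: ae_imply => t H Dt; have [_ c0] := H Dt.
  by apply: cvg_EFin => //; exact: nearW.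
have bnd : {ae mu, forall t, forall N, D t -> (`|(normc (w N t))%:E| <= (cst C%:E) t)%E}.
  move: wC; apply: ae_imply => t H N Dt; have [b _] := H Dt.
  by rewrite /= lee_fin ger0_norm ?normc_ge0.
have mf N : measurable_fun D (fun t => (normc (w N t))%:E) by exact: measurable_EFin_normc.
have m0 : measurable_fun D (fun=> 0%:E : \bar R) by exact: measurable_cst.
have [_ _ lim] := @dominated_convergence _ _ R mu D mD _ (fun=> 0%:E) _ mf m0 cvg0 ICst bnd.
move: lim; rewrite integral0 => /fine_cvgP[fin] /cvgrPdist_le/(_ _ e0) near1.
have [N1 _ hN] := filterI fin near1.
exists N1 => N leN; have [f1 f2] := hN N leN.
rewrite /norm1 -[leLHS]fineK// lee_fin; apply: le_trans (ler_norm _) _.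
by move: f2; rewrite /= sub0r normrN.
Qed.

Lemma continuous_fejer_cvg u (e : R) :
  continuous (fun s => Re (u s)) -> continuous (fun s => Im (u s)) -> 0 < e ->
  exists N0 : nat, forall N, (N0 <= N)%N ->
    (norm1 T (fun t => fejer N.+1 u t - u t)%R <= e%:E)%E.
Proof.
move=> cr ci e0; have p0 := @pi_gt0 R; have mT := @measurable_Tdom R.
have mU D : cmeasurable_on D u.
  by split; apply: measurable_funTS; exact: continuous_measurable_fun.
have bnd (v : R -> R) : continuous v -> exists B, forall s, T s -> `|v s| <= B.
  move=> cv; have [||c _ hc] := @EVT_max R (fun s => `|v s|) 0 (2 * pi).
  - by rewrite mulr_ge0// ltW.
  - by apply: continuous_subspaceT => x; apply: cvg_norm; exact: cv.
  exists (`|v c|) => s; rewrite /Tdom /= in_itv /= => /andP[s0 s2]; apply: hc.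
  by rewrite in_itv /= s0 ltW.
have [B1 h1] := bnd _ cr; have [B2 h2] := bnd _ ci.
have uB s : T s -> normc (u s) <= B1 + B2.
  by move=> Ts; apply: (le_trans (normc_le_ReIm _)); rewrite lerD ?h1 ?h2.
have B0 : 0 <= B1 + B2.
  by apply: (le_trans (normc_ge0 (u 0)) (uB _ _)); rewrite /Tdom /= in_itv /= lexx mulr_gt0.
pose D : set R := `]0, 2 * pi[%classic.
have mD : measurable D by exact: measurable_itv.
have DT : D `<=` T.
  by move=> t; rewrite /D /Tdom /= !in_itv /= => /andP[/ltW-> ->].
have mw N E : cmeasurable_on E (fun t => fejer N.+1 u t - u t).
  by apply: cmeasurableB => //; exact: cmeasurable_fejer.
have [|N0 hN] := @norm1_cvg0 D (fun N t => fejer N.+1 u t - u t) (3 * (B1 + B2)) e mD DT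
    (fun N => mw N D) _ e0.
  apply: aeW => t Dt; split=> [N|].
    apply: (le_trans (normcB_le _ _)).
    have := normc_fejer_le t (ltn0Sn N) (mU T) uB B0; have := uB _ (DT _ Dt); lra.
  exact: fejer_cvg (mU T) uB Dt (cr t) (ci t).
exists N0 => N leN; apply: le_trans (hN N leN); rewrite le_eqVlt; apply/orP; left; apply/eqP.
apply/esym; apply: integral_itv_obnd_cbnd; exact: measurable_EFin_normc.
Qed.

(** Density argument: a continuous [u] is close to [h] in L^1, and [norm1_fejer] bounds the mean of
    h - u uniformly in N. The budget is e/4 for h - u, e/2 for its Fejer mean and e/8 for [u]. *)
Lemma fejer_approx h (e : R) : cintegrable h -> 0 < e ->
  exists2 N : nat, (0 < N)%N & (norm1 T (fun t => h t - fejer N h t)%R <= e%:E)%E.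
Proof.
move=> Ih e0; have mT := @measurable_Tdom R.
have approx (v : R -> R) : mu.-integrable T (EFin \o v) ->
    exists2 w : R -> R, continuous w & (norm1 T (fun t => (v t - w t)%:C)%R <= (e / 8)%:E)%E.
  move=> Iv; have [w [cw Iw lim]] := approximation_continuous_integrable mT (@Tdom_lty R) Iv.
  have e8 : 0 < e / 8 by lra.
  move/fine_cvgP : lim => [fin] /cvgrPdist_le/(_ _ e8) near1.
  have [N0 _ hN] := filterI fin near1.
  have [f1 f2] := hN N0 (leqnn _).
  exists (w N0) => //; have -> : norm1 T (fun t => (v t - w N0 t)%:C) =
      (\int[mu]_(z in T) `|(v z - w N0 z)%:E|)%E.
    by apply: eq_integral => t _; rewrite normc_real.
  by rewrite -[leLHS]fineK// lee_fin; apply: le_trans (ler_norm _) _; move: f2; rewrite /= sub0r normrN.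
have [If1 If2] := Ih; have [w1 c1 n1] := approx _ If1; have [w2 c2 n2] := approx _ If2.
pose u t := Complex (w1 t) (w2 t).
have mU D : cmeasurable_on D u.
  by split; apply: measurable_funTS; exact: continuous_measurable_fun.
have mh := cintegrable_measurable Ih.
have nu : (norm1 T (fun t => h t - u t)%R <= (e / 4)%:E)%E.
  have E : norm1 T (fun t => h t - u t)%R =
      norm1 T (fun t => (Re (h t) - w1 t)%:C + 'i * (Im (h t) - w2 t)%:C)%R.
    apply: eq_norm1 => t _; congr (normc _); rewrite /u; case: (h t) => a b.
    by apply/eqP; rewrite eq_complex /=; apply/andP; split; apply/eqP; ring.
  have m1 : cmeasurable_on T (fun t => (Re (h t) - w1 t)%:C).
    by apply: cmeasurable_real; apply: measurable_funB; [case: mh|case: (mU T)].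
  have m2 : cmeasurable_on T (fun t => (Im (h t) - w2 t)%:C).
    by apply: cmeasurable_real; apply: measurable_funB; [case: mh|case: (mU T)].
  rewrite E; apply: (le_trans (norm1D mT m1 (cmeasurableM (cmeasurable_cst _ _) m2))).
  rewrite (norm1Z _ mT m2) (_ : normc 'i = 1); last first.
    by rewrite /= expr0n /= expr1n add0r sqrtr1.
  by rewrite mul1e (_ : e / 4 = e / 8 + e / 8) ?EFinD ?leeD//; lra.
have Iu : cintegrable u.
  have Ed : cintegrable (fun t => h t - u t).
    apply/cintegrableP; split; first exact: cmeasurableB.
    by apply: (le_lt_trans nu); rewrite ltry.
  rewrite (_ : u = (fun t => h t + (- 1) * (h t - u t))).
    by apply: cintegrableD => //; exact: cintegrableZ.
  by apply/funext => t; ring.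
have e8 : 0 < e / 8 by lra.
have [N hN] := @continuous_fejer_cvg u _ c1 c2 e8.
exists N.+1 => //; have {hN} := hN N (leqnn _).
set F : R -> R[i] := fun t => fejer N.+1 u t - u t => nF.
have Ed : cintegrable (fun t => h t - u t).
  rewrite (_ : (fun t => h t - u t) = (fun t => h t + (- 1) * u t)).
    by apply: cintegrableD => //; exact: cintegrableZ.
  by apply/funext => t; ring.
have E t : h t - fejer N.+1 h t = (h t - u t) - (F t + fejer N.+1 (fun t => h t - u t) t).
  rewrite /F (fejer_conv _ _ Ed) (fejer_conv _ _ Ih) (fejer_conv _ _ Iu).
  rewrite (_ : (fun s => (h s - u s) * _) = (fun s => h s * (fejer_kernel N.+1 (t - s))%:C +
     (- 1) * (u s * (fejer_kernel N.+1 (t - s))%:C))); last first.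
    by apply/funext => s; ring.
  have I1 := cintegrable_mul_kernel N.+1 t Ih; have I2 := cintegrable_mul_kernel N.+1 t Iu.
  rewrite (cintegralD I1 (cintegrableZ _ I2)) (cintegralZ _ I2); ring.
rewrite (eq_norm1 (g := fun t => (h t - u t) - (F t + fejer N.+1 (fun t => h t - u t) t))%R); last first.
  by move=> t _; rewrite E.
have mF : cmeasurable_on T F by apply: cmeasurableB => //; exact: cmeasurable_fejer.
have mf (v : R -> R[i]) : cmeasurable_on T (fejer N.+1 v) by exact: cmeasurable_fejer.
apply: (le_trans (norm1B mT (cintegrable_measurable Ed) (cmeasurableD mF (mf _)))).
have n3 := le_trans (norm1_fejer (ltn0Sn N) Ed) (lee_wpmul2l (_ : 0 <= 2%:E)%E nu).
have -> : e%:E = ((e / 4)%:E + ((e / 8)%:E + (2 * (e / 4))%:E) + (e/8)%:E)%E.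
  by rewrite -!EFinD; congr (_%:E); lra.
rewrite -[leLHS]adde0; apply: leeD; last by rewrite lee_fin; lra.
apply: leeD => //; apply: (le_trans (norm1D mT mF (mf _))); apply: leeD => //.
by apply: (le_trans (n3 _)); rewrite ?lee_fin// EFinM.
Qed.

End FejerDensity.

(** * Differences of functions with lacunary spectrum *)

Section Shift.
Context {R : realType}.
Local Notation mu := (@lebesgue_measure R).
Local Notation T := (Tdom R).
Implicit Types (f g u h : R -> R[i]) (n : int) (N : nat).

Lemma lebesgue_measure_shift (th : R) (A : set R) : measurable A ->
  mu ((fun t => t + th) @^-1` A) = mu A.
Proof.
move=> mA.
pose phi : measurableTypeR R -> measurableTypeR R := fun t => t + th.
have mphi : measurable_fun setT phi.
  by apply: measurable_funD; [exact: measurable_id|exact: measurable_cst].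
rewrite -[LHS]/(pushforward mu phi A).
apply/esym/lebesgue_measure_unique => //= _ [[a b]] _ <-.
rewrite /pushforward (_ : phi @^-1` _ = `]a - th, b - th]%classic); last first.
  by apply/seteqP; split=> t; rewrite /phi /= !in_itv /= => /andP[c d]; apply/andP; split; lra.
rewrite !lebesgue_measure_itv /= !lte_fin ltrD2r; case: ifP => // _.
by rewrite -!EFinB; congr (_%:E); ring.
Qed.

Lemma measurable_shift (th : R) (A : set R) : measurable A ->
  measurable ((fun t => t + th) @^-1` A).
Proof.
move=> mA; have mphi : measurable_fun setT (fun t : measurableTypeR R => t + th : measurableTypeR R).
  by apply: measurable_funD; [exact: measurable_id|exact: measurable_cst].
by have := mphi measurableT A mA; rewrite setTI.
Qed.

(** Functions are considered on [0, 2 pi) without periodicity, so a translate is used only where t +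
    th stays in that interval; the end of length th is given up. *)
Lemma integral_shift_le (v : R -> R) (th : R) : measurable_fun T v -> (forall t, 0 <= v t) ->
  0 <= th -> (\int[mu]_(t in `[0%R, (2 * pi - th)%R[) (v (t + th)%R)%:E <=
              \int[mu]_(t in T) (v t)%:E)%E.
Proof.
move=> mv v0 th0; have mT := @measurable_Tdom R.
pose phi : measurableTypeR R -> measurableTypeR R := fun t => t + th.
have mphi : measurable_fun setT phi.
  by apply: measurable_funD; [exact: measurable_id|exact: measurable_cst].
pose D : set R := `[th, 2 * pi[%classic.
have mD : measurable D by exact: measurable_itv.
have DT : D `<=` T.
  by move=> t; rewrite /D /Tdom /= !in_itv /= => /andP[t1 ->]; rewrite (le_trans th0 t1).
have mvD : measurable_fun D (fun t => (v t)%:E).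
  by apply/measurable_EFinP; apply: measurable_funS mv.
have preD : phi @^-1` D = `[0, 2 * pi - th[%classic.
  apply/seteqP; split=> t; rewrite /phi /D /= !in_itv /= => /andP[a b]; apply/andP; split; lra.
apply: (@le_trans _ _ (\int[mu]_(t in D) (v t)%:E)%E); last first.
  apply: ge0_subset_integral => //; first exact/measurable_EFinP.
  by move=> t _; rewrite lee_fin.
rewrite -preD -(@ge0_integral_pushforward _ _ _ _ R phi mphi mu D (fun t => (v t)%:E) mD mvD)//.
  rewrite le_eqVlt; apply/orP; left; apply/eqP.
  by apply: eq_measure_integral => A mA _; exact: lebesgue_measure_shift.
by move=> t _; rewrite lee_fin.
Qed.

Lemma cmeasurable_shift f (th : R) : cmeasurable_on T f -> 0 <= th ->
  cmeasurable_on `[0, 2 * pi - th[%classic (fun t => f (t + th)).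
Proof.
move=> [m1 m2] th0; have mT := @measurable_Tdom R.
have aux (v : R -> R) : measurable_fun T v ->
    measurable_fun (`[0, 2 * pi - th[%classic : set R) (fun t => v (t + th)).
  move=> mv; apply: (@measurable_comp _ _ _ (measurableTypeR R) (measurableTypeR R) (measurableTypeR R)
    T v _ (fun t => t + th)) => //.
    move=> _ [t /= + <-]; rewrite /Tdom /= !in_itv /= => /andP[a b]; apply/andP; split; lra.
  by apply: measurable_funD; [exact: measurable_id|exact: measurable_cst].
by split; [exact: aux m1|exact: aux m2].
Qed.

Lemma norm1_shift_le f (th : R) : cmeasurable_on T f -> 0 <= th ->
  (norm1 `[0%R, (2 * pi - th)%R[ (fun t => f (t + th))%R <= norm1 T f)%E.
Proof.
move=> mf th0; apply: (@integral_shift_le (fun t => normc (f t))) => //.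
exact: measurable_normc.
by move=> t; exact: normc_ge0.
Qed.

Lemma parseval N k (c : nat -> R[i]) :
  (\int[mu]_(t in T) (normc (\sum_(j < N) c j * cexpi ((j%:Z - k%:Z)%:~R * t)) ^+ 2)%:E =
   (2 * pi * \sum_(j < N) normc (c j) ^+ 2)%:E)%E.
Proof.
pose W t : R[i] := \sum_(j < N) c j * cexpi ((j%:Z - k%:Z)%:~R * t).
pose F (i j : 'I_N) t : R[i] := (c i * conjc (c j)) * cexpi ((i%:Z - j%:Z)%:~R * t).
have Ic (m : int) : cintegrable (fun t : R => cexpi (m%:~R * t) : R[i]).
  by apply: (@cintegrable_bounded _ _ 1) => [|t _]; [exact: cmeasurable_cexpi_lin|rewrite normc_cexpi].
have IF i j : cintegrable (F i j) by exact: cintegrableZ.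
have IF' i := (@cintegral_sum R _ (index_enum 'I_N) (F i) (IF i)).
have IF'' := @cintegral_sum R _ (index_enum 'I_N) _ (fun i => (IF' i).2).
have WE : (fun t => (normc (W t) ^+ 2)%:C) = (fun t => \sum_(i < N) \sum_(j < N) F i j t).
  apply/funext => t; rewrite -mulr_conjc /W rmorph_sum /= mulr_suml.
  apply: eq_bigr => i _; rewrite mulr_sumr; apply: eq_bigr => j _.
  rewrite rmorphM /= -[Complex (cos ((j%:Z - k%:Z)%:~R * t)) _]/(conjc (cexpi ((j%:Z - k%:Z)%:~R * t))).
  rewrite conj_cexpi /F mulrACA -cexpiD; congr (_ * cexpi _).
  by rewrite !rmorphB /=; ring.
have IW : cintegrable (fun t => (normc (W t) ^+ 2)%:C) by rewrite WE; exact: IF''.2.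
have EW : cintegral (fun t => (normc (W t) ^+ 2)%:C) = (2 * pi * \sum_(j < N) normc (c j) ^+ 2)%:C.
  rewrite WE IF''.1 mulr_sumr rmorph_sum /=; apply: eq_bigr => i _.
  rewrite (IF' i).1 (bigD1 i)//= big1 => [|j ji].
    rewrite addr0 /F cintegralZ// cintegral_cexpi subrr eqxx mulr_conjc -rmorphM.
    by rewrite mulrC.
  rewrite /F cintegralZ// cintegral_cexpi subr_eq0 (_ : (i%:Z == j%:Z) = false) ?mulr0//.
  by apply/negbTE; apply: contraNneq ji => ij; apply/eqP/val_inj; case: ij.
have [EW1 _] : (Rintegral mu T (fun t => normc (W t) ^+ 2) = 2 * pi * \sum_(j < N) normc (c j) ^+ 2)
    /\ True by split => //; have := congr1 (@complex.Re R) EW.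
rewrite -EW1 /Rintegral fineK//.
rewrite ge0_fin_numE; last by apply: integral_ge0 => t _; rewrite lee_fin sqr_ge0.
have [_] := (cintegrableP _).1 IW; apply: le_lt_trans.
rewrite le_eqVlt; apply/orP; left; apply/eqP; apply: eq_integral => t _.
by rewrite normc_real ger0_norm ?sqr_ge0.
Qed.

(* Integrate 2 x <= rho + x^2 / rho. *)
Lemma norm1_le_sqr f (rho S : R) : cmeasurable_on T f -> 0 < rho -> 0 <= S ->
  (\int[mu]_(t in T) (normc (f t) ^+ 2)%:E <= (2 * pi * S)%:E)%E ->
  (norm1 T f <= (pi * (rho + rho^-1 * S))%:E)%E.
Proof.
move=> mf rho0 S0 le2; have p0 := @pi_gt0 R; have mT := @measurable_Tdom R.
have m2 : measurable_fun T (fun t => (normc (f t) ^+ 2)%:E).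
  apply/measurable_EFinP; apply: measurable_funX; exact: measurable_normc.
have c0 : (0 <= (rho^-1 / 2)%:E :> \bar R)%E by rewrite lee_fin divr_ge0// invr_ge0 ltW.
have n0 t : T t -> (0 <= (normc (f t) ^+ 2)%:E :> \bar R)%E by move=> _; rewrite lee_fin sqr_ge0.
apply: (@le_trans _ _ (\int[mu]_(t in T) ((rho / 2)%:E + (rho^-1 / 2)%:E * (normc (f t) ^+ 2)%:E))%E).
  apply: ge0_le_integral => //.
  - by move=> t _; rewrite lee_fin normc_ge0.
  - exact: measurable_EFin_normc.
  - by apply: emeasurable_funD; [exact: measurable_cst|exact: measurable_funeM].
  move=> t _; rewrite -EFinM -EFinD lee_fin; move: (normc (f t)) => x.
  rewrite -subr_ge0 (_ : _ - x = (rho^-1 / 2) * (x - rho) ^+ 2).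
    by rewrite mulr_ge0 ?sqr_ge0// divr_ge0// invr_ge0 ltW.
  by field; rewrite gt_eqF.
have rh0 t : T t -> (0 <= (rho / 2)%:E :> \bar R)%E by move=> _; rewrite lee_fin divr_ge0// ltW.
have cn0 t : T t -> (0 <= (rho^-1 / 2)%:E * (normc (f t) ^+ 2)%:E :> \bar R)%E.
  by move=> Tt; rewrite mule_ge0// n0.
rewrite (ge0_integralD mu mT rh0 (@measurable_cst _ _ _ _ _ _) cn0 (measurable_funeM _ m2)).
rewrite (ge0_integralZl mu mT m2 n0 c0) integral_cst//.
have M2 : mu T = (2 * pi)%:E := @lebesgue_measure_Tdom R.
rewrite [X in ((rho / 2)%:E * X)%E]M2.
have -> : (pi * (rho + rho^-1 * S))%:E = ((rho / 2)%:E * (2 * pi)%:E +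
    (rho^-1 / 2)%:E * (2 * pi * S)%:E)%E :> \bar R.
  by rewrite -!EFinM -EFinD; congr (_%:E); field; rewrite gt_eqF.
by rewrite leeD2l// lee_wpmul2l.
Qed.

End Shift.

(** * Smallness of the difference of h in L^1 *)

Section LacunaryDifference.
Context {R : realType}.
Local Notation mu := (@lebesgue_measure R).
Local Notation T := (Tdom R).
Variables (q : nat -> nat) (h : R -> R[i]) (A : R).
Hypothesis hQ : LS (negQ q) h.
Hypothesis hA : forall N k, \sum_(j < N) normc (fint h (j%:Z - k%:Z)) ^+ 2 <= A.
Variables (th rho : R).
Hypothesis rho0 : 0 < rho.
Hypothesis th_rho : forall j, normc (cexpi ((q j)%:R * th) - 1) <= rho.

Let Ih : cintegrable h := hQ.1.
Let mT : measurable T := @measurable_Tdom R.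

Let A0 : 0 <= A.
Proof. by have := hA 0 0; rewrite big_ord0. Qed.

Let coef (n : int) : R[i] := fint h n * (cexpi (n%:~R * th) - 1).

Let coef_le n : normc (coef n) <= rho * normc (fint h n).
Proof.
rewrite /coef Normc.normcM mulrC.
have [E|[j nj]] : fint h n = 0 \/ exists j, n = - (q j)%:Z.
  have [[j nj]|nQ] := pselect (negQ q n); first by right; exists j.
  by left; rewrite fint_fourier hQ.2 ?mulr0.
- by rewrite E Normc.normc0 !mulr0.
apply: ler_wpM2r; first exact: normc_ge0.
rewrite nj rmorphN mulNr normc_cexpiNB1.
exact: th_rho.
Qed.

Let window k N t : R[i] := \sum_(j < N) coef (j%:Z - k%:Z) * cexpi ((j%:Z - k%:Z)%:~R * t).

Let cmeasurable_window k N D : cmeasurable_on D (window k N).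
Proof.
apply: cmeasurable_sum => j; apply: cmeasurableM; [exact: cmeasurable_cst|].
exact: cmeasurable_cexpi_lin.
Qed.

Let norm1_window k N : (norm1 T (window k N) <= (pi * (rho * (1 + A)))%:E)%E.
Proof.
have p0 := @pi_gt0 R.
have S0 : 0 <= rho ^+ 2 * A by rewrite mulr_ge0 ?sqr_ge0.
(* The squares sum to at most rho^2 A; with rho as the free parameter of [norm1_le_sqr], both terms
   there are of order rho. *)
have -> : rho * (1 + A) = rho + rho^-1 * (rho ^+ 2 * A) by field; rewrite gt_eqF.
apply: norm1_le_sqr => //.
rewrite (parseval N k (fun j => coef (j%:Z - k%:Z))) lee_fin.
rewrite ler_wpM2l ?mulr_ge0// ?(ltW p0)//.
apply: (@le_trans _ _ (rho ^+ 2 * \sum_(j < N) normc (fint h (j%:Z - k%:Z)) ^+ 2)).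
  rewrite mulr_sumr; apply: ler_sum => j _; rewrite -exprMn lerXn2r ?nnegrE ?normc_ge0//.
  by rewrite mulr_ge0 ?normc_ge0// ltW.
by rewrite ler_wpM2l ?sqr_ge0.
Qed.

Let fejer_diff N t : fejer N h (t + th) - fejer N h t =
  ((2 * pi)^-1 * N%:R^-1)%:C * \sum_(k < N) window k N t.
Proof.
rewrite /fejer -mulrBr; congr (_ * _); rewrite -sumrB; apply: eq_bigr => k _.
rewrite -sumrB; apply: eq_bigr => j _; rewrite /coef mulrDr cexpiD; ring.
Qed.

Let norm1_fejer_diff N : (0 < N)%N ->
  (norm1 T (fun t => fejer N h (t + th) - fejer N h t)%R <= (rho * (1 + A) / 2)%:E)%E.
Proof.
move=> N0; have p0 := @pi_gt0 R.
rewrite (eq_norm1 (g := fun t => ((2 * pi)^-1 * N%:R^-1)%:C * \sum_(k < N) window k N t)%R); last first.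
  by move=> t _; rewrite fejer_diff.
have mS : cmeasurable_on T (fun t => \sum_(k < N) window k N t).
  by apply: cmeasurable_sum => k; exact: cmeasurable_window.
rewrite (norm1Z _ mT mS) normc_real ger0_norm; last first.
  by rewrite mulr_ge0 ?invr_ge0 ?mulr_ge0// ltW.
have c0 : (0 <= ((2 * pi)^-1 * N%:R^-1)%:E :> \bar R)%E.
  by rewrite lee_fin mulr_ge0 ?invr_ge0 ?mulr_ge0// ltW.
have -> : (rho * (1 + A) / 2)%:E =
    (((2 * pi)^-1 * N%:R^-1)%:E * (N%:R * (pi * (rho * (1 + A))))%:E)%E.
  rewrite -EFinM.
  have -> // : rho * (1 + A) / 2 = (2 * pi)^-1 * N%:R^-1 * (N%:R * (pi * (rho * (1 + A)))).
  by move: p0; move: pi => p p0; field; rewrite pnatr_eq0 -lt0n N0 gt_eqF.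
apply: lee_wpmul2l => //.
have mW k : cmeasurable_on T (fun t => window k N t) by exact: cmeasurable_window.
apply: (le_trans (norm1_sum _ mT (fun k : 'I_N => mW k))).
apply: (@le_trans _ _ (\sum_(k < N) (pi * (rho * (1 + A)))%:E)%E).
  by apply: lee_sum => k _; exact: norm1_window.
by rewrite sumEFin sumr_const card_ord -[X in (X%:E <= _)%E]mulr_natl.
Qed.

(** Fejer means stand in for [h], since [parseval] concerns trigonometric polynomials. Their bound
    rho (1 + A) / 2 is uniform in N, and the approximation error rho / 4 enters twice, at t + th and
    at t. *)
Lemma norm1_diff_le : 0 <= th ->
  (norm1 `[0%R, (2 * pi - th)%R[ (fun t => h (t + th) - h t)%R <= (rho * (1 + A))%:E)%E.
Proof.
move=> th0; pose D : set R := `[0, 2 * pi - th[%classic.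
have mD : measurable D by exact: measurable_itv.
have DT : D `<=` T.
  by move=> t; rewrite /D /Tdom /= !in_itv /= => /andP[-> t2] /=; lra.
have r4 : 0 < rho / 4 by rewrite divr_gt0.
have [N N0 hN] := fejer_approx Ih r4.
pose E t := h t - fejer N h t.
have mE : cmeasurable_on T E.
  by apply: cmeasurableB; [exact: cintegrable_measurable|exact: cmeasurable_fejer].
have mFd : cmeasurable_on T (fun t => fejer N h (t + th) - fejer N h t).
  rewrite (funext (fejer_diff N)); apply: cmeasurableM; first exact: cmeasurable_cst.
  by apply: cmeasurable_sum => k; exact: cmeasurable_window.
have mEs := cmeasurable_shift mE th0.
have mE' := cmeasurable_subset mT DT mE.
have mFd' := cmeasurable_subset mT DT mFd.
rewrite (eq_norm1 (g := fun t => (fejer N h (t + th) - fejer N h t) + (E (t + th) - E t))%R); last first.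
  by move=> t _; congr (normc _); rewrite /E; ring.
apply: (le_trans (norm1D mD mFd' (cmeasurableB mEs mE'))).
apply: (@le_trans _ _ ((rho * (1 + A) / 2)%:E + ((rho / 4)%:E + (rho / 4)%:E))%E).
  apply: leeD.
    exact: le_trans (norm1_subset mD mT DT mFd) (norm1_fejer_diff N0).
  apply: (le_trans (norm1B mD mEs mE')); apply: leeD.
    exact: le_trans (norm1_shift_le mE th0) hN.
  exact: le_trans (norm1_subset mD mT DT mE) hN.
rewrite -!EFinD lee_fin; have : 0 <= rho * A by rewrite mulr_ge0// ltW.
by move: (rho0); lra.
Qed.

End LacunaryDifference.

(** * Angles adapted to a lacunary sequence *)

Section LacunaryAngles.
Context {R : realType}.
Variable q : nat -> nat.
Hypothesis q_pos : forall k, (0 < q k)%N.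
Hypothesis q_incr : forall k, (q k < q k.+1)%N.
Hypothesis q_lac : (fun k => (q k.+1)%:R / (q k)%:R : R) @ \oo --> +oo.

Lemma lacunary_ratio_ge (B : R) : exists k0, forall k, (k0 <= k)%N -> B * (q k)%:R <= (q k.+1)%:R.
Proof.
move/cvgryPge : q_lac => /(_ B) [k0 _ hk]; exists k0 => k kk; have := hk k kk.
by rewrite /= ler_pdivlMr// ltr0n.
Qed.

(* The angle is the common point of nested intervals
   [a_i, a_i + rho / (2 q_(k+i))] with q_(k+i) a_i a multiple of 2 pi for
   i > 0; the ratio of successive q's leaves room for such an a_(i+1). *)
Lemma exists_lacunary_angle (rho tau : R) : 0 < rho -> 0 < tau ->
  exists th : R, [/\ 0 < th, th <= tau & forall j, normc (cexpi ((q j)%:R * th) - 1) <= rho].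
Proof.
move=> rho0 tau0; have p0 := @pi_gt0 R.
have [k0 hk0] := lacunary_ratio_ge (2 * (2 * pi + rho) / rho).
(* Beyond k0 the ratio is large enough; moreover q_k >= k > rho / tau yields rho / q_k <= tau. *)
pose k := maxn k0 (Num.truncn (rho / tau)).+1.
pose Q i : R := (q (k + i))%:R.
have Q0 i : 0 < Q i by rewrite ltr0n.
(* The left end moves by at most 2 pi / Q_(i+1), and the new length is at most rho / Q_(i+1): both
   fit into the old length. *)
have QS i : (2 * pi + rho) / Q i.+1 <= rho / (2 * Q i).
  have : 2 * (2 * pi + rho) / rho * Q i <= Q i.+1.
    by rewrite /Q addnS; apply: hk0; exact: leq_trans (leq_maxl k0 _) (leq_addr _ _).
  move: (Q0 i) (Q0 i.+1); move: (Q i) (Q i.+1) => x y x0 y0.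
  rewrite mulrAC ler_pdivrMr// => h.
  rewrite ler_pdivrMr// mulrAC ler_pdivlMr ?mulr_gt0//; lra.
pose step (a : R) i := 2 * pi * (Num.truncn (a * Q i.+1 / (2 * pi))).+1%:R / Q i.+1.
(* The first interval is [rho / (2 Q_0), rho / Q_0]: its left end keeps the angle positive, and its
   right end settles all j <= k at once, because Q_0 th <= rho. *)
pose a := fix a i : R := if i is i'.+1 then step (a i') i' else rho / (2 * Q 0).
pose b i := a i + rho / (2 * Q i).
have a0 i : 0 <= a i.
  case: i => [|i] /=; first by rewrite divr_ge0 ?mulr_ge0 ?(ltW rho0) ?(ltW (Q0 _)).
  by rewrite /step !mulr_ge0 ?invr_ge0 ?(ltW p0) ?(ltW (Q0 _)).
have pp0 : 0 < 2 * pi :> R by rewrite mulr_gt0.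
have aS i : a i <= a i.+1 /\ a i.+1 <= a i + 2 * pi / Q i.+1.
  have x0 : 0 <= a i * Q i.+1 / (2 * pi).
    by rewrite divr_ge0 ?(ltW pp0)// mulr_ge0 ?a0 ?(ltW (Q0 _)).
  have [t1 t2] : (Num.truncn (a i * Q i.+1 / (2 * pi)))%:R <= a i * Q i.+1 / (2 * pi) /\
      a i * Q i.+1 / (2 * pi) < (Num.truncn (a i * Q i.+1 / (2 * pi))).+1%:R.
    by split; [rewrite truncn_le//|exact: truncnS_gt].
  rewrite [a i.+1]/= /step; move: t1 t2; set m := Num.truncn _ => t1 t2; split.
    by rewrite ler_pdivlMr ?Q0// mulrC [_ * m.+1%:R]mulrC -ler_pdivrMr// ltW// mulrC.
  rewrite ler_pdivrMr ?Q0// [leRHS]mulrDl divfK ?gt_eqF ?Q0//.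
  have -> : 2 * pi * m.+1%:R = m%:R * (2 * pi) + 2 * pi :> R by ring.
  by rewrite lerD2r -ler_pdivlMr.
have bS i : b i.+1 <= b i.
  have := QS i; rewrite /b mulrDl => qs; have [_ a2] := aS i.
  have : rho / (2 * Q i.+1) <= rho / Q i.+1.
    rewrite ler_wpM2l ?(ltW rho0)// lef_pV2 ?posrE ?mulr_gt0 ?Q0//.
    by have := Q0 i.+1; lra.
  by move: (rho / (2 * Q i.+1)) (2 * pi / Q i.+1) qs a2 => x y; lra.
have amono i j : (i <= j)%N -> a i <= a j.
  by apply: (@homo_leq _ _ (fun x y : R => x <= y)) => [//|x y z|n]; [exact: le_trans|have [] := aS n].
have bmono i j : (i <= j)%N -> b j <= b i.
  by apply: (@homo_leq _ _ (fun x y : R => y <= x)) => [//|x y z h1 h2|n]; [exact: le_trans h2 h1|exact: bS].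
have ab i : a i <= b i by rewrite /b lerDl divr_ge0 ?mulr_ge0 ?(ltW rho0) ?(ltW (Q0 _)).
have abij i j : a i <= b j.
  have [ij|ij] := leqP i j; first exact: le_trans (amono _ _ ij) (ab j).
  exact: le_trans (ab i) (bmono _ _ (ltnW ij)).
pose th := sup (range a).
have hs : has_sup (range a).
  by split; [exists (a 0%N), 0%N|exists (b 0%N) => _ [i _ <-]].
have ath i : a i <= th by apply: ub_le_sup; [exact: hs.2|exists i].
have thb i : th <= b i by apply: ge_sup; [exact: hs.1|move=> _ [j _ <-]].
have kQ : Q 0 * th <= rho.
  have := thb 0%N; rewrite /b /= => h; rewrite mulrC -ler_pdivlMr ?Q0//.
  apply: (le_trans h); rewrite le_eqVlt; apply/orP; left; apply/eqP; field.
  by rewrite gt_eqF ?Q0.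
exists th; split.
- apply: lt_le_trans (ath 0%N); by rewrite /= divr_gt0 ?mulr_gt0 ?Q0.
- rewrite -(ler_pM2l (Q0 0%N)); apply: (le_trans kQ); rewrite -ler_pdivrMr//.
  apply: (le_trans (ltW (truncnS_gt _))); rewrite /Q ler_nat addn0.
  exact: leq_trans (leq_maxr k0 _) (leq_lacunary q_incr k).
move=> j; have [jk|kj] := leqP j k.
  apply: (le_trans (normc_cexpiB1 _)); rewrite ger0_norm; last first.
    by rewrite mulr_ge0// (le_trans (a0 0%N)).
  apply: le_trans kQ; rewrite ler_wpM2r ?(le_trans (a0 0%N))//.
  by rewrite /Q addn0 ler_nat; exact: lacunary_mono.
have [i ->] : exists i, j = (k + i.+1)%N by exists (j - k.+1)%N; rewrite addnS; lia.
rewrite -/(Q i.+1); set m := (Num.truncn (a i * Q i.+1 / (2 * pi))).+1.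
have aE : Q i.+1 * a i.+1 = m%:R * (2 * pi).
  by rewrite [a i.+1]/= /step -/m mulrC divfK ?gt_eqF ?Q0// mulrC.
have -> : cexpi (Q i.+1 * th) = cexpi (Q i.+1 * (th - a i.+1)) :> R[i].
  by rewrite -[in LHS](subrK (a i.+1) th) mulrDr aE cexpiD2pi.
apply: (le_trans (normc_cexpiB1 _)).
rewrite ger0_norm; last by rewrite mulr_ge0 ?subr_ge0 ?ath ?(ltW (Q0 _)).
have : th - a i.+1 <= rho / (2 * Q i.+1) by have := thb i.+1; rewrite /b; lra.
rewrite -(ler_pM2l (Q0 i.+1)) => h; apply: (le_trans h).
have -> : Q i.+1 * (rho / (2 * Q i.+1)) = rho / 2 by field; rewrite gt_eqF ?Q0.
lra.
Qed.

(** The largest multiple p th up to pi lies in [pi/2, pi], as th <= pi / 2; there |e^(ix) - 1|^2 = 2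
    - 2 cos x >= 2. The bound pi / (P + 2) on th forces p > P. *)
Lemma exists_half_turn (th : R) (P : nat) : 0 < th -> th <= pi / P.+2%:R ->
  exists2 p, (P < p)%N & 1 <= normc (cexpi (p%:R * th) - 1).
Proof.
move=> th0 thP; have p0 := @pi_gt0 R.
have th2 : th <= pi / 2.
  apply: (le_trans thP); rewrite ler_wpM2l ?(ltW p0)// lef_pV2 ?posrE// ler_nat//.
have x0 : 0 <= pi / th by rewrite divr_ge0 ?ltW.
exists (Num.truncn (pi / th)).
  have : P.+2%:R < (Num.truncn (pi / th)).+1%:R :> R; last by rewrite ltr_nat; lia.
  apply: le_lt_trans (truncnS_gt _); rewrite ler_pdivlMr// mulrC -ler_pdivlMr//.
have t1 : (Num.truncn (pi / th))%:R * th <= pi.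
  by rewrite -ler_pdivlMr// truncn_le.
have t2 : pi < (Num.truncn (pi / th))%:R * th + th.
  have := truncnS_gt (pi / th); rewrite ltr_pdivrMr// -natr1 mulrDl mul1r//.
move: t1 t2; set x := _ * th => t1 t2.
rewrite -(@ler_pXn2r _ 2) ?nnegrE ?normc_ge0// expr1n sqr_normc_cexpiB1.
have : cos x <= cos (pi / 2); last by rewrite cos_pihalf; lra.
by apply: cos_le_far; rewrite ?ger0_norm; lra.
Qed.

Lemma exists_angle_frequency (rho tau : R) (P : nat) : 0 < rho -> 0 < tau ->
  exists s : R * nat, [/\ 0 < s.1, s.1 <= tau, (P < s.2)%N,
    forall j, normc (cexpi ((q j)%:R * s.1) - 1) <= rho &
    1 <= normc (cexpi (s.2%:R * s.1) - 1)].
Proof.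
move=> rho0 tau0; have p0 := @pi_gt0 R.
have t0 : 0 < Num.min tau (pi / P.+2%:R) by rewrite lt_min tau0 divr_gt0.
have [th [th0 + hq]] := exists_lacunary_angle rho0 t0.
rewrite le_min => /andP[th1 th2]; have [p Pp hp] := exists_half_turn th0 th2.
by exists (th, p).
Qed.

(** The recursion runs on pairs of angle and frequency, so that p_n serves as the lower bound [P]
    for p_(n+1). *)
Lemma exists_angle_sequence (rho tau : nat -> R) : (forall n, 0 < rho n) ->
  (forall n, 0 < tau n) ->
  exists (th : nat -> R) (p : nat -> nat), (forall n, (p n < p n.+1)%N) /\
   forall n, [/\ 0 < th n, th n <= tau n,
    forall j, normc (cexpi ((q j)%:R * th n) - 1) <= rho n &
    1 <= normc (cexpi ((p n)%:R * th n) - 1)].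
Proof.
move=> rho0 tau0.
pose good (x : nat * nat) (y : R * nat) := [/\ 0 < y.1, y.1 <= tau x.1, (x.2 < y.2)%N,
  forall j, normc (cexpi ((q j)%:R * y.1) - 1) <= rho x.1 & 1 <= normc (cexpi (y.2%:R * y.1) - 1)].
have /boolp.choice[G hG] : forall x, exists y, good x y.
  by move=> [n P]; exact: exists_angle_frequency.
pose s := fix s n := if n is n'.+1 then G (n, (s n').2) else G (0%N, 0%N).
exists (fun n => (s n).1), (fun n => (s n).2); split=> [n|[|n]].
- by have [] := hG (n.+1, (s n).2).
- by have [] := hG (0%N, 0%N).
- by have [] := hG (n.+1, (s n).2).
Qed.

End LacunaryAngles.

(** * Main argument *)

Section AbsoluteSeries.
Context {R : realType}.
Local Notation mu := (@lebesgue_measure R).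
Local Notation T := (Tdom R).
Variables (a B : nat -> R).
Hypothesis aB : forall n m, \sum_(i < m) a (n + i)%N <= B n.

Lemma abs_series_limit (x : nat -> R) : (forall j, `|x j| <= a j) ->
  exists2 l, (fun J => \sum_(j < J) x j) @ \oo --> l & forall n, `|l - \sum_(j < n) x j| <= B n.
Proof.
move=> xa.
have nsE : [normed series x] = (fun n => \sum_(i < n) `|x i|).
  by apply/funext => n; rewrite -[LHS]/(\sum_(0 <= i < n) `|x i|) big_mkord.
have cs : cvgn (series x).
  apply: normed_cvg; rewrite nsE; apply: nondecreasing_is_cvgn.
    by apply/nondecreasing_seqP => n; rewrite big_ord_recr /= lerDl.
  exists (B 0%N) => _ [n _ <-]; apply: le_trans (aB 0 n).
  by apply: ler_sum => i _; rewrite add0n.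
have cl : (fun J => \sum_(j < J) x j) @ \oo --> limn (series x).
  by move: cs; rewrite seriesEord.
exists (limn (series x)) => // n; move: cl; set l := limn _ => cl.
rewrite leNgt; apply/negP => lt1.
have e0 : 0 < `|l - \sum_(j < n) x j| - B n by rewrite subr_gt0.
move/cvgrPdist_lt : cl => /(_ _ e0)[N _ hN].
have /= h := hN (n + N)%N (leq_addl _ _).
have h2 : `|\sum_(j < n + N) x j - \sum_(j < n) x j| <= B n.
  rewrite big_split_ord /= addrAC subrr add0r; apply: (le_trans (ler_norm_sum _ _ _)).
  by apply: le_trans (aB n N); apply: ler_sum => i _.
have := ler_distD (\sum_(j < n + N) x j) l (\sum_(j < n) x j).
by lra.
Qed.

(** The bound is stated at every real t, so that it also covers t + th. The factor 2 adds the cosine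
    and the sine series. *)
Lemma exists_frequency_sum (nu : nat -> R) : (forall j, 0 <= a j) ->
  exists f : R -> R[i], (forall D, cmeasurable_on D f) /\
   forall t n, normc (f t - \sum_(j < n) (a j)%:C * cexpi (nu j * t)) <= 2 * B n.
Proof.
move=> a0.
have ex (w : R -> R) : (forall x, `|w x| <= 1) -> measurable_fun setT w ->
    exists f : R -> R, (forall D, measurable_fun D f) /\
      forall t n, `|f t - \sum_(j < n) a j * w (nu j * t)| <= B n.
  move=> w1 mw.
  have xa t j : `|a j * w (nu j * t)| <= a j.
    by rewrite normrM (ger0_norm (a0 j)) ler_piMr.
  have /boolp.choice[f hf] : forall t, exists l,
      (fun J => \sum_(j < J) a j * w (nu j * t)) @ \oo --> l /\
      forall n, `|l - \sum_(j < n) a j * w (nu j * t)| <= B n.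
    by move=> t; have [l l1 l2] := abs_series_limit (xa t); exists l.
  exists f; split=> [D|t n]; last by have [] := hf t.
  apply: measurable_funTS.
  apply: (@measurable_fun_cvg _ _ R setT (fun J t => \sum_(j < J) a j * w (nu j * t))).
    move=> J; apply: measurable_sum => j; apply: measurable_funM; first exact: measurable_cst.
    apply: (@measurableT_comp _ _ _ _ _ _ w); first exact: mw.
    exact: measurable_linear.
  by move=> t _; have [] := hf t.
have [f1 [m1 h1]] := ex cos (fun x => cos_max x) (continuous_measurable_fun (@continuous_cos R)).
have [f2 [m2 h2]] := ex sin (fun x => sin_max x) (continuous_measurable_fun (@continuous_sin R)).
exists (fun t => Complex (f1 t) (f2 t)); split=> [D|t n]; first by split; [exact: m1|exact: m2].
have -> : \sum_(j < n) (a j)%:C * cexpi (nu j * t) =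
    Complex (\sum_(j < n) a j * cos (nu j * t)) (\sum_(j < n) a j * sin (nu j * t)).
  elim: n => [|n IH]; first by rewrite !big_ord0.
  rewrite !big_ord_recr /= IH; apply/eqP; rewrite eq_complex /=.
  by apply/andP; split; apply/eqP; ring.
apply: (le_trans (normc_le_ReIm _)); rewrite ReD ReN ImD ImN /=.
by have := h1 t n; have := h2 t n; lra.
Qed.

End AbsoluteSeries.

(** * Null sets, and uniform bounds off a small set *)

Section NullSets.
Context {R : realType}.
Local Notation mu := (@lebesgue_measure R).
Local Notation T := (Tdom R).

Lemma ae_shift (th : R) (P : R -> Prop) : {ae mu, forall t, P t} ->
  {ae mu, forall t, P (t + th)}.
Proof.
move=> [A [mA A0 PA]]; exists ((fun t => t + th) @^-1` A); split.
- exact: measurable_shift.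
- by rewrite lebesgue_measure_shift.
- by move=> t /= nP; apply: PA.
Qed.

(** The sets where all partial sums are at most M grow with M and exhaust T up to a null set;
    continuity of the measure from above does the rest. *)
Lemma exists_uniformly_bounded_set (S : nat -> R -> R[i]) (d : R) :
  (forall N, cmeasurable_on T (S N)) ->
  {ae mu, forall t, T t -> exists M : R, forall N, normc (S N t) <= M} -> 0 < d ->
  exists (M : R) (E : set R), [/\ 0 <= M, measurable E, E `<=` T, (mu (T `\` E) <= d%:E)%E &
    forall t, E t -> forall N, normc (S N t) <= M].
Proof.
move=> mS bnd d0; have mT := @measurable_Tdom R.
pose E (M : nat) := \bigcap_N (T `&` [set t | normc (S N t) <= M%:R]).
have mE M : measurable (E M).
  apply: bigcap_measurable => [|N _]; first by exists 0%N.
  rewrite (_ : [set t | _] = (fun t => normc (S N t)) @^-1` `]-oo, M%:R]%classic); last first.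
    by apply/seteqP; split=> t; rewrite /= in_itv.
  exact: (measurable_normc (mS N)).
have mF M : measurable (T `\` E M) by exact: measurableD.
have F0 : (mu (T `\` E 0%N) < +oo)%E.
  apply: le_lt_trans (@Tdom_lty R); apply: le_measure.
  - by rewrite inE; exact: mF.
  - by rewrite inE.
  - exact: subDsetl.
have Fdecr : {homo (fun M => T `\` E M) : n m / (n <= m)%N >-> (m <= n)%O}.
  move=> n m nm; apply/subsetPset => t [Tt nE]; split=> // tE; apply: nE => N _.
  have [_ /= h] := tE N I; split=> //=.
  by apply: (le_trans h); rewrite ler_nat.
have mcap : measurable (\bigcap_M (T `\` E M)) by apply: bigcap_measurable => //; exists 0%N.
have cap0 : mu (\bigcap_M (T `\` E M)) = 0%E.
  apply: measure_negligible => //; apply: negligibleS bnd => t /= tF bt.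
  have Tt : T t by have [] := tF 0%N I.
  have [M hM] := bt Tt; have [_] := tF (Num.truncn M).+1 I; apply=> N _; split=> //=.
  exact: le_trans (hM N) (ltW (truncnS_gt M)).
have : (fun M => mu (T `\` E M)) @ \oo --> 0%:E.
  rewrite (_ : 0%:E = mu (\bigcap_M (T `\` E M))); last exact: esym cap0.
  exact: nonincreasing_cvg_mu F0 mF mcap Fdecr.
move=> /fine_cvgP[fin /cvgrPdist_le/(_ _ d0) near1].
have [M _ hM] := filterI fin near1; have [f1 f2] := hM M (leqnn _).
exists M%:R, (E M); split=> //.
- by move=> t /(_ 0%N I) [].
- rewrite -[leLHS]fineK// lee_fin; apply: le_trans (ler_norm _) _.
  by move: f2; rewrite /= sub0r normrN.
- by move=> t tE N; have [] := tE N I.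
Qed.

End NullSets.

(** * The difference estimate at stage n *)

Section DifferenceSeries.
Context {R : realType}.
Local Notation mu := (@lebesgue_measure R).
Local Notation T := (Tdom R).

Lemma sum_shift_expr (u : nat -> R[i]) (z : R[i]) P N :
  \sum_(m < N) (if (P <= m)%N then u (m - P)%N else 0) * z ^+ m =
  z ^+ P * \sum_(m < N - P) u m * z ^+ m.
Proof.
elim: N => [|N IH]; first by rewrite sub0n !big_ord0 mulr0.
rewrite big_ord_recr /= IH; case: leqP => [PN|NP].
  rewrite subSn// big_ord_recr /= mulrDr; congr (_ + _).
  by rewrite mulrCA -exprD subnKC.
by rewrite mul0r addr0 (eqP (ltnW NP : N - P == 0)%N) (eqP (NP : N.+1 - P == 0)%N).
Qed.

Lemma sum_delta_expr (x z : R[i]) k N :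
  \sum_(m < N) (if m == k :> nat then x else 0) * z ^+ m = if (k < N)%N then x * z ^+ k else 0.
Proof.
elim: N => [|N IH]; first by rewrite big_ord0.
rewrite big_ord_recr /= IH ltnS [(k <= N)%N]leq_eqVlt [N == k]eq_sym.
by case: eqP => [->|_]; rewrite ?ltnn ?add0r//= mul0r addr0.
Qed.

Variables (p : nat -> nat) (a B : nat -> R) (f g h : R -> R[i]) (c : nat -> R[i]).
Hypothesis p_incr : forall j, (p j < p j.+1)%N.
Hypothesis a0 : forall j, 0 <= a j.
Hypothesis aB : forall n m, \sum_(i < m) a (n + i)%N <= B n.
Hypothesis mf : forall D, cmeasurable_on D f.
Hypothesis fB : forall t n,
  normc (f t - \sum_(j < n) (a j)%:C * cexpi (- (p j)%:R * t)) <= 2 * B n.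
Hypothesis mh : cmeasurable_on T h.

Let S N t : R[i] := \sum_(m < N) c m * cexpi (m%:R * t).

Hypothesis cvgS : {ae mu, forall t, T t ->
  (fun N => normc (S N t - g t)) @ \oo --> (0 : R) /\ f t = g t + h t}.

Variables (n : nat) (th H M kap e : R) (E : set R) (L : nat).
Hypothesis th0 : 0 <= th.
Hypothesis th_kap : th <= kap / 2.
Hypothesis kap1 : kap < 1.
Hypothesis mE : measurable E.
Hypothesis ET : E `<=` T.
Hypothesis muE : (mu (T `\` E) <= (kap / 4)%:E)%E.
Hypothesis SM : forall t, E t -> forall N, normc (S N t) <= M.
Hypothesis hH : (norm1 `[0%R, (2 * pi - th)%R[ (fun t => h (t + th) - h t)%R <= H%:E)%E.
Hypothesis half_turn : 1 <= normc (cexpi ((p n)%:R * th) - 1).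
Hypothesis e0 : 0 < e.

Let P := p n.
Let I : set R := `[0, 2 * pi - th[%classic.
Let K : set R := (I `&` E) `&` (fun t => t + th) @^-1` E.
Let dc m : R[i] := c m * (cexpi (m%:R * th) - 1).
Let x j : R[i] := (a j)%:C * (cexpi (- (p j)%:R * th) - 1).
(* Coefficients of e^(iPt) times the difference of the series of [c] minus
   the first n+1 terms of the series of [f]; the n-th term contributes to the
   constant coefficient [d 0] only. *)
Let d m : R[i] := (if (P <= m)%N then dc (m - P)%N else 0) -
  \sum_(j < n.+1) (if m == (P - p j)%N then x j else 0).
Let lim t : R[i] := cexpi (P%:R * t) * ((f (t + th) - f t) - (h (t + th) - h t)) -
  \sum_(j < n.+1) x j * cexpi (P%:R * t) * cexpi (- (p j)%:R * t).

Let mT : measurable T := @measurable_Tdom R.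
Let mI : measurable I. Proof. exact: measurable_itv. Qed.
Let mK : measurable K.
Proof. by apply: measurableI; [exact: measurableI|exact: measurable_shift]. Qed.
Let IT : I `<=` T.
Proof. by move=> t; rewrite /I /Tdom /= !in_itv /= => /andP[-> t2] /=; move: (th0); lra. Qed.
Let KI : K `<=` I. Proof. by move=> t [[]]. Qed.
Let KT : K `<=` T. Proof. by move=> t /KI /IT. Qed.

(** The losses are kap / 4 for E, kap / 4 for its translate, and th <= kap / 2 for the end of T,
    where t + th leaves T. *)
Let muK : (mu (T `\` K) <= kap%:E)%E.
Proof.
pose A : set R := `[2 * pi - th, 2 * pi[%classic.
have mA : measurable A by exact: measurable_itv.
have mTE : measurable (T `\` E) by exact: measurableD.
have mTE' := measurable_shift th mTE.
have sub : T `\` K `<=` ((T `\` E) `|` (fun t => t + th) @^-1` (T `\` E)) `|` A.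
  move=> t [Tt nK]; have := Tt; rewrite /Tdom /= in_itv /= => /andP[t0 t2].
  have [tI|tA] := ltP t (2 * pi - th); last by right; rewrite /A /= in_itv /= tA t2.
  have It : I t by rewrite /I /= in_itv /= t0.
  have [Et|nE] := pselect (E t); last by left; left.
  left; right; split; last by move=> Et'; apply: nK.
  rewrite /Tdom /= in_itv /=; apply/andP; split; last by lra.
  by rewrite addr_ge0.
apply: (@le_trans _ _ (mu (((T `\` E) `|` (fun t => t + th) @^-1` (T `\` E)) `|` A))).
  apply: le_measure => //; rewrite inE.
  - exact: measurableD.
  - by apply: measurableU => //; exact: measurableU.
have muA : (mu A <= (kap / 2)%:E)%E.
  rewrite /A lebesgue_measure_itv /= lte_fin gtrBl; case: ifP => t0; last first.
    by rewrite lee_fin (le_trans th0 th_kap).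
  by rewrite -EFinB lee_fin opprB addrC subrK.
have m1 := measureU2 mu mTE mTE'.
have m2 := measureU2 mu (measurableU _ _ mTE mTE') mA.
apply: (le_trans m2); rewrite (_ : kap = (kap / 4 + kap / 4) + kap / 2); last by lra.
rewrite EFinD; apply: leeD.
  apply: (le_trans m1); rewrite EFinD; apply: leeD => //.
  apply: le_trans muE; rewrite le_eqVlt; apply/orP; left; apply/eqP.
  exact: lebesgue_measure_shift.
exact: muA.
Qed.

Let d0E : d 0%N = - x n.
Proof.
(* If P = 0, the series of [c] contributes [dc 0], which vanishes: a difference has no constant
   term. *)
rewrite /d (_ : (if (P <= 0)%N then _ else 0) = 0); last first.
  by case: ifP => // _; rewrite sub0n /dc mul0r cexpi0 subrr mulr0.
rewrite sub0r big_ord_recr /= subnn eqxx big1 ?add0r// => j _.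
have lt_p : (p j < P)%N by exact: homo_ltn ltn_trans p_incr _ _ (ltn_ord j).
by rewrite ifF//; apply/negbTE; rewrite eq_sym -lt0n subn_gt0.
Qed.

Let normc_d0 : a n <= normc (d 0%N).
Proof.
rewrite d0E normcN /x Normc.normcM normc_real ger0_norm// ler_peMr//.
rewrite mulNr normc_cexpiNB1.
exact: half_turn.
Qed.

Let normc_x j : normc (x j) <= 2 * a j.
Proof.
rewrite /x Normc.normcM normc_real ger0_norm// mulrC ler_wpM2r//.
by apply: (le_trans (normcB_le _ _)); rewrite normc_cexpi Normc.normc1; lra.
Qed.

Let partial_sum N t : \sum_(m < N) d m * cexpi t ^+ m =
  cexpi (P%:R * t) * (S (N - P) (t + th) - S (N - P) t) -
  \sum_(j < n.+1) (if (P - p j < N)%N then x j * cexpi t ^+ (P - p j) else 0).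
Proof.
under eq_bigr do rewrite /d mulrBl mulr_suml.
rewrite sumrB exchange_big /= sum_shift_expr -cexpiMn; congr (_ * _ - _).
  rewrite /S -sumrB; apply: eq_bigr => m _; rewrite /dc -cexpiMn (mulrDr m%:R t th) cexpiD.
  by ring.
by apply: eq_bigr => j _; rewrite sum_delta_expr.
Qed.

Let partial_sum_bound t : K t -> forall N,
  normc (\sum_(m < N) d m * cexpi t ^+ m) <= 2 * M + 2 * B 0%N.
Proof.
move=> [[_ Et] Et'] N; rewrite partial_sum; apply: (le_trans (normcB_le _ _)); apply: lerD.
  rewrite Normc.normcM normc_cexpi mul1r; apply: (le_trans (normcB_le _ _)).
  by have := SM Et (N - P); have := SM Et' (N - P); lra.
apply: (le_trans (normc_sum _ _ _)); apply: (@le_trans _ _ (\sum_(j < n.+1) 2 * a j)).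
  apply: ler_sum => j _; case: ifP => _; last by rewrite Normc.normc0 mulr_ge0.
  by rewrite Normc.normcM normcX normc_cexpi expr1n mulr1.
by rewrite -mulr_sumr ler_wpM2l//; apply: aB 0%N n.+1.
Qed.

Let mS N D : cmeasurable_on D (S N).
Proof.
apply: cmeasurable_sum => m; apply: cmeasurableM; [exact: cmeasurable_cst|].
exact: cmeasurable_cexpi_lin.
Qed.

Let mlim : cmeasurable_on K lim.
Proof.
have shiftf : cmeasurable_on I (fun t => f (t + th)) by exact: cmeasurable_shift.
have shifth : cmeasurable_on I (fun t => h (t + th)) by exact: cmeasurable_shift.
have mhI : cmeasurable_on I h := cmeasurable_subset mT IT mh.
apply: (cmeasurable_subset mI KI); apply: cmeasurableB.
  apply: cmeasurableM; first exact: cmeasurable_cexpi_lin.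
  by apply: cmeasurableB; apply: cmeasurableB.
apply: cmeasurable_sum => j; apply: cmeasurableM; last exact: cmeasurable_cexpi_lin.
by apply: cmeasurableM; [exact: cmeasurable_cst|exact: cmeasurable_cexpi_lin].
Qed.

Let partial_sum_lim N t : f t = g t + h t -> f (t + th) = g (t + th) + h (t + th) ->
  \sum_(m < (P + N).+1) d m * cexpi t ^+ m - lim t =
  cexpi (P%:R * t) * ((S N.+1 (t + th) - g (t + th)) - (S N.+1 t - g t)).
Proof.
move=> E1 E2; rewrite partial_sum -addnS addKn /lim E1 E2.
rewrite (eq_bigr (fun j : 'I_n.+1 => x j * cexpi (P%:R * t) * cexpi (- (p j)%:R * t))); last first.
  move=> j _; have pj : (p j <= P)%N by apply: (homo_leq leqnn leq_trans (fun j => ltnW (p_incr j))); rewrite -ltnS.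
  rewrite ifT; last by rewrite addnS ltnS (leq_trans (leq_subr _ _))// leq_addr.
  by rewrite -cexpiMn -mulrA -cexpiD natrB//; congr (_ * cexpi _); ring.
ring.
Qed.

(** Up to a unimodular factor, [lim] is the difference of the tail [r] of [f] minus that of [h]. The
    former is at most 4 B_(n+1) pointwise, and T has length 2 pi. *)
Let norm1_lim : (norm1 K lim <= (8 * pi * B n.+1 + H)%:E)%E.
Proof.
pose r t := f t - \sum_(j < n.+1) (a j)%:C * cexpi (- (p j)%:R * t).
have limE t : lim t = cexpi (P%:R * t) * ((r (t + th) - r t) - (h (t + th) - h t)).
  rewrite /lim /r; have -> : \sum_(j < n.+1) x j * cexpi (P%:R * t) * cexpi (- (p j)%:R * t) =
    cexpi (P%:R * t) * (\sum_(j < n.+1) (a j)%:C * cexpi (- (p j)%:R * (t + th)) -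
       \sum_(j < n.+1) (a j)%:C * cexpi (- (p j)%:R * t)).
    rewrite -sumrB mulr_sumr; apply: eq_bigr => j _.
    by rewrite /x (mulrDr (- (p j)%:R) t th) cexpiD; ring.
  ring.
have mr D : cmeasurable_on D r.
  apply: cmeasurableB => //; apply: cmeasurable_sum => j.
  by apply: cmeasurableM; [exact: cmeasurable_cst|exact: cmeasurable_cexpi_lin].
have mr' : cmeasurable_on K (fun t => r (t + th) - r t).
  apply: (cmeasurable_subset mI KI); apply: cmeasurableB => //; exact: cmeasurable_shift.
have mh' : cmeasurable_on I (fun t => h (t + th) - h t).
  by apply: cmeasurableB; [exact: cmeasurable_shift|exact: cmeasurable_subset mT IT mh].
have mh'' := cmeasurable_subset mI KI mh'.
rewrite (eq_norm1 (g := fun t => (r (t + th) - r t) - (h (t + th) - h t))%R); last first.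
  by move=> t _; rewrite limE Normc.normcM normc_cexpi mul1r.
apply: (le_trans (norm1B mK mr' mh'')); rewrite EFinD; apply: leeD; last first.
  exact: le_trans (norm1_subset mK mI KI mh') hH.
have B0 : 0 <= B n.+1 by have := aB n.+1 0; rewrite big_ord0.
apply: (@le_trans _ _ (norm1 K (fun=> (4 * B n.+1)%:C))).
  apply: le_norm1 => // t _; rewrite normc_real ger0_norm ?mulr_ge0//.
  by apply: (le_trans (normcB_le _ _)); have := fB t n.+1; have := fB (t + th) n.+1; rewrite -/(r _) -/(r _); lra.
apply: (le_trans (norm1_subset mK mT KT (cmeasurable_cst _ _))).
rewrite /norm1 normc_real ger0_norm ?mulr_ge0// integral_cst//.
have M2 : mu T = (2 * pi)%:E := @lebesgue_measure_Tdom R.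
by rewrite [X in (_ * X <= _)%E]M2 -EFinM lee_fin le_eqVlt; apply/orP; left; apply/eqP; ring.
Qed.

Lemma difference_estimate : 2 * pi * a n * (1 - kap) ^+ L <=
  3 * (e + (8 * pi * B n.+1 + H)) + 63%:R * pi * (2 * M + 2 * B 0%N) * decay R ^+ L.
Proof.
have p0 := @pi_gt0 R.
(* The offset P + 1 makes the sums of [c] run over N + 1 terms and includes all the frequencies P -
   p_j from the start, so the subtracted polynomial cancels exactly. *)
pose w N t := \sum_(m < (P + N).+1) d m * cexpi t ^+ m - lim t.
have md N D : cmeasurable_on D (fun t => \sum_(m < N) d m * cexpi t ^+ m).
  apply: cmeasurable_sum => m; apply: cmeasurableM; first exact: cmeasurable_cst.
  by apply: cmeasurableX; exact: cmeasurable_cexpi_id.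
have mw N : cmeasurable_on K (w N) by exact: cmeasurableB.
have shiftS (v : nat -> R) l : v @ \oo --> l -> (fun N => v N.+1) @ \oo --> l.
  by rewrite -(cvg_shiftS v).
have wcvg : {ae mu, forall t, K t -> (forall N, normc (w N t) <= 4 * M) /\
                           (fun N => normc (w N t)) @ \oo --> (0 : R)}.
  move: (ae_shift th cvgS); move: cvgS; apply: ae_imply2 => t c1 c2 Kt.
  have [[_ Et] Et'] := Kt.
  have [c1l c1e] := c1 (ET Et); have [c2l c2e] := c2 (ET Et').
  (* On E the limit [g] inherits the bound M, whence the dominating constant 4 M. *)
  have gM s : E s -> (fun N => normc (S N s - g s)) @ \oo --> (0 : R) -> normc (g s) <= M.
    move=> Es cs; rewrite leNgt; apply/negP => lt1.
    have lt2 : 0 < normc (g s) - M by rewrite subr_gt0.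
    move/cvgrPdist_lt : cs => /(_ _ lt2)[N _ /(_ N (leqnn N))] /=.
    rewrite sub0r normrN ger0_norm ?normc_ge0// => h1.
    have := lerB_normc (g s) (S N s); rewrite normc_distC; have := SM Es N; lra.
  have g1 := gM _ Et c1l; have g2 := gM _ Et' c2l.
  have wE N : normc (w N t) <= normc (S N.+1 (t + th) - g (t + th)) + normc (S N.+1 t - g t).
    by rewrite /w partial_sum_lim// Normc.normcM normc_cexpi mul1r; exact: normcB_le.
  split=> [N|].
    apply: (le_trans (wE N)).
    have := normcB_le (S N.+1 (t + th)) (g (t + th)); have := normcB_le (S N.+1 t) (g t).
    by have := SM Et N.+1; have := SM Et' N.+1; lra.
  apply: (@squeeze_cvgr _ _ _ _ (fun=> 0) (fun N => normc (S N.+1 (t + th) - g (t + th)) +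
      normc (S N.+1 t - g t))).
  - by apply: nearW => N; rewrite normc_ge0 wE.
  - exact: cvg_cst.
  rewrite -[X in _ --> X](addr0 (0 : R)); apply: cvgD.
    exact: shiftS c2l.
  exact: shiftS c1l.
have [N0 hN] := norm1_cvg0 mK KT mw wcvg e0.
have nlim : (norm1 K (fun t => \sum_(m < (P + N0).+1) d m * cexpi t ^+ m)%R <=
    (e + (8 * pi * B n.+1 + H))%:E)%E.
  rewrite (eq_norm1 (g := fun t => w N0 t + lim t)%R); last first.
    by move=> t _; rewrite /w subrK.
  apply: (le_trans (norm1D mK (mw N0) mlim)); rewrite EFinD; apply: leeD => //.
  exact: hN.
have main := main_estimate L mK KT muK kap1 partial_sum_bound (ltn0Sn (P + N0)).
rewrite -lee_fin; apply: (@le_trans _ _ (2 * pi * normc (d 0%N) * (1 - kap) ^+ L)%:E).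
  rewrite lee_fin ler_wpM2r ?exprn_ge0 ?subr_ge0 ?(ltW kap1)//.
  by rewrite ler_wpM2l ?mulr_ge0// ltW.
apply: (le_trans main); rewrite [leRHS]EFinD; apply: leeD; last exact: lexx.
by rewrite [leRHS]EFinM; apply: lee_wpmul2l; [rewrite lee_fin|exact: nlim].
Qed.

End DifferenceSeries.

Lemma sum_doubly_exp_le (R : realType) (g : R) (n m : nat) : 0 < g -> g < 1 ->
  \sum_(i < m) g ^+ (2 * 4 ^ (n + i)) <= g ^+ (2 * 4 ^ n) / (1 - g).
Proof.
move=> g0 g1; have g10 : 0 < 1 - g by rewrite subr_gt0.
apply: (@le_trans _ _ (\sum_(i < m) g ^+ (2 * 4 ^ n) * g ^+ i)).
  apply: ler_sum => i _; rewrite -exprD; apply: ler_wiXn2l; rewrite ?(ltW g0) ?(ltW g1)//.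
  rewrite expnD; have i4 : (i < 4 ^ i)%N by exact: ltn_expl.
  have n4 : (0 < 4 ^ n)%N by rewrite expn_gt0.
  nia.
rewrite -mulr_sumr ler_wpM2l ?exprn_ge0 ?(ltW g0)//.
by apply: sum_expr_le; rewrite (ltW g0).
Qed.

Theorem theorem2 (R : realType) (q : nat -> nat)
  (q_pos : forall k, (0 < q k)%N)
  (q_incr : forall k, (q k < q k.+1)%N)
  (q_lac : (fun k => (q k.+1)%:R / (q k)%:R : R) @ \oo --> +oo) :
  exists f : R -> R[i], cmeasurable f /\
    ~ (exists g h : R -> R[i], PLA g /\ LS (negQ q) h /\
         {ae (@lebesgue_measure R), forall t, Tdom R t -> f t = g t + h t}).
Proof.
pose r := decay R; have r0 : 0 < r := @decay_gt0 R; have r1 : r < 1 := @decay_lt1 R.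
have p0 := @pi_gt0 R.
(* Every quantity of stage n is compared with a power of x_n: the coefficient is x_n^2, the tail of
   order x_n^8, the difference of h of order x_n^4; for L = 4 * 4^n also r^L = x_n^4 and (1-kap)^L
   >= x_n. Thus x_n^2 x_n <= const * x_n^4, with one factor x_n to spare. *)
pose x n := r ^+ (4 ^ n); pose a n := r ^+ (2 * 4 ^ n); pose B n := a n / (1 - r).
have r10 : 0 < 1 - r by rewrite subr_gt0.
have x0 n : 0 < x n by exact: exprn_gt0.
have x1 n : x n <= 1 by apply: exprn_ile1; exact: ltW.
have aE n : a n = x n ^+ 2 by rewrite /a mulnC exprM.
have BE n : B n.+1 = x n ^+ 8 / (1 - r) by rewrite /B /a expnS mulnA mulnC exprM.
have a0 n : 0 <= a n by rewrite aE exprn_ge0 ?ltW.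
(* Chosen so that Bernoulli's bound 1 - 4 kap equals r. *)
pose kap := (1 - r) / 4; have kap0 : 0 < kap by rewrite divr_gt0.
have kap1 : kap < 1 by rewrite /kap; lra.
have kapr : r <= (1 - kap) ^+ 4.
  apply: le_trans (bernoulli_le 4 _); last by rewrite (ltW kap0) ltW.
  by rewrite /kap mulrC divfK// opprB addrC subrK.
have [th [p [p_incr angle]]] := exists_angle_sequence q_pos q_incr q_lac
  (rho := fun n => x n ^+ 4) (tau := fun=> kap / 2) (fun n => exprn_gt0 4 (x0 n))
  (fun=> divr_gt0 kap0 (ltr0n _ 2)).
have aB n m : \sum_(i < m) a (n + i)%N <= B n by exact: sum_doubly_exp_le.
have [f [mf fB]] := exists_frequency_sum aB (fun j => - (p j)%:R) a0.
exists f; split; first exact: mf.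
move=> [g [h [[mg [c cvgc]] [hQ fgh]]]].
pose S N t : R[i] := \sum_(m < N) c m * cexpi (m%:R * t).
have cvgS : {ae (@lebesgue_measure R), forall t, Tdom R t ->
    (fun N => normc (S N t - g t)) @ \oo --> (0 : R) /\ f t = g t + h t}.
  move: fgh; move: cvgc; apply: ae_imply2 => t c1 c2 Tt; split; last exact: c2.
  by have := c1 Tt; under eq_fun do rewrite big_mkord.
have mS N : cmeasurable_on (Tdom R) (S N).
  apply: cmeasurable_sum => m; apply: cmeasurableM; [exact: cmeasurable_cst|].
  exact: cmeasurable_cexpi_lin.
have bndS : {ae (@lebesgue_measure R), forall t, Tdom R t ->
    exists M : R, forall N, normc (S N t) <= M}.
  move: cvgS; apply: ae_imply => t ct Tt; have [c1 _] := ct Tt.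
  have [M0 [_ hM]] : bounded_fun (fun N => normc (S N t - g t)).
    by apply: cvg_seq_bounded; apply/cvg_ex; exists 0.
  exists (M0 + 1 + normc (g t)) => N; have /= := hM (M0 + 1) _ N I.
  rewrite ltrDl ltr01 ger0_norm ?normc_ge0// => /(_ isT) h1.
  by move: h1; have := le_normcD (S N t - g t) (g t); rewrite subrK; lra.
have kap40 : 0 < kap / 4 by rewrite divr_gt0.
(* The set and the bound depend on g but not on n. This is why [kap] is fixed once and all angles
   are required only to be at most kap / 2. *)
have [M [E [M0 mE ET muE SM]]] := exists_uniformly_bounded_set mS bndS kap40.
have [k3 hk3] := lacunary_ratio_ge q_pos q_lac 3.
have [|A hA] := square_summable q_pos q_incr hQ.
  exists k3 => k kk; have := hk3 k kk.
  by rewrite -natrM ler_nat.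
have window := window_square_le q_incr hQ hA.
have A0 : 0 <= A by have := hA 0%N; rewrite big_ord0.
(* In units of x_n^4 the slack [e], taken to be x_n^4 itself, contributes 1, the tail at most 8 pi /
   (1 - r), and the difference of h contributes 1 + A; the last summand is the coefficient of r^L.
   None of these depends on n. *)
pose C := 3 * (1 + 8 * pi / (1 - r) + (1 + A)) + 63%:R * pi * (2 * M + 2 * B 0%N).
have B00 : 0 <= B 0%N by rewrite divr_ge0// ltW.
have D0 : 0 <= 8 * pi / (1 - r).
  by apply: divr_ge0; [apply: mulr_ge0 => //; exact: ltW|exact: ltW].
have W0 : 0 <= 63%:R * pi * (2 * M + 2 * B 0%N).
  by apply: mulr_ge0; [apply: mulr_ge0 => //; exact: ltW|apply: addr_ge0; exact: mulr_ge0].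
have C0 : 0 < C by rewrite /C; move: W0; set W := 63%:R * _ * _ => W0; lra.
have key n : 2 * pi <= C * x n.
  have [th0 thk thq half] := angle n.
  have x40 : 0 < x n ^+ 4 by exact: exprn_gt0.
  have hH := norm1_diff_le hQ window x40 thq (ltW th0).
  have := difference_estimate p_incr a0 aB mf fB (cintegrable_measurable hQ.1) cvgS
    (4 * 4 ^ n)%N (ltW th0) thk kap1 mE ET muE SM hH half x40.
  rewrite -/r BE aE => est.
  have xk : x n <= (1 - kap) ^+ (4 * 4 ^ n).
    rewrite exprM /x; apply: lerXn2r kapr; rewrite nnegrE; first exact: ltW.
    by rewrite exprn_ge0// subr_ge0 ltW.
  have x8 : x n ^+ 8 <= x n ^+ 4 by apply: ler_wiXn2l; rewrite ?(ltW (x0 n)).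
  have rx : r ^+ (4 * 4 ^ n) = x n ^+ 4 by rewrite mulnC exprM.
  have lhs : 2 * pi * x n ^+ 2 * x n <= 2 * pi * x n ^+ 2 * (1 - kap) ^+ (4 * 4 ^ n).
    by rewrite ler_wpM2l// !mulr_ge0 ?exprn_ge0// ltW.
  have x8' : 8 * pi * (x n ^+ 8 / (1 - r)) <= 8 * pi / (1 - r) * x n ^+ 4.
    rewrite mulrA mulrAC; exact: ler_wpM2l.
  have := le_trans lhs est; rewrite rx => {}est.
  have {}est : 2 * pi * x n ^+ 2 * x n <= C * x n ^+ 4.
    apply: (le_trans est); rewrite /C [leRHS]mulrDl; apply: lerD; last exact: lexx.
    rewrite -[leRHS]mulrA; apply: ler_wpM2l => //; move: x8'.
    move: (8 * pi / (1 - r)) (8 * pi * _) (x n ^+ 4) => u v w; lra.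
  rewrite -(ler_pM2r (exprn_gt0 3 (x0 n))); move: est.
  rewrite (_ : C * x n * x n ^+ 3 = C * x n ^+ 4); last by ring.
  by rewrite (_ : 2 * pi * x n ^+ 2 * x n = 2 * pi * x n ^+ 3 :> R); last by ring.
have [k hk] : exists k, r ^+ k < 2 * pi / C.
  by apply: exists_expr_lt; rewrite ?(ltW r0)// divr_gt0// mulr_gt0.
have := key k; rewrite leNgt => /negP; apply.
rewrite mulrC -ltr_pdivlMr//; apply: le_lt_trans hk.
apply: ler_wiXn2l; rewrite ?(ltW r0) ?(ltW r1)//.
exact/ltnW/ltn_expl.
Qed.
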